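(* Let $n\ge 1$ and let $\Sigma\subset\mathbb{S}^{2n}_+$ be a spherical cap. Then $$\int_{C_\Sigma}\frac{|\nabla_{\mathbb{H}}^\perp u|^2}{\psi}\,dp\ \ge\ \frac{n^2}{4}\int_{C_\Sigma}\frac{|u|^2}{\delta^2}\,\psi\,dp,\qquad\forall u\in C_c^\infty(C_\Sigma).$$ Moreover, the inequality is sharp, in the sense that $$c_n^\perp(\Sigma,\psi):=\inf_{0\neq u\in C_c^\infty(C_\Sigma)}\frac{\int_{C_\Sigma}\psi^{-1}|\nabla_{\mathbb{H}}^\perp u|^2\,dp}{\int_{C_\Sigma}\psi\,|u|^2\delta^{-2}\,dp}=\frac{n^2}{4}.$$
   Context: The Heisenberg group $\mathbb{H}^n$ is $\mathbb{R}^{2n+1}$ with points $(x,y,z)\in\mathbb{R}^n\times\mathbb{R}^n\times\mathbb{R}$ (write $\xi=(x,y)$), endowed with the sub-Riemannian structure whose (horizontal) distribution $\mathcal{D}$ has orthonormal frame $$X_i=\partial_{x_i}-\frac{y_i}{2}\partial_z,\qquad Y_i=\partial_{y_i}+\frac{x_i}{2}\partial_z,\qquad i=1,\dots,n,$$ with associated metric $\langle\cdot,\cdot\rangle$ and norm $|\cdot|$ on $\mathcal{D}$. The Carnot-Carathéodory distance from the origin is $\delta(p)=\inf\int_0^1|\dot\gamma(t)|\,dt$, over absolutely continuous curves $\gamma:[0,1]\to\mathbb{H}^n$ with $\dot\gamma(t)\in\mathcal{D}_{\gamma(t)}$ for a.e. $t$, $\gamma(0)=0$, $\gamma(1)=p$.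 It is smooth outside the center $\mathcal{Z}=\{x=y=0\}$. The horizontal gradient is $\nabla_{\mathbb{H}}u=\sum_{i=1}^n\big((X_iu)X_i+(Y_iu)Y_i\big)$, and $\nabla_{\mathbb{H}}^\perp u$ denotes, on $\mathbb{H}^n\setminus\mathcal{Z}$, the component of $\nabla_{\mathbb{H}}u$ orthogonal to the (unit) field $\nabla_{\mathbb{H}}\delta$, i.e. $\nabla_{\mathbb{H}}^\perp u=\nabla_{\mathbb{H}}u-\langle\nabla_{\mathbb{H}}u,\nabla_{\mathbb{H}}\delta\rangle\nabla_{\mathbb{H}}\delta$. Integration $dp$ is with respect to Lebesgue measure. Let $\varrho_\lambda(x,y,z)=(\lambda x,\lambda y,\lambda^2z)$ for $\lambda>0$, and $\mathbb{S}^{2n}_+=\{|x|^2+|y|^2+z^2=1,\ z>0\}$. Spherical caps $\Sigma\subset\mathbb{S}^{2n}_+$ are (open, nonempty) caps centered at the north pole $(0,0,1)$, possibly all of $\mathbb{S}^{2n}_+$. The associated homogeneous cone is $C_\Sigma=\{\varrho_\lambda(p):\lambda>0,\ p\in\Sigma\}$; it equals $\{(x,y,z): |x|^2+|y|^2<\alpha_\Sigma z\}$ for a unique $\alpha_\Sigma\in(0,+\infty]$ (with $\alpha_\Sigma=+\infty$ meaning $\{z>0\}$). Let $\phi:[0,2\pi]\to[0,+\infty]$ be the order-reversing bijection $\phi(r)=\dfrac{4(1-\cos r)}{r-\sin r}$, $\phi(0)=+\infty$. For $z>0$ define $\psi(\xi,z)=\phi^{-1}(|\xi|^2/z)\in(0,2\pi]$;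 in particular $\psi(0,z)=2\pi$. *)

(* Defs.v *)
From HB Require Import structures.
From mathcomp Require Import all_boot all_order all_algebra.
From mathcomp Require Import all_classical all_reals all_analysis.

Set Implicit Arguments.
Unset Strict Implicit.
Unset Printing Implicit Defensive.

Import Order.TTheory GRing.Theory Num.Theory.
Import numFieldNormedType.Exports.

Local Open Scope classical_set_scope.
Local Open Scope ring_scope.

Definition rV_display : measure_display -> measure_display.
Proof. exact. Qed.

Section measurable_rV.
Context {d} {T : measurableType d}.
Variable n : nat.

Let coors : 'I_n -> 'rV[T]_n -> T := fun i x => x ord0 i.

Let rV_set0 : g_sigma_preimage coors set0.
Proof. exact: sigma_algebra0. Qed.

Let rV_setC A : g_sigma_preimage coors A -> g_sigma_preimage coors (~` A).
Proof. exact: sigma_algebraC. Qed.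

Let rV_bigcup (F : _^nat) : (forall i, g_sigma_preimage coors (F i)) ->
  g_sigma_preimage coors (\bigcup_i (F i)).
Proof. exact: sigma_algebra_bigcup. Qed.

(* The product sigma-algebra on 'rV[T]_n; for T = R this is the Borel one. *)
HB.instance Definition _ := @isMeasurable.Build (rV_display d)
  'rV[T]_n (g_sigma_preimage coors) rV_set0 rV_setC rV_bigcup.

End measurable_rV.

Section rV_measurability.
Context d d' (T : measurableType d) (S : measurableType d') (n : nat).

Lemma measurable_coord (i : 'I_n) :
  measurable_fun [set: 'rV[T]_n] (fun x => x ord0 i).
Proof.
move=> _ Y mY; rewrite setTI; apply: sub_sigma_algebra => /=.
rewrite -bigcup_seq/=; exists i => /=; first by rewrite mem_index_enum.
by exists Y => //; rewrite setTI.
Qed.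

Lemma measurable_fun_rV (f : S -> 'rV[T]_n) :
  (forall i, measurable_fun [set: S] (fun x => f x ord0 i)) ->
  measurable_fun [set: S] f.
Proof.
move=> mf.
have : g_sigma_preimage (fun i => (fun x : 'rV[T]_n => x ord0 i) \o f)
   `<=` measurable.
  apply: smallest_sub; first exact: sigma_algebra_measurable.
  case: n f mf => [|m] f mf; first by rewrite big_ord0.
  rewrite -bigcup_mkord_ord; apply: bigcup_sub => i Ii.
  by move=> A [B mB <-]; exact: mf.
rewrite g_sigma_preimage_comp => prefS _ A mA.
by apply: prefS; exists A.
Qed.

End rV_measurability.

Lemma sigma_finite_prod d1 d2 (T1 : measurableType d1) (T2 : measurableType d2)
    (R : realType) (m1 : {measure set T1 -> \bar R})
    (m2 : {sigma_finite_measure set T2 -> \bar R}) :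
  sigma_finite setT m1 -> sigma_finite setT (m1 \x m2)%E.
Proof.
move=> /sigma_finiteP[F [TF ndF Foo]].
have /sigma_finiteP[G [TG ndG Goo]] := sigma_finiteT m2.
exists (fun n => F n `*` G n).
 rewrite -setXTT TF TG predeqE => -[x y]; split.
    move=> [/= [n _ Fnx] [k _ Gky]]; exists (maxn n k) => //; split.
    - by move: x Fnx; exact/subsetPset/ndF/leq_maxl.
    - by move: y Gky; exact/subsetPset/ndG/leq_maxr.
  by move=> [n _ []/= ? ?]; split; exists n.
move=> k; have [? ?] := Foo k; have [? ?] := Goo k.
split; first exact: measurableX.
by rewrite product_measure1E// lte_mul_pinfty// ge0_fin_numE.
Qed.

Section lebesgue_rV_step.
Context (R : realType) (n : nat).
Local Open Scope ereal_scope.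

Definition rV_cons (p : measurableTypeR R * 'rV[measurableTypeR R]_n) :
    'rV[measurableTypeR R]_n.+1 :=
  \row_(i < n.+1) oapp (fun j : 'I_n => p.2 ord0 j) p.1 (unlift ord0 i).

Lemma measurable_rV_cons : measurable_fun setT rV_cons.
Proof.
apply: measurable_fun_rV => i; rewrite /rV_cons.
case: (unliftP ord0 i) => [j ->|->].
- rewrite (_ : (fun _ => _) = (fun x : 'rV[measurableTypeR R]_n => x ord0 j) \o snd); last first.
    by apply/funext => x; rewrite mxE liftK.
  by apply: measurableT_comp => //; exact: measurable_coord.
- rewrite (_ : (fun _ => _) = fst) //.
  by apply/funext => x; rewrite mxE unlift_none.
Qed.

Variable m : {sigma_finite_measure set 'rV[measurableTypeR R]_n -> \bar R}.


Definition lebesgue_rV_succ : set 'rV[measurableTypeR R]_n.+1 -> \bar R :=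
  pushforward (@lebesgue_measure R \x m) rV_cons.

Let succ0 : lebesgue_rV_succ set0 = 0.
Proof. by rewrite /lebesgue_rV_succ /pushforward preimage_set0 measure0. Qed.

Let succ_ge0 A : 0 <= lebesgue_rV_succ A.
Proof. exact: (measure_ge0 (@lebesgue_measure R \x m)). Qed.

Let succ_sigma_additive : semi_sigma_additive lebesgue_rV_succ.
Proof.
move=> F mF tF mUF; rewrite /lebesgue_rV_succ /pushforward preimage_bigcup.
have mp k : measurable (rV_cons @^-1` F k).
  by rewrite -[X in measurable X]setTI; exact: measurable_rV_cons.
apply: measure_semi_sigma_additive => //; last exact: bigcupT_measurable.
apply/trivIsetP => /= i j _ _ ij; rewrite -preimage_setI.
by move/trivIsetP : tF => /(_ _ _ _ _ ij) ->//; rewrite preimage_set0.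
Qed.

HB.instance Definition _ := isMeasure.Build _ _ _ lebesgue_rV_succ
  succ0 succ_ge0 succ_sigma_additive.

Lemma measurable_rV_head :
  measurable_fun setT (fun x : 'rV[measurableTypeR R]_n.+1 => x ord0 ord0).
Proof. exact: measurable_coord. Qed.

Lemma measurable_rV_tail :
  measurable_fun setT (fun x : 'rV[measurableTypeR R]_n.+1 =>
    (\row_(j < n) x ord0 (lift ord0 j) : 'rV[measurableTypeR R]_n)).
Proof.
apply: measurable_fun_rV => i; rewrite (_ : (fun _ => _) =
  (fun x : 'rV[measurableTypeR R]_n.+1 => x ord0 (lift ord0 i))).
  exact: measurable_coord.
by apply/funext => x; rewrite mxE.
Qed.

Let succ_sigma_finite : sigma_finite setT lebesgue_rV_succ.
Proof.
have [F FT Foo] := sigma_finite_prod m (sigma_finiteT (@lebesgue_measure R)).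
pose g (x : 'rV[measurableTypeR R]_n.+1) :
    measurableTypeR R * 'rV[measurableTypeR R]_n :=
  (x ord0 ord0, \row_(j < n) x ord0 (lift ord0 j)).
have mg : measurable_fun setT g.
  by apply: measurable_fun_pair; [exact: measurable_rV_head
                                 |exact: measurable_rV_tail].
have gK p : g (rV_cons p) = p.
  rewrite /g /rV_cons mxE unlift_none /=; case: p => a b /=; congr pair.
  by apply/rowP => j; rewrite !mxE liftK.
exists (fun k => g @^-1` F k).
  by rewrite -preimage_bigcup -FT preimage_setT.
move=> k; have [mFk Fk] := Foo k; split.
  by rewrite -[X in measurable X]setTI; exact: mg.
rewrite /lebesgue_rV_succ /pushforward -comp_preimage.
by rewrite (_ : g \o rV_cons = id) //; apply/funext => p; exact: gK.
Qed.

HB.instance Definition _ := Measure_isSigmaFinite.Build _ _ _ lebesgue_rV_succ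
  succ_sigma_finite.

End lebesgue_rV_step.

(* Product Lebesgue measure on R^n, built coordinate by coordinate; see
   lebesgue_rV_box. *)
Fixpoint lebesgue_rV (R : realType) (n : nat) :
    {sigma_finite_measure set 'rV[measurableTypeR R]_n -> \bar R} :=
  match n with
  | 0 => dirac (0 : 'rV[measurableTypeR R]_0)
  | n'.+1 => lebesgue_rV_succ (lebesgue_rV R n')
  end.

Lemma lebesgue_rV_box (R : realType) (n : nat)
    (A : 'I_n -> set (measurableTypeR R)) :
  (forall i, measurable (A i)) ->
  lebesgue_rV R n [set x | forall i, A i (x ord0 i)] =
    (\prod_(i < n) lebesgue_measure (A i))%E.
Proof.
elim: n A => [|n IH] A mA.
  rewrite big_ord0 /= diracE (_ : _ \in _ = true) //.
  by apply/mem_set => -[].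
pose B : set 'rV[measurableTypeR R]_n :=
  [set y | forall i, A (lift ord0 i) (y ord0 i)].
have mB : measurable B.
  suff -> : B = \bigcap_(i in [set: 'I_n])
      ((fun y : 'rV[measurableTypeR R]_n => y ord0 i) @^-1` A (lift ord0 i)).
    apply: fin_bigcap_measurable => // i _.
    by rewrite -[X in measurable X]setTI; exact: measurable_coord.
  by apply/seteqP; split => y By i => [_|]; exact: By.
rewrite big_ord_recl -IH// -product_measure1E//.
transitivity ((@lebesgue_measure R \x lebesgue_rV R n)%E
  (@rV_cons R n @^-1` [set x | forall i, A i (x ord0 i)])); first by [].
apply: (f_equal (@lebesgue_measure R \x lebesgue_rV R n)%E).
apply/seteqP; split => [[a y]|[a y]] /=.
  move=> Ay; split; first by have := Ay ord0; rewrite mxE unlift_none.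
  by move=> i; have := Ay (lift ord0 i); rewrite mxE liftK.
move=> [Aa Ay] i; rewrite mxE; case: (unliftP ord0 i) => [j ->|->] //=.
Qed.

Definition lebesgue_heis (R : realType) (n : nat) :
  set ('rV[measurableTypeR R]_n * 'rV[measurableTypeR R]_n * measurableTypeR R)
    -> \bar R :=
  (lebesgue_rV R n \x lebesgue_rV R n \x @lebesgue_measure R)%E.
HB.instance Definition _ R n := Measure.on (@lebesgue_heis R n).

Lemma lebesgue_heis_sigma_finite R n : sigma_finite setT (@lebesgue_heis R n).
Proof. by do 2 apply: sigma_finite_prod; exact: sigma_finiteT. Qed.

HB.instance Definition _ R n := Measure_isSigmaFinite.Build _ _ _
  (@lebesgue_heis R n) (lebesgue_heis_sigma_finite R n).

(* A point (x, y, z) of the Heisenberg group is the triple p with p.1.1 = x,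
   p.1.2 = y and p.2 = z; tangent vectors are triples as well. *)
Notation heis R n := ('rV[R]_n * 'rV[R]_n * R)%type.

Section Heisenberg.
Context {R : realType} {n : nat}.
Implicit Types (p v w : heis R n) (u : heis R n -> R) (S : set (heis R n)).

Definition Xfield (i : 'I_n) p : heis R n :=
  (delta_mx ord0 i, 0, - (p.1.2 ord0 i / 2)).

Definition Yfield (i : 'I_n) p : heis R n :=
  (0, delta_mx ord0 i, p.1.1 ord0 i / 2).

Definition distribution p : set (heis R n) :=
  [set v | exists a b : 'rV[R]_n,
    v = \sum_i (a ord0 i *: Xfield i p + b ord0 i *: Yfield i p)].

(* A vector of the distribution at p has its first 2n coordinates as
   coefficients in the frame (X_i, Y_i), so the metric making this frame
   orthonormal reads the same at every p (see hinner_frame below).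
   Only meaningful on horizontal vectors. *)
Definition hinner v w : R :=
  \sum_i (v.1.1 ord0 i * w.1.1 ord0 i + v.1.2 ord0 i * w.1.2 ord0 i).

Definition hnorm v : R := Num.sqrt (hinner v v).

Lemma hinner_frame p (a b c d : 'rV[R]_n) :
  hinner (\sum_i (a ord0 i *: Xfield i p + b ord0 i *: Yfield i p))
         (\sum_i (c ord0 i *: Xfield i p + d ord0 i *: Yfield i p)) =
  \sum_i (a ord0 i * c ord0 i + b ord0 i * d ord0 i).
Proof.
have E1 (e f : 'rV[R]_n) :
    (\sum_i (e ord0 i *: Xfield i p + f ord0 i *: Yfield i p)).1 = (e, f).
  rewrite (raddf_sum fst) (_ : \sum_i _ =
    \sum_i (e ord0 i *: delta_mx ord0 i, f ord0 i *: delta_mx ord0 i)); last first.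
    by apply: eq_bigr => i _; congr pair; rewrite /= scaler0 ?addr0 ?add0r.
  rewrite [LHS]surjective_pairing (raddf_sum fst) (raddf_sum snd) /=.
  by rewrite -!row_sum_delta.
by rewrite /hinner !E1.
Qed.

(* The non-overlapping intervals below may be degenerate. *)
Definition abs_continuous (V : normedModType R) (a b : R) (f : R -> V) : Prop :=
  forall e : R, 0 < e -> exists2 d : R, 0 < d &
    forall (m : nat) (l r : 'I_m -> R),
      (forall i, [/\ a <= l i, l i <= r i & r i <= b]) ->
      trivIset setT (fun i => `]l i, r i[%classic) ->
      \sum_i (r i - l i) < d -> \sum_i `|f (r i) - f (l i)| < e.

Definition horizontal_curve (g : R -> heis R n) : Prop :=
  abs_continuous 0 1 g /\
  {ae lebesgue_measure, forall t : R, `[0, 1]%classic t ->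
    derivable g t 1 /\ distribution (g t) (derive1 g t)}.

Definition curve_length (g : R -> heis R n) : \bar R :=
  (\int[lebesgue_measure]_(t in `[0%R, 1%R]) (hnorm (derive1 g t))%:E)%E.

Definition cc_dist0 p : R :=
  fine (ereal_inf [set curve_length g | g in
    [set g : R -> heis R n | [/\ horizontal_curve g, g 0 = 0 & g 1 = p]]]).

Definition hgrad u p : heis R n :=
  \sum_i ('D_(Xfield i p) u p *: Xfield i p + 'D_(Yfield i p) u p *: Yfield i p).

(* Takes a meaningless value on the center x = y = 0, where cc_dist0 is not
   differentiable; the center is Lebesgue-negligible. *)
Definition hgrad_perp u p : heis R n :=
  hgrad u p - hinner (hgrad u p) (hgrad cc_dist0 p) *: hgrad cc_dist0 p.

Definition sqnorm_xy p : R :=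
  \sum_i (p.1.1 ord0 i ^+ 2 + p.1.2 ord0 i ^+ 2).

Definition dilation (l : R) p : heis R n := (l *: p.1.1, l *: p.1.2, l ^+ 2 * p.2).

Definition upper_sphere : set (heis R n) :=
  [set p | sqnorm_xy p + p.2 ^+ 2 = 1 /\ 0 < p.2].

(* Open caps around the north pole (0, 0, 1), cut off by a plane {z = c};
   c = 0 gives the whole open upper hemisphere. *)
Definition spherical_cap S : Prop :=
  exists2 c : R, 0 <= c < 1 & S = upper_sphere `&` [set p | c < p.2].

Definition homogeneous_cone S : set (heis R n) :=
  [set q | exists l p, [/\ 0 < l, S p & q = dilation l p]].

Definition phi (r : R) : \bar R :=
  if r == 0 then +oo%E else ((4 * (1 - cos r)) / (r - sin r))%:E.

(* Used only where p.2 > 0. *)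
Definition psi p : R := pinv `[0, 2 * pi]%classic phi ((sqnorm_xy p / p.2)%:E).

Definition iter_derive u (s : seq (heis R n)) : heis R n -> R :=
  foldr (fun v f => 'D_v f) u s.

Definition smooth u : Prop :=
  forall (s : seq (heis R n)) p, differentiable (iter_derive u s) p.

(* C_c^infty(C) for C open: functions are extended by 0 outside C. *)
Definition test_function (C : set (heis R n)) u : Prop :=
  [/\ smooth u, compact (closure [set p | u p != 0]) &
      closure [set p | u p != 0] `<=` C].

Definition hardy_lhs (C : set (heis R n)) u : \bar R :=
  (\int[@lebesgue_heis R n]_(p in C) (hnorm (hgrad_perp u p) ^+ 2 / psi p)%:E)%E.

Definition hardy_rhs (C : set (heis R n)) u : \bar R :=
  (\int[@lebesgue_heis R n]_(p in C) (`|u p| ^+ 2 / cc_dist0 p ^+ 2 * psi p)%:E)%E.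

End Heisenberg.

(* Main.v *)
Require Import Defs.
From HB Require Import structures.
From mathcomp Require Import all_boot all_order all_algebra.
From mathcomp Require Import all_classical all_reals all_analysis.
From mathcomp Require Import measurable_realfun ring lra.
Set Implicit Arguments.
Unset Strict Implicit.
Unset Printing Implicit Defensive.
Import Order.TTheory GRing.Theory Num.Theory.
Import numFieldNormedType.Exports.
Local Open Scope classical_set_scope.
Local Open Scope ring_scope.

(* With [s = |xi|^2] and [t = psi / 2], geodesics from the origin give
   [delta = t sqrt s / sin t] where [s / z = 4 sin^2 t / (t - sin t cos t)]; a
   calibration shows that they are shortest. Hence
   [grad delta = (cos t xi + sin t J xi) / sqrt s], and the field
   [W = A xi - B J xi] with [A = sin^2 t / (t s)] and [B = sin t cos t / (t s)] is
   orthogonal to it, has [psi |W|^2 = 2 A] and horizontal divergence [2 n A], while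
   [psi / delta^2 = 2 A]. Integrating [div (u^2 W)] away from the center and
   completing the square gives the inequality. For the sharpness, [u = s ^ (- n / 2)]
   turns the pointwise inequality into an equality up to the derivative of [u] in
   [z]; with [s] replaced by [s + e], and cut off away from the center, both sides
   diverge like [log (1 / e)] while the error terms stay comparatively small. *)

(** The constant comes from one free parameter: completing the square in [grad_perp u + c u psi W]
    leaves the factor [c n - c ^ 2] in front of [psi u ^ 2 / delta ^ 2], maximal at [c = n / 2]. The
    direction of [W] is that of [sin t xi - cos t J xi], the normal to [grad delta] in the plane of
    [xi] and [J xi]. Its length is [1 / delta], which turns [psi |W| ^ 2] into the Hardy weight, and
    the relation [4 dA/ds = dB/dz] reduces its divergence to [n] times that weight. Equality in the
    square, for [u] depending on [s] alone, reads [du/ds = - (n / 2) u / s]; this is where the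
    extremal power comes from. Two obstacles shape the proof. Test functions may cross the center,
    where [B] blows up like [1 / sqrt s] although [A] stays bounded. Moreover the speed of a curve
    and the integrands of [hardy_lhs] and [hardy_rhs] come without measurability: they are only
    compared, by an inequality between integrals of arbitrary nonnegative functions, while
    additivity and limits are used for explicit measurable functions. *)

(** * Derivatives along a vector *)

Section directional_derivatives.
Context {R : realType} {V : normedModType R}.
Implicit Types (f g : V -> R) (x v : V).

(** The difference quotients on both sides are the same function of [h], so one-variable results
    such as the chain rule transfer to directional derivatives. *)
Lemma is_derive_line {W : normedModType R} (f : V -> W) x v (d : W) :
  is_derive x v f d <-> is_derive (0 : R) 1 (fun h : R => f (h *: v + x)) d.
Proof.
have E : (fun h : R => h^-1 *: (f (h *: v + x) - f x)) =
  (fun h : R => h^-1 *: (f ((h *: (1 : R) + 0) *: v + x) - f ((0 : R) *: v + x))).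
  apply/funext => h.
  by rewrite scale0r add0r addr0 (_ : h *: (1 : R) = h) // /GRing.scale /= mulr1.
by split=> -[D Dd]; split; rewrite /derivable /derive /= ?E // -?E //.
Qed.

Lemma is_derive_cstL (c : R) x v : is_derive x v (fun _ : V => c) 0.
Proof. exact: is_derive_cst. Qed.

Lemma is_deriveDL f g x v a b : is_derive x v f a -> is_derive x v g b ->
  is_derive x v (fun t => f t + g t) (a + b).
Proof. by move=> ? ?; exact: is_deriveD. Qed.

Lemma is_deriveNL f x v a : is_derive x v f a ->
  is_derive x v (fun t => - f t) (- a).
Proof. by move=> ?; exact: is_deriveN. Qed.

Lemma is_deriveML f g x v a b : is_derive x v f a -> is_derive x v g b ->
  is_derive x v (fun t => f t * g t) (a * g x + f x * b).
Proof.
move=> fa gb; apply: (@is_derive_eq _ _ _ _ _ _ _ _ (is_deriveM fa gb)).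
by rewrite /GRing.scale /= addrC mulrC.
Qed.

Lemma is_derive_compL (h : R -> R) g x v a b : is_derive (g x) 1 h a ->
  is_derive x v g b -> is_derive x v (fun t => h (g t)) (a * b).
Proof.
move=> ha /is_derive_line gb; apply/is_derive_line.
by apply: (@is_derive1_comp _ h); rewrite // scale0r add0r.
Qed.

Lemma is_deriveXL f n x v a : is_derive x v f a ->
  is_derive x v (fun t => f t ^+ n) (n%:R * f x ^+ n.-1 * a).
Proof.
move=> fa; have -> : (fun t => f t ^+ n) = f ^+ n.
  by elim: n => [|n IH]; apply/funext => t; rewrite ?expr0 // !exprS -IH.
exact: is_deriveX.
Qed.

Lemma is_derive_sumL n (f : 'I_n -> V -> R) x v (a : 'I_n -> R) :
  (forall i, is_derive x v (f i) (a i)) ->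
  is_derive x v (fun t => \sum_i f i t) (\sum_i a i).
Proof.
move=> fa; rewrite (_ : (fun _ => _) = \sum_i f i); first exact: is_derive_sum.
by apply/funext => t; rewrite fct_sumE.
Qed.

Lemma is_deriveVL f x v a : f x != 0 -> is_derive x v f a ->
  is_derive x v (fun t => (f t)^-1) (- f x ^- 2 * a).
Proof.
move=> fx [df Df]; split; first exact: derivableV.
by rewrite deriveV // Df.
Qed.

Lemma is_derive_near f g x v d : (\forall y \near x, f y = g y) ->
  is_derive x v f d -> is_derive x v g d.
Proof.
move=> fg [df Df].
by split; [exact: near_eq_derivable df | rewrite -Df; apply/esym/near_eq_derive].
Qed.

End directional_derivatives.

Lemma is_derive_continuous {R : realType} (f : R -> R) (x d : R) :
  is_derive x (1 : R) f d -> {for x, continuous f}.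
Proof. by move=> [fx _]; apply: differentiable_continuous; apply/derivable1_diffP. Qed.

Ltac der1 :=
  lazymatch goal with
  | |- is_derive _ _ (fun t => t) _ => exact: is_derive_id
  | |- is_derive _ _ (fun t => @?f t + @?g t) _ => apply (@is_deriveDL _ _ f g)
  | |- is_derive _ _ (fun t => - @?f t) _ => apply (@is_deriveNL _ _ f)
  | |- is_derive _ _ (fun t => @?f t * @?g t) _ => apply (@is_deriveML _ _ f g)
  | |- is_derive _ _ (fun t => (@?f t)^-1) _ => first [exact: is_derive_cstL | apply (@is_deriveVL _ _ f)]
  | |- is_derive _ _ (fun t => @?f t ^+ ?n) _ => apply (@is_deriveXL _ _ f n)
  | |- is_derive _ _ (fun t => sin (@?f t)) _ =>
      apply (@is_derive_compL _ _ sin f); [exact: is_derive_sin|]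
  | |- is_derive _ _ (fun t => cos (@?f t)) _ =>
      apply (@is_derive_compL _ _ cos f); [exact: is_derive_cos|]
  | |- is_derive _ _ (fun t => expR (@?f t)) _ =>
      apply (@is_derive_compL _ _ expR f); [exact: is_derive_expR|]
  | |- is_derive _ _ (fun _ => ?c) _ => exact: is_derive_cstL
  | |- is_derive _ _ _ _ => solve [eassumption | eauto 2]
  end.
(** The derivative computed from the syntax is an existential variable; the goals left are its
    equality with the announced value and the nonvanishing of denominators. *)
Ltac der := eapply is_derive_eq; [repeat der1 | ].

Lemma mvt {R : realType} (f df : R -> R) (a b : R) : a < b ->
  (forall x, a <= x <= b -> is_derive x 1 f (df x)) ->
  exists2 c, a < c < b & f b - f a = df c * (b - a).
Proof.
move=> ab fD; have [||c cab E] := @MVT R f df a b ab.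
- by move=> x /itvP xab; apply: fD; rewrite !xab.
- apply: derivable_within_continuous => x; rewrite in_itv /= => xab.
  by have [] := fD _ xab.
- by exists c => //; rewrite !(itvP cab).
Qed.

(** * The function [phi] in the half angle, and its inverse *)

Section trigonometry.
Context {R : realType}.
Implicit Types t y : R.

(** The difference has derivative [2 * sin t ^+ 2], which vanishes at the multiples of [pi].
    Strictness is obtained on [[0, min t 1]], inside which the sine is positive, and kept afterwards
    by monotonicity. *)
Lemma sincos_lt t : 0 < t -> sin t * cos t < t.
Proof.
move=> t0; rewrite -subr_gt0.
have [m [m0 mt mpi]] : exists m : R, [/\ 0 < m, m <= t & m < pi].
  exists (Num.min t 1); split; [by rewrite lt_min t0 ltr01|by rewrite ge_min lexx|].
  by rewrite gt_min; apply/orP; right; have := @pi_ge2 R; lra.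
have D (x : R) : is_derive x (1 : R) (fun t => t - sin t * cos t) (2 * sin x ^+ 2).
  der; have := cos2Dsin2 x; nra.
have [c /andP[c0 cm]] := @mvt R _ _ 0 m m0 (fun x _ => D x).
rewrite sin0 mul0r !subr0 => E.
have : 0 < m - sin m * cos m.
  by rewrite E !mulr_gt0 // sin_gt0_pi // c0 (lt_trans cm).
move: mt; rewrite le_eqVlt => /predU1P[<- //|mt] /lt_le_trans; apply.
have [c' _ E'] := @mvt R _ _ m t mt (fun x _ => D x).
by rewrite -subr_ge0 E' mulr_ge0 ?subr_ge0 ?(ltW mt) // mulr_ge0 // sqr_ge0.
Qed.

Lemma mul_cos_lt_sin t : 0 < t < pi -> t * cos t < sin t.
Proof.
move=> /andP[t0 tpi]; rewrite -subr_gt0.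
have D (x : R) : is_derive x (1 : R) (fun t => sin t - t * cos t) (x * sin x).
  by der; rewrite /GRing.scale /=; ring.
have [c /andP[c0 cm]] := @mvt R _ _ 0 t t0 (fun x _ => D x).
rewrite sin0 mul0r !subr0 => ->.
by rewrite !mulr_gt0 // sin_gt0_pi // c0 (lt_trans cm).
Qed.

(** This is [phi (2 * t)], the value of [s / z] at half angle [t]; see [phi_qratio]. *)
Definition qratio t : R := 4 * sin t ^+ 2 / (t - sin t * cos t).

Lemma is_derive_qratio t : 0 < t ->
  is_derive t (1 : R) qratio
    (- (8 * sin t * (sin t - t * cos t) / (t - sin t * cos t) ^+ 2)).
Proof.
move=> t0; have tne : t - sin t * cos t != 0.
  by rewrite gt_eqF // subr_gt0 sincos_lt.
rewrite /qratio; der => //.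
rewrite /GRing.scale /= expr1; field: (sin2cos2 t) => //.
Qed.

Lemma qratio_pi : qratio pi = 0.
Proof. by rewrite /qratio sinpi expr0n /= mulr0 mul0r. Qed.

Lemma qratio_lt t t' : 0 < t -> t < t' -> t' <= pi -> qratio t' < qratio t.
Proof.
move=> t0 tt' tpi; rewrite -subr_lt0.
have H (x : R) : t <= x <= t' -> is_derive x (1 : R) qratio
    (- (8 * sin x * (sin x - x * cos x) / (x - sin x * cos x) ^+ 2)).
  by move=> /andP[tx _]; apply: is_derive_qratio; exact: lt_le_trans tx.
have [c /andP[c0 cm] ->] := mvt tt' H.
have cpi : 0 < c < pi by rewrite (lt_trans t0 c0) (lt_le_trans cm).
rewrite nmulr_rlt0 ?subr_gt0 // oppr_lt0 mulr_gt0 //.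
  by rewrite !mulr_gt0 ?sin_gt0_pi // subr_gt0 mul_cos_lt_sin.
by rewrite invr_gt0 exprn_gt0 // subr_gt0 sincos_lt //; case/andP: cpi.
Qed.

(** The intermediate value theorem is applied to the numerator [h] of [qratio t - y], which is
    regular at [0]. It vanishes there, its derivative [2 sin x (4 cos x - y sin x)] is positive just
    after [0], and [h pi < 0]. *)
Lemma qratio_surj y : 0 < y -> exists2 t, 0 < t < pi & qratio t = y.
Proof.
move=> y0; pose h t : R := 4 * sin t ^+ 2 - y * (t - sin t * cos t).
have D (x : R) : is_derive x (1 : R) h (2 * sin x * (4 * cos x - y * sin x)).
  by rewrite /h; der; rewrite expr1; ring: (sin2cos2 x).
have hc x : {for x, continuous h}.
  by apply: differentiable_continuous; apply/derivable1_diffP; have [] := D x.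
have [d d0 [dpi hd]] : exists2 d, 0 < d & d < pi /\ 0 < h d.
  have gc : {for (0 : R), continuous (fun x : R => 4 * cos x - y * sin x)}.
    by apply: is_derive_continuous; repeat der1.
  have : \forall t \near (0 : R), 0 < 4 * cos t - y * sin t.
    by apply: (cvgr_gt _ gc); rewrite cos0 sin0 mulr0 subr0 mulr1.
  move=> /nbhs_ballP[e /= e0 He].
  have pg := @pi_ge2 R.
  pose d := Num.min (e / 2) 1; exists d.
    by rewrite lt_min divr_gt0 //=.
  have d0 : 0 < d by rewrite lt_min divr_gt0 //=.
  have de : d <= e / 2 by rewrite ge_min lexx.
  have d1 : d <= 1 by rewrite ge_min lexx orbT.
  have dpi : d < pi by lra.
  split => //.
  have [c /andP[c0 cm]] := @mvt R _ _ 0 d d0 (fun x _ => D x).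
  rewrite {2}/h sin0 mul0r expr0n /= !(mulr0,subr0) => ->.
  apply: mulr_gt0 => //; apply: mulr_gt0.
    by rewrite mulr_gt0 // sin_gt0_pi // c0 (lt_trans cm).
  by apply: He; rewrite /ball /= sub0r normrN gtr0_norm //; lra.
have hpi : h pi < 0.
  by rewrite /h sinpi expr0n /= mulr0 mul0r subr0 sub0r oppr_lt0 mulr_gt0 // pi_gt0.
have [||t tin ht] := @IVT R h d pi 0 (ltW dpi).
- by apply: continuous_subspaceT => x; exact: hc.
- by rewrite ge_min le_max (ltW hd) (ltW hpi) orbT.
have t0 : 0 < t by rewrite (lt_le_trans d0) // (itvP tin).
have tpi : t < pi.
  rewrite lt_neqAle (itvP tin) andbT; apply/eqP => tE.
  by move: hpi; rewrite -tE ht ltxx.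
exists t; first by rewrite t0.
rewrite /qratio; apply: (canLR (mulfK _)).
  by rewrite gt_eqF // subr_gt0 sincos_lt.
by apply/eqP; rewrite -subr_eq0; apply/eqP.
Qed.

Lemma sin2x t : sin (2 * t) = 2 * sin t * cos t.
Proof. by rewrite mulr_natl sin_mulr2n -mulr_natl; ring. Qed.

Lemma cos2x t : cos (2 * t) = 1 - 2 * sin t ^+ 2.
Proof. by rewrite mulr_natl cos_mulr2n cos2sin2 -mulr_natl; ring. Qed.

Lemma phi_qratio t : 0 < t -> phi (2 * t) = (qratio t)%:E.
Proof.
move=> t0; rewrite /phi gt_eqF ?mulr_gt0 // sin2x cos2x; congr (_%:E).
have := sincos_lt t0; rewrite /qratio => ?.
by field; apply/andP; split; rewrite gt_eqF //; nra.
Qed.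

Definition theta (y : R) : R := pinv `[0, 2 * pi]%classic phi y%:E / 2.

(** By [qratio_surj] the value [y] is taken by [phi] on [[0, 2 pi]], so [pinv] returns a genuine
    preimage. Both ends are excluded because [phi 0 = +oo] and [phi (2 pi) = 0]. *)
Lemma thetaP y : 0 < y -> 0 < theta y < pi /\ qratio (theta y) = y.
Proof.
move=> y0; have [t /andP[t0 tpi] ty] := qratio_surj y0.
have yin : y%:E \in phi @` `[0, 2 * pi]%classic.
  apply/mem_set; exists (2 * t); last by rewrite phi_qratio // ty.
  by rewrite /= in_itv /=; lra.
have : phi (pinv `[0, 2 * pi]%classic phi y%:E) = y%:E by exact: pinvK.
have : `[0, 2 * pi]%classic (pinv `[0, 2 * pi]%classic phi y%:E).
  have := @surjpinv_image_sub _ _ (fun=> point) `[0, 2 * pi]%classic (phi @` `[0, 2 * pi]%classic) phi.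
  by apply => //; exists y%:E => //; apply/set_mem.
rewrite /theta; move: (pinv _ _ _) => r; rewrite /= in_itv /= => /andP[r0 r2].
move: r0; rewrite le_eqVlt => /predU1P[<-|r0]; first by rewrite /phi eqxx.
rewrite -[in phi _](@divfK _ 2 _ r) // mulrC phi_qratio ?divr_gt0 // => -[E].
split => //; rewrite lt_neqAle /=; apply/andP; split; last by lra.
by apply/eqP => rE; move: y0; rewrite -E rE qratio_pi ltxx.
Qed.

Lemma thetaK t : 0 < t < pi -> theta (qratio t) = t.
Proof.
move=> /andP[t0 tpi]; have q0 : 0 < qratio t.
  by rewrite -qratio_pi; exact: qratio_lt.
have [/andP[u0 upi] E] := thetaP q0.
by apply/eqP; case: (ltgtP (theta (qratio t)) t) => // /qratio_lt;
  rewrite E => /(_ _ _)/wrap[]//; rewrite ?ltxx // ltW.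
Qed.

Lemma theta_le y y' : 0 < y -> y <= y' -> theta y' <= theta y.
Proof.
move=> y0 yy'; have [/andP[u0 upi] E] := thetaP y0.
have [/andP[v0 vpi] E'] := thetaP (lt_le_trans y0 yy').
rewrite leNgt; apply/negP => /(qratio_lt u0)/(_ (ltW vpi)).
by rewrite E E' ltNge yy'.
Qed.

Lemma is_derive_theta t : 0 < t < pi -> is_derive (qratio t) (1 : R) theta
  (- ((t - sin t * cos t) ^+ 2 / (8 * sin t * (sin t - t * cos t)))).
Proof.
move=> /[dup] tin /andP[t0 tpi].
have s0 := sin_gt0_pi tin; have m0 := mul_cos_lt_sin tin.
have d0 := sincos_lt t0.
have tn : \forall x \near t, 0 < x < pi.
  near=> x; apply/andP; split; near: x; [exact: lt_nbhsr|exact: lt_nbhsl].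
eapply is_derive_eq.
  apply: (is_derive_inverse _ _ (is_derive_qratio t0)).
  - by near=> x; apply: thetaK; near: x.
  - near=> x; have x0 : 0 < x < pi by near: x.
    by apply: is_derive_continuous; apply: is_derive_qratio; case/andP: x0.
  - rewrite oppr_eq0 gt_eqF // !(mulr_gt0, invr_gt0, exprn_gt0, subr_gt0) //.
by rewrite invrN invf_div.
Unshelve. all: by end_near. Qed.

End trigonometry.

(** * Monotonicity of absolutely continuous functions *)

Section absolutely_continuous_monotonicity.
Context {R : realType}.

(** Compactness of [[a, b]] in the form of a supremum argument: the supremum [c] of the points [t]
    with [Q a t] satisfies [Q a c], and if [c < b] the local hypothesis at [c] leads beyond it. *)
Lemma cousin (Q : R -> R -> Prop) (a b : R) : a <= b ->
  (forall x y z, a <= x -> x <= y -> y <= z -> z <= b ->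
    Q x y -> Q y z -> Q x z) ->
  (forall t, a <= t <= b -> exists2 d, 0 < d &
    forall x y, a <= x -> x <= t -> t <= y -> y <= b ->
      t - x < d -> y - t < d -> Q x y) ->
  Q a b.
Proof.
move=> ab Qadd Qloc.
pose S : set R := [set t | a <= t <= b /\ Q a t].
have Sa : S a.
  split; first by rewrite lexx.
  have [|d d0 Qd] := Qloc a; first by rewrite lexx.
  by apply: Qd => //; rewrite subrr.
have ubS : ubound S b by move=> t [/andP[]].
have hS : has_sup S by split; [exists a|exists b].
have supS t : S t -> t <= sup S := @sup_upper_bound _ _ hS t.
set c := sup S in supS *.
have ac : a <= c := supS _ Sa.
have cb : c <= b by apply: ge_sup => //; exists a.
have [|d d0 Qd] := Qloc c; first by rewrite ac.
have [t [/andP[at_ tb] Qat] tc] := sup_adherent d0 hS.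
have tlc : t <= c by apply: supS; split => //; rewrite at_.
have Qac : Q a c.
  apply: (Qadd a t c) => //; apply: Qd => //; last by rewrite subrr.
  by rewrite -/c in tc; lra.
move: cb; rewrite le_eqVlt => /predU1P[cE|cb]; first by rewrite -cE.
pose y := Num.min b (c + d / 2).
have cy : c < y by rewrite lt_min cb ltrDl divr_gt0.
have yb : y <= b by rewrite ge_min lexx.
have yd : y <= c + d / 2 by rewrite ge_min lexx orbT.
have Sy : S y.
  split; first by rewrite yb (le_trans ac (ltW cy)).
  apply: (Qadd a c y) => //; first exact: ltW.
  by apply: Qd => //; [exact: ltW|rewrite subrr|lra].
by have := supS _ Sy; rewrite leNgt cy.
Qed.

(* [chain U x s y]: the pairs of [s] are the end points, listed in increasing
   order, of intervals between [x] and [y] whose interiors lie in [U]. *)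
Fixpoint chain (U : set R) (x : R) (s : seq (R * R)) (y : R) : Prop :=
  match s with
  | [::] => x <= y
  | p :: s' => [/\ x <= p.1, p.1 <= p.2, `]p.1, p.2[%classic `<=` U & chain U p.2 s' y]
  end.

Lemma chain_le U x s y : chain U x s y -> x <= y.
Proof.
elim: s x => [//|p s IH] x /= [xp pp _ /IH].
exact: le_trans (le_trans xp pp).
Qed.

Lemma chain_cat U x s y s' z :
  chain U x s y -> chain U y s' z -> chain U x (s ++ s') z.
Proof.
elim: s x => [|p s IH] x /=; last by move=> [? ? ? ?] ?; split => //; apply: IH.
case: s' => [|p s'] /=; first exact: le_trans.
by move=> xy [yp ? ? ?]; split => //; exact: le_trans yp.
Qed.

Lemma chain_nth U x s y i : chain U x s y -> (i < size s)%N ->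
  let p := nth (0, 0) s i in
  [/\ x <= p.1, p.1 <= p.2, p.2 <= y & `]p.1, p.2[%classic `<=` U].
Proof.
elim: s x i => [//|p s IH] x [|i] /= [xp pp pU ch].
  by move=> _; split => //; exact: chain_le ch.
move=> /(IH _ _ ch)[h1 h2 h3 h4]; split => //.
exact: le_trans (le_trans xp pp) h1.
Qed.

Lemma chain_nth_lt U x s y i j : chain U x s y -> (i < j < size s)%N ->
  (nth (0, 0) s i).2 <= (nth (0, 0) s j).1.
Proof.
elim: s x i j => [|p s IH] x i [|j] //=; first by rewrite andbF.
move=> [xp pp pU ch]; case: i => [|i] /=; last exact: (IH _ _ _ ch).
by move=> js; have [] := chain_nth ch js.
Qed.

(** Links the bookkeeping of [chain] with measure: the intervals are disjoint and their interiors
    lie in [U], so absolute continuity applies to them as soon as [U] is small. *)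
Lemma chain_measure U x s y : measurable U -> chain U x s y ->
  ((\sum_(i < size s) ((nth (0, 0) s i).2 - (nth (0, 0) s i).1))%:E
    <= lebesgue_measure U)%E /\
  trivIset setT (fun i : 'I_(size s) =>
    `](nth (0, 0) s i).1, (nth (0, 0) s i).2[%classic).
Proof.
move=> mU ch.
pose F (i : 'I_(size s)) := `](nth (0, 0) s i).1, (nth (0, 0) s i).2[%classic.
have tF : trivIset setT F.
  apply/trivIsetP => i j _ _ ij; wlog: i j ij / (i < j)%N => [H|iltj].
    have [/H->//|] := ltnP i j; rewrite leq_eqVlt => /predU1P[E|ji].
      by move: ij; rewrite -(inj_eq val_inj) /= E eqxx.
    by rewrite setIC H // eq_sym.
  rewrite -subset0 => z []; rewrite /F /= !in_itv /= => /andP[_ z1] /andP[z2 _].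
  have := @chain_nth_lt _ _ _ _ i j ch; rewrite iltj ltn_ord => /(_ isT).
  by rewrite leNgt (lt_trans z2 z1).
split => //.
have -> : (\sum_(i < size s) ((nth (0, 0) s i).2 - (nth (0, 0) s i).1))%:E =
   (\sum_(i < size s) lebesgue_measure (F i))%E.
  rewrite -sumEFin; apply: eq_bigr => i _.
  have [_ le12 _ _] := chain_nth ch (ltn_ord i).
  rewrite lebesgue_measure_itv /= lte_fin; case: ltgtP le12 => // -> _.
  by rewrite subrr.
rewrite -measure_bigsetU_ord //.
  apply: le_measure; rewrite ?inE //.
    by apply: bigsetU_measurable => i _; exact: measurable_itv.
  elim/big_ind: _ => [||i _]; first exact: sub0set.
    by move=> A B AU BU; rewrite subUset.
  by have [] := chain_nth ch (ltn_ord i).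
by move=> i; exact: measurable_itv.
Qed.

(** The exceptional set is enclosed in an open set [U] of measure below the threshold [d]. Around
    its points the increments of [F] are charged to intervals inside [U], elsewhere to the slope
    [e / 2], and [cousin] assembles these local bounds. Absolute continuity is asked one-sidedly,
    for the increase of [F] only. *)
Lemma ac_nonincreasing (F : R -> R) (N : set R) :
  lebesgue_measure.-negligible N ->
  (forall t, 0 <= t <= 1 -> ~ N t -> forall e, 0 < e -> exists2 d, 0 < d &
    forall x y, 0 <= x -> x <= t -> t <= y -> y <= 1 -> t - x < d -> y - t < d ->
      F y - F x <= e * (y - x)) ->
  (forall e : R, 0 < e -> exists2 d : R, 0 < d &
    forall (m : nat) (l r : 'I_m -> R),
      (forall i, [/\ 0 <= l i, l i <= r i & r i <= 1]) ->
      trivIset setT (fun i => `]l i, r i[%classic) ->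
      \sum_i (r i - l i) < d -> \sum_i (F (r i) - F (l i)) < e) ->
  F 1 <= F 0.
Proof.
move=> [N' [mN' N'0 NN']] Floc Fac.
rewrite -subr_le0; apply/ler_addgt0Pr => e e0; rewrite add0r.
have e20 : 0 < e / 2 by rewrite divr_gt0.
have [d d0 Hd] := Fac _ e20.
have [|U [oU NU mUd]] := lebesgue_regularity_outer mN' _ d0.
  by rewrite [ltLHS](_ : _ = 0%E).
have mU : measurable U by exact: open_measurable.
have Ud : (lebesgue_measure U < d%:E)%E.
  have -> : U = (U `\` N') `|` N' by rewrite setUC setDUK.
  apply: le_lt_trans (measureU2 _ _ _) _ => //; first exact: measurableD.
  by rewrite [X in (_ + X)%E](_ : _ = 0%E) ?adde0.
(* The list [s] collects the intervals inside [U], over which the increment of [F] is not controlled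
   by the slope. *)
pose Q x y := exists2 s, chain U x s y &
  F y - F x <= e / 2 * (y - x) +
    \sum_(i < size s) (F (nth (0, 0) s i).2 - F (nth (0, 0) s i).1).
have [s chs Fs] : Q 0 1.
  apply: cousin => //.
    move=> x y z x0 xy yz z1 [s chs Fs] [s' chs' Fs'].
    exists (s ++ s'); first exact: chain_cat chs'.
    move: Fs Fs'; rewrite -!(big_mkord xpredT
      (fun i => F (nth (0, 0) _ i).2 - F (nth (0, 0) _ i).1)).
    rewrite -!(big_nth (0, 0) xpredT (fun p : R * R => F p.2 - F p.1)).
    by rewrite big_cat /=; lra.
  move=> t t01; have [Nt|Nt] := pselect (N t).
    have /nbhs_ballP[r /= r0 rU] : nbhs t U.
      by apply: open_nbhs_nbhs; split => //; apply: NU; exact: NN'.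
    exists r => // x y x0 xt ty y1 txr ytr.
    exists [:: (x, y)] => /=.
      split => //; first exact: le_trans ty.
      move=> w /=; rewrite in_itv /= => /andP[xw wy]; apply: rU.
      by rewrite /ball /= ltr_norml; lra.
    by rewrite big_ord1 /= lerDr mulr_ge0 ?subr_ge0 ?(ltW e20) // (le_trans xt).
  have [r r0 Hr] := Floc t t01 Nt _ e20.
  exists r => // x y x0 xt ty y1 txr ytr.
  exists [::] => /=; first exact: le_trans ty.
  by rewrite big_ord0 addr0; exact: Hr.
have [sU tU] := chain_measure mU chs.
have /= := Hd _ _ _ _ tU.
have H1 : forall i : 'I_(size s),
  [/\ 0 <= (nth (0, 0) s i).1, (nth (0, 0) s i).1 <= (nth (0, 0) s i).2 &
     (nth (0, 0) s i).2 <= 1].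
  by move=> i; have [] := chain_nth chs (ltn_ord i).
move=> /(_ H1)/(_ _)/wrap[|H2]; last by lra.
by rewrite -lte_fin; exact: le_lt_trans Ud.
Qed.

End absolutely_continuous_monotonicity.

(** * Coordinates on the Heisenberg group and horizontal vectors *)

Section heisenberg_coordinates.
Context {R : realType}.

Lemma is_derive_linear_comp {V W W' : normedModType R} (l : W -> W') (g : V -> W)
    (x v : V) (G : W) : linear l -> continuous l ->
  is_derive x v g G -> is_derive x v (fun t => l (g t)) (l G).
Proof.
move=> ll lc [dg Dg].
have lB a b : l (a - b) = l a - l b.
  by rewrite -scaleN1r addrC ll scaleN1r addrC.
have lZ k a : l (k *: a) = k *: l a.
  have l0 : l 0 = 0 by rewrite -(subrr 0) lB subrr.
  by rewrite -[k *: a]addr0 ll l0 addr0.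
have cv : (fun h : R => h^-1 *: (l (g (h *: v + x)) - l (g x))) @ 0^' --> l G.
  rewrite (_ : (fun h : R => _) =
     l \o (fun h : R => h^-1 *: (g (h *: v + x) - g x))); last first.
    by apply/funext => h /=; rewrite lZ lB.
  apply: cvg_comp; last exact: lc.
  by rewrite -Dg; exact: dg.
split; first by apply/cvg_ex; exists (l G).
by apply/cvg_lim => //; exact: norm_hausdorff.
Qed.

Context {n : nat}.
Implicit Types (p v : heis R n).

Definition hx (i : 'I_n) p : R := p.1.1 ord0 i.
Definition hy (i : 'I_n) p : R := p.1.2 ord0 i.
Definition hz p : R := p.2.

Lemma hx_linear i : linear (hx i : heis R n -> R).
Proof. by move=> k p q; rewrite /hx /= !mxE. Qed.
Lemma hy_linear i : linear (hy i : heis R n -> R).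
Proof. by move=> k p q; rewrite /hy /= !mxE. Qed.
Lemma hz_linear : linear (hz : heis R n -> R).
Proof. by []. Qed.

Lemma hx_continuous i : continuous (hx i).
Proof.
move=> p; apply: (@continuous_comp _ _ _ (fun p : heis R n => p.1.1)
  (fun x : 'rV[R]_n => x ord0 i)); last exact: coord_continuous.
by apply: (@continuous_comp _ _ _ fst fst); exact: cvg_fst.
Qed.
Lemma hy_continuous i : continuous (hy i).
Proof.
move=> p; apply: (@continuous_comp _ _ _ (fun p : heis R n => p.1.2)
  (fun x : 'rV[R]_n => x ord0 i)); last exact: coord_continuous.
by apply: (@continuous_comp _ _ _ fst snd); [exact: cvg_fst|exact: cvg_snd].
Qed.
Lemma hz_continuous : continuous (hz : heis R n -> R).
Proof. by move=> p; exact: cvg_snd. Qed.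

Lemma is_derive_hx {V : normedModType R} (g : V -> heis R n) (x w : V) G i :
  is_derive x w g G -> is_derive x w (fun t => hx i (g t)) (hx i G).
Proof. exact: (is_derive_linear_comp (hx_linear i) (@hx_continuous i)). Qed.

Lemma is_derive_hy {V : normedModType R} (g : V -> heis R n) (x w : V) G i :
  is_derive x w g G -> is_derive x w (fun t => hy i (g t)) (hy i G).
Proof. exact: (is_derive_linear_comp (hy_linear i) (@hy_continuous i)). Qed.

Lemma is_derive_hz {V : normedModType R} (g : V -> heis R n) (x w : V) G :
  is_derive x w g G -> is_derive x w (fun t => hz (g t)) (hz G).
Proof. exact: (is_derive_linear_comp hz_linear hz_continuous). Qed.

Lemma sqnorm_xyE p : sqnorm_xy p = \sum_i (hx i p ^+ 2 + hy i p ^+ 2).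
Proof. by []. Qed.

Lemma is_derive_sqnorm_xy {V : normedModType R} (g : V -> heis R n) (x w : V) G :
  is_derive x w g G -> is_derive x w (fun t => sqnorm_xy (g t))
    (2 * \sum_i (hx i (g x) * hx i G + hy i (g x) * hy i G)).
Proof.
move=> DG; have DX i := is_derive_hx i DG; have DY i := is_derive_hy i DG.
rewrite mulr_sumr.
apply: (@is_derive_sumL _ _ _ (fun i t => hx i (g t) ^+ 2 + hy i (g t) ^+ 2)) => i.
by der; rewrite !expr1; ring.
Qed.

Lemma hx_norm i p : `|hx i p| <= `|p|.
Proof.
rewrite prod_normE le_max prod_normE le_max /hx.
have -> : `|p.1.1 ord0 i| <= `|p.1.1|.
  rewrite [leRHS]/Num.Def.normr /= mx_normrE; apply/bigmax_geP; right => /=.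
  by exists (ord0, i).
by [].
Qed.
Lemma hy_norm i p : `|hy i p| <= `|p|.
Proof.
rewrite prod_normE le_max prod_normE le_max /hy.
have -> : `|p.1.2 ord0 i| <= `|p.1.2|.
  rewrite [leRHS]/Num.Def.normr /= mx_normrE; apply/bigmax_geP; right => /=.
  by exists (ord0, i).
by rewrite orbT.
Qed.
Lemma hz_norm p : `|hz p| <= `|p|.
Proof. by rewrite prod_normE le_max lexx orbT. Qed.

Lemma frame_comb p (a b : 'rV[R]_n) :
  \sum_i (a ord0 i *: Xfield i p + b ord0 i *: Yfield i p) =
  (a, b, 2^-1 * \sum_i (hx i p * b ord0 i - hy i p * a ord0 i)).
Proof.
rewrite [LHS]surjective_pairing (raddf_sum fst) (raddf_sum snd) /=.
congr (_, _).
  rewrite [LHS]surjective_pairing (raddf_sum fst) (raddf_sum snd) /=.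
  by rewrite (row_sum_delta a) (row_sum_delta b); congr (_, _);
    apply: eq_bigr => i _; rewrite !scaler0 ?addr0 ?add0r -?row_sum_delta.
rewrite mulr_sumr; apply: eq_bigr => i _.
by rewrite /hx /hy /GRing.scale /=; field.
Qed.

(** Horizontal vectors form the kernel of the contact form [dz - (x dy - y dx) / 2]. *)
Lemma distributionP p v : Defs.distribution p v <->
  v.2 = 2^-1 * \sum_i (hx i p * hy i v - hy i p * hx i v).
Proof.
split=> [[a [b ->]]|vE]; first by rewrite frame_comb.
exists v.1.1, v.1.2; rewrite frame_comb -vE.
by case: v {vE} => -[].
Qed.

End heisenberg_coordinates.

(** * Tools for bounding lengths from below *)

Section carnot_caratheodory_lower_bound.
Context {R : realType}.

(** An interval containing [t] is cut at [t], and both pieces obey the slope bound. This supplies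
    the local hypothesis of [ac_nonincreasing]. *)
Lemma straddle (F : R -> R) (t l e : R) : is_derive t (1 : R) F l -> l <= 0 ->
  0 < e -> exists2 d, 0 < d & forall x y, x <= t -> t <= y ->
    t - x < d -> y - t < d -> F y - F x <= e * (y - x).
Proof.
move=> [dF Dl] l0 e0.
have : (fun h : R => h^-1 *: (F (h *: 1 + t) - F t)) @ 0^' --> l.
  by rewrite -Dl; exact: dF.
move=> /cvgrPdist_le /(_ _ e0).
rewrite near_withinE => /nbhs_ballP[d /= d0 Hd].
have H h : h != 0 -> `|h| < d -> `|l - h^-1 * (F (h + t) - F t)| <= e.
  move=> h0 hd; have /= := Hd h; rewrite /ball /= sub0r normrN => /(_ hd h0).
  by rewrite /GRing.scale /= mulr1.
exists d => // x y xt ty txd ytd.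
have Hy : F y - F t <= e * (y - t).
  move: ty; rewrite le_eqVlt => /predU1P[->|ty]; first by rewrite !subrr mulr0.
  have yt0 : 0 < y - t by rewrite subr_gt0.
  have := H (y - t); rewrite subrK gt_eqF // gtr0_norm // => /(_ isT ytd).
  rewrite ler_norml => /andP[+ _]; rewrite lerBrDr => H'.
  have : (y - t)^-1 * (F y - F t) <= e by lra.
  by rewrite mulrC ler_pdivrMr.
have Hx : F t - F x <= e * (t - x).
  move: xt; rewrite le_eqVlt => /predU1P[->|xt]; first by rewrite !subrr mulr0.
  have xt0 : 0 < t - x by rewrite subr_gt0.
  have := H (x - t); rewrite subrK subr_eq0 lt_eqF // distrC gtr0_norm //.
  move=> /(_ isT txd); rewrite ler_norml => /andP[+ _]; rewrite lerBrDr => H'.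
  have : (x - t)^-1 * (F x - F t) <= e by lra.
  rewrite -[x - t]opprB invrN mulNr -mulrN opprB mulrC ler_pdivrMr //.
have -> : F y - F x = (F y - F t) + (F t - F x) by lra.
by nra.
Qed.

Context {n : nat}.
Implicit Types (p v : heis R n) (g : R -> heis R n).

Lemma sqnorm_xy_ge0 p : 0 <= sqnorm_xy p.
Proof. by apply: sumr_ge0 => i _; rewrite addr_ge0 // sqr_ge0. Qed.

Lemma hinner_ge0 v : 0 <= hinner v v.
Proof. by apply: sumr_ge0 => i _; rewrite -!expr2 addr_ge0 // sqr_ge0. Qed.

Lemma hnorm_ge0 v : 0 <= hnorm v.
Proof. exact: sqrtr_ge0. Qed.

Lemma hnorm_sqr v : hnorm v ^+ 2 = hinner v v.
Proof. by rewrite sqr_sqrtr // hinner_ge0. Qed.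

(** With [J xi = (- y, x)], the left side pairs [v] with [a xi + w J xi], whose squared norm is
    [(w ^ 2 + a ^ 2) |xi| ^ 2]. The bound is Cauchy-Schwarz followed by [b <= (b ^ 2 + 1) / 2]; it
    is the pointwise inequality behind [calibration]. *)
Lemma hinner_amgm (a w : R) p v :
  \sum_i ((a * hx i p - w * hy i p) * hx i v + (a * hy i p + w * hx i p) * hy i v)
    <= ((w ^+ 2 + a ^+ 2) * sqnorm_xy p + 1) / 2 * hnorm v.
Proof.
have := hnorm_ge0 v; rewrite le_eqVlt => /predU1P[V0|V0].
  have /eqP : hinner v v = 0 by rewrite -hnorm_sqr -V0 expr0n.
  rewrite psumr_eq0 => [/allP /= H|i _]; last by rewrite -!expr2 addr_ge0 // sqr_ge0.
  rewrite -V0 mulr0 big1 // => i _.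
  have := H i; rewrite mem_index_enum => /(_ isT).
  rewrite -!expr2 paddr_eq0 ?sqr_ge0 // !sqrf_eq0 => /andP[/eqP hx0 /eqP hy0].
  by rewrite /hx /hy hx0 hy0 !mulr0 addr0.
set V := hnorm v in V0 *.
have -> : ((w ^+ 2 + a ^+ 2) * sqnorm_xy p + 1) / 2 * V =
  \sum_i (V / 2 * ((a * hx i p - w * hy i p) ^+ 2 + (a * hy i p + w * hx i p) ^+ 2)
    + (hx i v ^+ 2 + hy i v ^+ 2) / (2 * V)).
  rewrite big_split /= -mulr_sumr -mulr_suml.
  have -> : \sum_(i < n) (hx i v ^+ 2 + hy i v ^+ 2) = V ^+ 2.
    by rewrite hnorm_sqr; apply: eq_bigr => i _; rewrite !expr2.
  have -> : \sum_i ((a * hx i p - w * hy i p) ^+ 2 +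
      (a * hy i p + w * hx i p) ^+ 2) = (w ^+ 2 + a ^+ 2) * sqnorm_xy p.
    by rewrite sqnorm_xyE mulr_sumr; apply: eq_bigr => i _; ring.
  by field; rewrite gt_eqF.
apply: ler_sum => i _.
have H (b c : R) : b * c <= V / 2 * b ^+ 2 + c ^+ 2 / (2 * V).
  rewrite -subr_ge0.
  have -> : V / 2 * b ^+ 2 + c ^+ 2 / (2 * V) - b * c = (V * b - c) ^+ 2 / (2 * V).
    by field; rewrite gt_eqF.
  by rewrite divr_ge0 ?sqr_ge0 // mulr_ge0 // ltW.
rewrite mulrDr mulrDl.
have := H (a * hx i p - w * hy i p) (hx i v).
have := H (a * hy i p + w * hx i p) (hy i v).
lra.
Qed.

(** Finitely many steps of length [d / 2] cover [[0, 1]], and along each of them [g] moves by less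
    than one. *)
Lemma ac_bounded g : abs_continuous 0 1 g -> g 0 = 0 ->
  exists2 M, 0 < M & forall t, 0 <= t <= 1 -> `|g t| <= M.
Proof.
move=> /(_ _ ltr01)[d d0 Hd] g0.
have step x y : 0 <= x -> x <= y -> y <= 1 -> y - x < d -> `|g y - g x| < 1.
  move=> x0 xy y1 xyd.
  have := Hd 1%N (fun=> x) (fun=> y); rewrite !big_ord1; apply => //.
  by apply/trivIsetP => i j _ _; rewrite !ord1 eqxx.
have H k t : 0 <= t <= 1 -> t <= k%:R * (d / 2) -> `|g t| <= k%:R.
  elim: k t => [|k IH] t /andP[t0 t1] tk.
    have -> : t = 0 by lra.
    by rewrite g0 normr0.
  pose t' := Num.max 0 (t - d / 2).
  have t'0 : 0 <= t' by rewrite le_max lexx.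
  have t't : t' <= t by rewrite ge_max t0; lra.
  have t't2 : t - d / 2 <= t' by rewrite le_max lexx orbT.
  have t'k : t' <= k%:R * (d / 2).
    rewrite ge_max mulr_ge0 ?ler0n //=; last by lra.
    by move: tk; rewrite -natr1; lra.
  have := IH t'; rewrite t'0 (le_trans t't) // => /(_ isT t'k) H.
  have := step t' t t'0 t't t1; move=> /(_ _)/wrap[|H2]; first by lra.
  have := ler_normD (g t - g t') (g t'); rewrite subrK -natr1; lra.
have [k _ kP] : exists2 k : nat, True & (2 / d) <= k%:R.
  have := archi_boundP (divr_ge0 (ler0n R 2) (ltW d0)).
  by move=> /ltW; exists (Num.bound (2 / d)).
have d2 : 1 <= k%:R * (d / 2).
  have := ler_wpM2r (ltW d0) kP; rewrite divfK ?gt_eqF //; lra.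
exists (k%:R + 1); first by rewrite ltr_wpDl ?ler0n.
move=> t t01; have := H k t t01; move=> /(_ _)/wrap[|]; last by lra.
by case/andP: t01; lra.
Qed.

End carnot_caratheodory_lower_bound.

(** * The calibration *)

Section calibration.
Context {R : realType}.

Definition cot (t : R) : R := cos t / sin t.

Lemma is_derive_cot t : sin t != 0 -> is_derive t (1 : R) cot (- (1 + cot t ^+ 2)).
Proof.
move=> s0; rewrite /cot; der => //.
by field: (sin2cos2 t).
Qed.

Lemma cot_le (t t' : R) : 0 < t -> t <= t' -> t' < pi -> cot t' <= cot t.
Proof.
move=> t0; rewrite le_eqVlt => /predU1P[->//|tt'] tpi.
have H (x : R) : t <= x <= t' -> is_derive x (1 : R) cot (- (1 + cot x ^+ 2)).
  move=> /andP[tx xt']; apply: is_derive_cot; rewrite gt_eqF // sin_gt0_pi //.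
  by rewrite (lt_le_trans t0) //= (le_lt_trans xt').
have [c _] := mvt tt' H; have := sqr_ge0 (cot c); nra.
Qed.

(* The distance from the origin in terms of [s = |xi|^2] and [z], see [cc_dist0E]. *)
Definition dist_sz (s z : R) : R :=
  let t := theta (s / z) in t * Num.sqrt s / sin t.

Lemma theta_div_itv (s z : R) : 0 < s -> 0 < z -> 0 < theta (s / z) < pi.
Proof. by move=> s0 z0; have [] := thetaP (divr_gt0 s0 z0). Qed.

Lemma theta_divE (s z : R) : 0 < s -> 0 < z -> let t := theta (s / z) in
  z = s * (t - sin t * cos t) / (4 * sin t ^+ 2).
Proof.
move=> s0 z0 t; have [tin] := thetaP (divr_gt0 s0 z0).
rewrite -/t in tin *; have st := sin_gt0_pi tin.
have [t0 tpi] := andP tin; have dt := sincos_lt t0.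
rewrite /qratio => E.
have sz : s = z * (4 * sin t ^+ 2 / (t - sin t * cos t)).
  by rewrite E mulrC divfK // gt_eqF.
by rewrite {1}sz; field; rewrite !gt_eqF // subr_gt0.
Qed.

Lemma dist_sz_gt0 (s z : R) : 0 < s -> 0 < z -> 0 < dist_sz s z.
Proof.
move=> s0 z0; have tin := theta_div_itv s0 z0; have [t0 _] := andP tin.
by rewrite /dist_sz /= divr_gt0 ?sin_gt0_pi // mulr_gt0 // sqrtr_gt0.
Qed.

(** The form in which the distance enters [calibration]: divided by twice the distance, the right
    side is the calibration function at the end point, apart from its term in [tau]. *)
Lemma dist_sz_sqr (s z : R) : 0 < s -> 0 < z -> let t := theta (s / z) in
  dist_sz s z ^+ 2 = 4 * t * z + t * cot t * s.
Proof.
move=> s0 z0 t; have tin : 0 < t < pi := theta_div_itv s0 z0.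
have st := sin_gt0_pi tin.
have zE := theta_divE s0 z0; rewrite /dist_sz /= -/t in zE *.
clearbody t; rewrite /cot [in RHS]zE !exprMn sqr_sqrtr ?ltW // exprVn.
by field: (sin2cos2 t); rewrite gt_eqF.
Qed.

Context {n : nat}.
Implicit Types (p v : heis R n) (g : R -> heis R n).

(* Calibration: with [w = theta / dist] and [e = dist - tau 1], the function
   [2 w z + w cot (w (tau + e)) |xi|^2 / 2 - tau / 2] is nonincreasing along any
   horizontal curve of arc length [tau], and at the end point it is nonnegative
   unless [tau 1 >= dist]. *)
Lemma calibration g (tau : R -> R) (N : set R) :
  abs_continuous 0 1 g -> g 0 = 0 ->
  0 < sqnorm_xy (g 1) -> 0 < hz (g 1) ->
  tau 0 = 0 ->
  (forall x y, 0 <= x -> x <= y -> y <= 1 -> tau x <= tau y) ->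
  lebesgue_measure.-negligible N ->
  (forall t, 0 <= t <= 1 -> ~ N t ->
    [/\ derivable g t 1, Defs.distribution (g t) (derive1 g t)
      & is_derive t (1 : R) tau (hnorm (derive1 g t))]) ->
  dist_sz (sqnorm_xy (g 1)) (hz (g 1)) <= tau 1.
Proof.
move=> acg g0 s0 z0 tau0 taule nN gN.
set s := sqnorm_xy (g 1) in s0 *; set z := hz (g 1) in z0 *.
set D := dist_sz s z; set th := theta (s / z).
rewrite leNgt; apply/negP => tauD.
have D0 : 0 < D by exact: dist_sz_gt0.
have D2 : D ^+ 2 = 4 * th * z + th * cot th * s := dist_sz_sqr s0 z0.
have /andP[th0 thpi] : 0 < th < pi := theta_div_itv s0 z0.
(* Under the contrary assumption [tau 1 < D], the shift [e] keeps the argument [u] of the cotangent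
   in []0, th]], away from the pole at [0], with [u 1 = th]. *)
pose e := D - tau 1; have e0 : 0 < e by rewrite subr_gt0.
pose w := th / D; have w0 : 0 < w by rewrite divr_gt0.
have wD : w * D = th by rewrite divfK // gt_eqF.
pose u t := w * (tau t + e).
have tau_ge0 t : 0 <= t <= 1 -> 0 <= tau t.
  by move=> /andP[t0 t1]; rewrite -tau0; apply: taule.
have u_gt0 t : 0 <= t <= 1 -> 0 < u t.
  by move=> /tau_ge0 ?; rewrite mulr_gt0 // ltr_wpDl.
have u_le x y : 0 <= x -> x <= y -> y <= 1 -> u x <= u y.
  by move=> x0 xy y1; rewrite ler_pM2l // lerD2r taule.
have u1 : u 1 = th by rewrite /u /e addrC subrK.
have u_ltpi t : 0 <= t <= 1 -> u t < pi.
  move=> /andP[t0 t1]; apply: le_lt_trans thpi; rewrite -u1; exact: u_le.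
pose a t := w * cot (u t).
have a_le x y : 0 <= x -> x <= y -> y <= 1 -> a y <= a x.
  move=> x0 xy y1; rewrite ler_pM2l //; apply: cot_le; last 2 first.
  - exact: u_le.
  - by apply: u_ltpi; rewrite y1 (le_trans x0).
  - by apply: u_gt0; rewrite x0 (le_trans xy).
pose K := `|a 0| + `|a 1|.
have K0 : 0 <= K by rewrite addr_ge0.
have aK t : 0 <= t <= 1 -> `|a t| <= K.
  move=> /andP[t0 t1]; have := a_le _ _ (lexx 0) t0 t1.
  have := a_le _ _ t0 t1 (lexx 1); rewrite /K ler_norml.
  have := ler_norm (a 0); have := ler_norm (- a 1); rewrite normrN.
  have := normr_ge0 (a 0); have := normr_ge0 (a 1).
  by move=> *; apply/andP; split; lra.
pose F t := 2 * w * hz (g t) + a t * sqnorm_xy (g t) / 2 - tau t / 2.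
have F10 : F 1 <= F 0; last first.
  have : F 0 = 0.
    rewrite /F g0 tau0 [hz _]/= sqnorm_xyE big1; first by rewrite !(mulr0, mul0r) addr0 subr0.
    by move=> i _; rewrite /hx /hy !mxE expr0n addr0.
  (* By [dist_sz_sqr] this value is [(D - tau 1) / 2], which is positive. *)
  have F1 : F 1 = (4 * th * z + th * cot th * s - tau 1 * D) / (2 * D).
    by rewrite /F /a u1 -/s -/z /w; field; rewrite gt_eqF.
  move: F10; rewrite F1 -D2 leNgt => + F0; rewrite F0 => /negP; apply.
  by apply: divr_gt0; [rewrite subr_gt0 expr2 ltr_pM2r|rewrite mulr_gt0].
have [M M0 gM] := ac_bounded acg g0.
apply: (ac_nonincreasing nN).
  move=> t t01 Nt; have [dg hg dtau] := gN t t01 Nt => r r0.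
  set G := derive1 g t in hg dtau; set V := hnorm G in dtau.
  have DG : is_derive t (1 : R) g G.
    split; first exact: dg.
    by rewrite /G derive1E.
  have DS := is_derive_sqnorm_xy DG.
  have DZ : is_derive t (1 : R) (fun t => hz (g t)) (hz G).
    exact: is_derive_hz.
  have Da : is_derive t (1 : R) a (- (w ^+ 2 + a t ^+ 2) * V).
    rewrite /a; der.
    apply (@is_derive_compL _ _ cot u); first apply: is_derive_cot.
      by rewrite gt_eqF // sin_gt0_pi // u_gt0 // u_ltpi.
    by rewrite /u; repeat der1.
    by rewrite mul0r add0r; ring.
  pose l := 2 * w * hz G - (w ^+ 2 + a t ^+ 2) * V * sqnorm_xy (g t) / 2 +
     a t * \sum_i (hx i (g t) * hx i G + hy i (g t) * hy i G) - V / 2.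
  have DF : is_derive t (1 : R) F l.
    by rewrite /F; der; rewrite /l; field.
  (* The scaled cotangent satisfies the Riccati equation [a' = - (w ^ 2 + a ^ 2) tau'], and
     horizontality turns [2 w z'] into the pairing with [w J xi]; what is left is [hinner_amgm]. *)
  have l0 : l <= 0.
    move: hg; rewrite distributionP -/(hz G) => zG.
    have := hinner_amgm (a t) w (g t) G.
    have -> : \sum_i ((a t * hx i (g t) - w * hy i (g t)) * hx i G +
        (a t * hy i (g t) + w * hx i (g t)) * hy i G) =
      2 * w * hz G + a t * \sum_i (hx i (g t) * hx i G + hy i (g t) * hy i G).
      rewrite zG -mulrA mulrCA [2 * (2^-1 * _)]mulrA divff // mul1r !mulr_sumr.
      by rewrite -big_split /=; apply: eq_bigr => i _; ring.
    by rewrite -/V /l; lra.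
  have [d d0 Hd] := straddle DF l0 r0.
  by exists d => // x y *; apply: Hd.
pose C := 2 * w + K * (2 * n%:R * M) + 1.
have C0 : 0 < C.
  by rewrite /C; have := mulr_ge0 K0 (mulr_ge0 (mulr_ge0 (ler0n R 2) (ler0n R n)) (ltW M0)); lra.
(* An upper bound is enough here: the increments of [a] and of [- tau / 2], which [g] does not
   control, are nonpositive. *)
have Fle x y : 0 <= x -> x <= y -> y <= 1 -> F y - F x <= C * `|g y - g x|.
  move=> x0 xy y1.
  have x01 : 0 <= x <= 1 by rewrite x0 (le_trans xy).
  have y01 : 0 <= y <= 1 by rewrite y1 (le_trans x0).
  have zle : hz (g y) - hz (g x) <= `|g y - g x|.
    exact: le_trans (ler_norm _) (hz_norm (g y - g x)).
  have sqle (b c : R) : `|b| <= M -> `|c| <= M -> `|b - c| <= `|g y - g x| ->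
      `|b ^+ 2 - c ^+ 2| <= 2 * M * `|g y - g x|.
    move=> bM cM bc; rewrite subr_sqr normrM mulrC ler_pM //.
    by have := ler_normD b c; lra.
  have sle : `|sqnorm_xy (g y) - sqnorm_xy (g x)| <= 4 * n%:R * M * `|g y - g x|.
    rewrite !sqnorm_xyE -sumrB.
    apply: le_trans (ler_norm_sum _ _ _) _.
    have -> : 4 * n%:R * M * `|g y - g x| = \sum_(i < n) (4 * M * `|g y - g x|).
      by rewrite sumr_const card_ord -mulr_natl; ring.
    apply: ler_sum => i _.
    have h1 := sqle (hx i (g y)) (hx i (g x)) (le_trans (hx_norm _ _) (gM _ y01))
      (le_trans (hx_norm _ _) (gM _ x01)) _.
    have h2 := sqle (hy i (g y)) (hy i (g x)) (le_trans (hy_norm _ _) (gM _ y01))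
      (le_trans (hy_norm _ _) (gM _ x01)) _.
    have e1 : hx i (g y) - hx i (g x) = hx i (g y - g x) by rewrite /hx !mxE.
    have e2 : hy i (g y) - hy i (g x) = hy i (g y - g x) by rewrite /hy !mxE.
    move: h1 h2; rewrite e1 e2 => /(_ (hx_norm _ _)) h1 /(_ (hy_norm _ _)) h2.
    have := ler_normD (hx i (g y) ^+ 2 - hx i (g x) ^+ 2) (hy i (g y) ^+ 2 - hy i (g x) ^+ 2).
    rewrite opprD addrACA; lra.
  have := taule _ _ x0 xy y1 => tle; have := a_le _ _ x0 xy y1 => ale.
  have aS : a y * (sqnorm_xy (g y) - sqnorm_xy (g x)) <= K * (4 * n%:R * M * `|g y - g x|).
    by apply: le_trans (ler_norm _) _; rewrite normrM ler_pM // aK.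
  have aS' : (a y - a x) * sqnorm_xy (g x) <= 0.
    by rewrite mulr_le0_ge0 ?subr_le0 // sqnorm_xy_ge0.
  have wz : 2 * w * (hz (g y) - hz (g x)) <= 2 * w * `|g y - g x|.
    by rewrite ler_wpM2l // mulr_ge0 // ltW.
  have := normr_ge0 (g y - g x).
  by rewrite /F /C; nra.
move=> r r0; have [d d0 Hd] := acg (r / C) (divr_gt0 r0 C0).
exists d => // m lo hi lohi triv sumd.
have := Hd m lo hi lohi triv sumd.
rewrite ltr_pdivlMr // mulrC mulr_sumr; apply: le_lt_trans.
by apply: ler_sum => i _; have [? ? ?] := lohi i; apply: Fle.
Qed.

End calibration.

(** * Comparison of integrals without measurability *)

Section integral_lemmas.
Import HBNNSimple.
Local Open Scope ereal_scope.
Context d (T : measurableType d) (R : realType) (mu : {measure set T -> \bar R}).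

(* No measurability of [f], [g] or [D]: the integral of a nonnegative function
   is a supremum over the simple functions below it. *)
Lemma ge0_ae_le_integral_lower (D : set T) (f g : T -> \bar R) (N : set T) :
  mu.-negligible N ->
  (forall x, D x -> 0 <= f x) -> (forall x, D x -> 0 <= g x) ->
  (forall x, D x -> ~ N x -> f x <= g x) ->
  \int[mu]_(x in D) f x <= \int[mu]_(x in D) g x.
Proof.
move=> [A [mA A0 NA]] f0 g0 fg.
rewrite !ge0_integralE //; apply: ge_ereal_sup => _ [h /= hf <-].
(* Cutting the simple function [h] off the null set [A] keeps its integral and leaves it below [g]
   everywhere. *)
pose h' := proj_nnsfun h (measurableC mA).
have -> : sintegral mu h = sintegral mu h'.
  rewrite -!integralT_nnsfun; apply: ae_eq_integral => //.
  - by apply/measurable_EFinP; exact: measurable_funTS.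
  - by apply/measurable_EFinP; exact: measurable_funTS.
  exists A; split => // x /=; apply: contra_notP => Ax _.
  by rewrite /h' /= mindicE mem_set ?mulr1.
apply: ereal_sup_ubound; exists h' => //= x.
have [Dx|Dx] := pselect (D x); last first.
  have := hf x; rewrite !patchE memNset //= lee_fin => hx0.
  have -> : h x = 0%R by apply/eqP; rewrite eq_le hx0 fun_ge0.
  by rewrite mul0r.
rewrite patchE mem_set //= mindicE.
have [Ax|Ax] := pselect (A x); first by rewrite memNset ?mulr0 ?g0 //=; apply/not_notP.
rewrite mem_set // mulr1; apply: le_trans (fg x Dx _); last by move/NA.
by have := hf x; rewrite patchE mem_set.
Qed.

End integral_lemmas.

Lemma continuous_sumL {R : realType} {V : topologicalType} m (f : 'I_m -> V -> R) :
  (forall i, continuous (f i)) -> continuous (fun t => \sum_i f i t).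
Proof.
move=> fc; rewrite (_ : (fun _ => _) = \sum_i f i); last first.
  by apply/funext => t; rewrite fct_sumE.
elim/big_ind: _ => [|g h gc hc|i _]; last exact: fc.
  by move=> x; exact: cvg_cst.
by move=> x; apply: continuousD; [exact: gc|exact: hc].
Qed.

(** * Lower bound for the length of a horizontal curve *)

Section curve_length_lower_bound.
Context {R : realType} {n : nat}.
Implicit Types (p v : heis R n) (g : R -> heis R n).

Lemma sqnorm_xy_continuous : continuous (@sqnorm_xy R n).
Proof.
rewrite (_ : @sqnorm_xy R n = fun p => \sum_i (hx i p * hx i p + hy i p * hy i p)).
  apply: continuous_sumL => i p; apply: cvgD; apply: cvgM;
  solve [exact: hx_continuous|exact: hy_continuous].
by apply/funext => p; apply: eq_bigr => i _; rewrite !expr2.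
Qed.

Lemma hnormE v : hnorm v = Num.sqrt (sqnorm_xy v).
Proof. by congr Num.sqrt; apply: eq_bigr => i _; rewrite !expr2. Qed.

Lemma hnorm_continuous : continuous (@hnorm R n).
Proof.
rewrite (_ : @hnorm R n = Num.sqrt \o @sqnorm_xy R n); last first.
  by apply/funext => v; rewrite hnormE.
move=> v; apply: continuous_comp; first exact: sqnorm_xy_continuous.
exact: sqrt_continuous.
Qed.

(** Curves are constrained on [[0, 1]] only; composing with this retraction makes them continuous on
    the whole line. *)
Definition clamp01 (t : R) : R := Num.max 0 (Num.min 1 t).

Lemma clamp01_itv t : 0 <= clamp01 t <= 1.
Proof. by rewrite /clamp01 le_max lexx ge_max ler01 ge_min lexx. Qed.

Lemma clamp01_id t : 0 <= t <= 1 -> clamp01 t = t.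
Proof. by move=> /andP[t0 t1]; rewrite /clamp01 min_r // max_r. Qed.

Lemma clamp01_lip t t' : t <= t' -> clamp01 t <= clamp01 t' <= clamp01 t + (t' - t).
Proof.
by move=> tt'; rewrite /clamp01 /Num.max /Num.min; do !case: ifPn;
  rewrite -?leNgt => *; apply/andP; split; lra.
Qed.

Lemma ac_clamp_continuous g : abs_continuous 0 1 g -> continuous (g \o clamp01).
Proof.
move=> acg t; apply/cvgrPdist_lt => e e0; have [d d0 Hd] := acg e e0.
have H x y : 0 <= x -> x <= y -> y <= 1 -> y - x < d -> `|g y - g x| < e.
  move=> x0 xy y1 xyd.
  have := Hd 1%N (fun=> x) (fun=> y); rewrite !big_ord1; apply => //.
  by apply/trivIsetP => i j _ _; rewrite !ord1 eqxx.
have H2 x y : x <= y -> y - x < d -> `|g (clamp01 y) - g (clamp01 x)| < e.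
  move=> xy xyd; have /andP[? ?] := clamp01_lip xy.
  have /andP[? _] := clamp01_itv x; have /andP[_ ?] := clamp01_itv y.
  by apply: H => //; lra.
apply/nbhs_ballP; exists d => //= x; rewrite /ball /= ltr_norml => /andP[xd1 xd2].
have [xt|tx] := leP x t; first by apply: H2 => //; lra.
by rewrite distrC; apply: H2; [exact: ltW|lra].
Qed.

(** Norms of difference quotients of step [1 / (k + 1)]: they are continuous in [t] and converge to
    the speed wherever [g] is differentiable inside []0, 1[]. Their upper limit is thus a measurable
    version of the speed. *)
Let q g (k : nat) (t : R) : R :=
  hnorm (k.+1%:R *: (g (clamp01 (t + k.+1%:R^-1)) - g (clamp01 t))).

Let q_continuous g k : abs_continuous 0 1 g -> continuous (q g k).
Proof.
move=> acg; have gc := ac_clamp_continuous acg.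
have H : continuous (fun t : R =>
    k.+1%:R *: (g (clamp01 (t + k.+1%:R^-1)) - g (clamp01 t))).
  move=> t; apply: cvgZr; apply: cvgB; last exact: gc.
  have H1 : {for t, continuous (fun t : R => t + k.+1%:R^-1)}.
    by apply: cvgD; [exact: cvg_id|exact: cvg_cst].
  exact: (continuous_comp H1 (gc _)).
by move=> t; exact: (continuous_comp (H t) (@hnorm_continuous _)).
Qed.

Let q_cvg g t : 0 < t < 1 -> derivable g t 1 ->
  q g k t @[k --> \oo] --> hnorm (derive1 g t).
Proof.
move=> /andP[t0 t1] dg.
apply: (@cvg_comp _ _ _ (fun k : nat =>
  k.+1%:R *: (g (clamp01 (t + k.+1%:R^-1)) - g (clamp01 t))) (@hnorm R n));
  last exact: hnorm_continuous.
rewrite derive1E.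
have cv : (fun h : R => h^-1 *: (g (h *: 1 + t) - g t)) @ 0^' --> 'D_1 g t := dg.
have inv0 : (fun k : nat => k.+1%:R^-1 : R) @ \oo --> 0^'.
  move=> A /(@cvg_harmonic R) [N _ NA]; exists N => // k /NA; apply.
  by rewrite /= invr_eq0 pnatr_eq0.
have := cvg_comp _ _ inv0 cv; apply: cvg_trans; apply: near_eq_cvg.
have small : \forall k \near \oo, k.+1%:R^-1 < 1 - t.
  by have /cvgr_lt := @cvg_harmonic R; apply; rewrite subr_gt0.
near=> k; have kt : k.+1%:R^-1 < 1 - t by near: k.
have k0 : 0 < k.+1%:R^-1 :> R by rewrite invr_gt0.
rewrite /= invrK [_ *: 1]mulr1 [_ + t]addrC !clamp01_id ?(ltW t0) ?(ltW t1) //.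
rewrite addr_ge0 ?(ltW t0) ?(ltW k0) //=.
by move: kt; rewrite ltrBrDl => /ltW.
Unshelve. all: by end_near. Qed.

(** [calibration] is applied to the primitive [tau] of a measurable version [f] of the speed.
    Lebesgue differentiation gives [tau' = f] almost everywhere, and [tau 1] is at most the length,
    which may be assumed finite. *)
Lemma curve_length_ge g : horizontal_curve g -> g 0 = 0 ->
  0 < sqnorm_xy (g 1) -> 0 < hz (g 1) ->
  ((dist_sz (sqnorm_xy (g 1)) (hz (g 1)))%:E <= curve_length g)%E.
Proof.
move=> [acg hg] g0 s0 z0.
pose v t := hnorm (derive1 g t).
have L0 : (0 <= curve_length g)%E by apply: integral_ge0 => t _; rewrite lee_fin hnorm_ge0.
have [Loo|Lfin] := eqVneq (curve_length g) +oo%E; first by rewrite Loo leey.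
have Lf : curve_length g \is a fin_num by rewrite ge0_fin_numE // ltey.
pose W t := limn_esup (fun k => (q g k t)%:E).
have mW : measurable_fun setT W.
  apply: measurable_fun_limn_esup => k; apply/measurable_EFinP.
  by apply: continuous_measurable_fun; exact: q_continuous.
pose f t := `|fine (W t)| * \1_(`[0, 1]%classic) t.
have mf : measurable_fun setT f.
  apply: measurable_funM; last exact: measurable_indic.
  apply: measurableT_comp => //; apply: measurableT_comp => //.
have f0 t : 0 <= f t by rewrite mulr_ge0.
case: hg => N0 [mN0 N00 N0P].
(* The end points are discarded because [q_cvg] holds at interior points. *)
pose N1 := N0 `|` ([set 0] `|` [set 1]).
have nN1 : lebesgue_measure.-negligible N1.
  apply: negligibleU; first by exists N0; split.
  by apply: negligibleU; [exists [set 0]|exists [set 1]]; split => //;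
    exact: lebesgue_measure_set1.
have good t : 0 <= t <= 1 -> ~ N1 t ->
    [/\ derivable g t 1, Defs.distribution (g t) (derive1 g t) & f t = v t].
  move=> t01 Nt; have [t0 t1] : t != 0 /\ t != 1.
    by split; apply/eqP => tE; apply: Nt; right; [left|right].
  have [dg hg] : derivable g t 1 /\ Defs.distribution (g t) (derive1 g t).
    apply: contrapT => H; apply: Nt; left; apply: N0P => /= H'; apply: H.
    by apply: H'; rewrite in_itv.
  split => //; rewrite /f indicE mem_set ?in_itv //= mulr1.
  have -> : W t = (v t)%:E.
    apply: (cvg_limn_einf_sup _).2; apply: cvg_EFin; first exact: nearW.
    by apply: q_cvg => //; rewrite !lt_neqAle eq_sym t0 t1.
  by rewrite /= ger0_norm // hnorm_ge0.
have fL : (\int[lebesgue_measure]_t (f t)%:E <= curve_length g)%E.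
  rewrite /curve_length [leRHS]integral_mkcond.
  apply: (ge0_ae_le_integral_lower nN1) => [t _|t _|t _ Nt].
  - by rewrite lee_fin.
  - by rewrite patchE; case: ifP => // _; rewrite lee_fin hnorm_ge0.
  - rewrite patchE; case: ifPn => [|/negP tn].
      by rewrite inE /= in_itv /= => t01; have [_ _ ->] := good t t01 Nt.
    by rewrite /f indicE (negbTE (introN idP tn)) mulr0.
have intf : lebesgue_measure.-integrable setT (EFin \o f).
  apply/integrableP; split; first exact/measurable_EFinP.
  under eq_integral => t _ do rewrite /= ger0_norm //.
  by apply: le_lt_trans fL _; rewrite ltey.
pose tau (y : R) := (\int[lebesgue_measure]_(t in [set` `[0, y]]) f t)%R.
have ify (y : R) : lebesgue_measure.-integrable [set` Interval (BLeft (0 : R)) (BRight y)] (EFin \o f).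
  by apply: integrableS intf => //; exact: measurable_itv.
have locf : locally_integrable [set: R] f.
  by apply: open_integrable_locally; [exact: openT|exact: intf].
have [N2 [mN2 N20 N2P]] := FTC1 ify locf.
have tau1 : tau 1 <= fine (curve_length g).
  rewrite /tau /Rintegral fine_le //.
    by apply: integrable_fin_num => //; exact: integrableS intf.
  apply: le_trans fL; apply: ge0_subset_integral => //.
    exact/measurable_EFinP.
  by move=> t _; rewrite lee_fin.
rewrite -(fineK Lf) lee_fin; apply: le_trans tau1.
apply: (@calibration _ _ g tau (N1 `|` N2)) => //.
- by rewrite /tau set_itv1 Rintegral_set1.
- move=> x y x0 xy y1; rewrite /tau /Rintegral fine_le //.
  + by apply: integrable_fin_num => //; exact: integrableS intf.
  + by apply: integrable_fin_num => //; exact: integrableS intf.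
  + apply: ge0_subset_integral => //.
    * by apply/measurable_EFinP; exact: measurable_funTS.
    * by move=> t _; rewrite lee_fin.
    * by move=> t /=; rewrite !in_itv /= => /andP[-> /le_trans]; apply.
- by apply: (negligibleU nN1); exists N2; split.
- move=> t t01 Nt; have [|dg hg fv] := good t t01; first by move=> ?; apply: Nt; left.
  have t0 : 0 < t.
    rewrite lt_neqAle eq_sym; case/andP: t01 => -> _; rewrite andbT.
    by apply/eqP => tE; apply: Nt; left; right; left.
  split => //; have [dtau Dtau] : derivable tau t 1 /\ derive1 tau t = f t.
    apply: contrapT => H; apply: Nt; right; apply: N2P => /= H'; apply: H.
    by apply: H'; rewrite lte_fin.
  by split=> //; rewrite -derive1E Dtau fv.
Qed.

End curve_length_lower_bound.

(** * Geodesics and the formula for the distance *)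

Section geodesic.
Context {R : realType} {n : nat}.
Implicit Types (p v : heis R n).

Lemma derivative_lipschitz (f df : R -> R) (K : R) :
  (forall x, is_derive x (1 : R) f (df x)) -> (forall x, `|df x| <= K) ->
  forall l r, l <= r -> `|f r - f l| <= K * (r - l).
Proof.
move=> fD dfK l r; rewrite le_eqVlt => /predU1P[->|lr].
  by rewrite !subrr normr0 mulr0.
have [c _ ->] := mvt lr (fun x _ => fD x).
by rewrite normrM [X in _ * X]gtr0_norm ?subr_gt0 // ler_wpM2r // subr_ge0 ltW.
Qed.

Lemma is_derive_scalel {W : normedModType R} (f : R -> R) (e : W) (t a : R) :
  is_derive t (1 : R) f a -> is_derive t (1 : R) (fun t => f t *: e) (a *: e).
Proof.
apply: (@is_derive_linear_comp _ _ _ _ (fun k : R => k *: e)).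
  by move=> k x y; rewrite scalerDl scalerA.
by move=> x; apply: cvgZl; exact: cvg_id.
Qed.

Section arc.
Variables (p : heis R n) (th : R).
Hypothesis sth : 0 < sin th.

Let s := sqnorm_xy p.
Let e1 : heis R n := (p.1.1, p.1.2, 0).
Let e2 : heis R n := (- p.1.2, p.1.1, 0).
Let e3 : heis R n := (0, 0, 1).
(** The projection of the curve is [sin (th t) / sin th] times [xi] rotated by the angle
    [th (t - 1)]: an arc of circle from [0] to [xi], run at constant speed. The height [ze] is the
    signed area that it sweeps. *)
Let al (t : R) := sin (th * t) * cos (th * (t - 1)) / sin th.
Let be (t : R) := sin (th * t) * sin (th * (t - 1)) / sin th.
Let ze (t : R) := s / (4 * sin th ^+ 2) * (th * t - sin (th * t) * cos (th * t)).
Let al' (t : R) := th / sin th * cos (th * t + th * (t - 1)).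
Let be' (t : R) := th / sin th * sin (th * t + th * (t - 1)).
Let ze' (t : R) := s * th / (2 * sin th ^+ 2) * sin (th * t) ^+ 2.

Definition arc (t : R) : heis R n := al t *: e1 + be t *: e2 + ze t *: e3.
Definition arc' (t : R) : heis R n := al' t *: e1 + be' t *: e2 + ze' t *: e3.

Let al_derive t : is_derive t (1 : R) al (al' t).
Proof.
have s0 : sin th != 0 by rewrite gt_eqF.
by rewrite /al; der; rewrite /al' cosD; field.
Qed.
Let be_derive t : is_derive t (1 : R) be (be' t).
Proof.
have s0 : sin th != 0 by rewrite gt_eqF.
by rewrite /be; der; rewrite /be' sinD; field.
Qed.
Let ze_derive t : is_derive t (1 : R) ze (ze' t).
Proof.
have s0 : sin th != 0 by rewrite gt_eqF.
by rewrite /ze; der; rewrite /ze'; field: (cos2sin2 (th * t)).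
Qed.

Lemma arc_derive t : is_derive t (1 : R) arc (arc' t).
Proof.
have D1 := is_derive_scalel e1 (al_derive t).
have D2 := is_derive_scalel e2 (be_derive t).
have D3 := is_derive_scalel e3 (ze_derive t).
exact: is_deriveD (is_deriveD D1 D2) D3.
Qed.

Lemma hx_comb (a b c : R) i : hx i (a *: e1 + b *: e2 + c *: e3) = a * hx i p - b * hy i p.
Proof. by rewrite /hx /hy /= !mxE; ring. Qed.
Lemma hy_comb (a b c : R) i : hy i (a *: e1 + b *: e2 + c *: e3) = a * hy i p + b * hx i p.
Proof. by rewrite /hx /hy /= !mxE; ring. Qed.
Lemma hz_comb (a b c : R) : hz (a *: e1 + b *: e2 + c *: e3) = c.
Proof. by rewrite /hz /= /GRing.scale /=; ring. Qed.

Lemma hnorm_arc' t : 0 <= th -> hnorm (arc' t) = th * Num.sqrt s / sin th.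
Proof.
move=> th0; rewrite hnormE sqnorm_xyE.
have -> : \sum_i (hx i (arc' t) ^+ 2 + hy i (arc' t) ^+ 2) = (th / sin th) ^+ 2 * s.
  rewrite /s sqnorm_xyE mulr_sumr; apply: eq_bigr => i _.
  rewrite hx_comb hy_comb /al' /be'.
  by ring: (cos2sin2 (th * t + th * (t - 1))).
rewrite sqrtrM ?sqr_ge0 // sqrtr_sqr ger0_norm ?divr_ge0 // ?ltW //.
by rewrite mulrAC.
Qed.

Lemma arc_horizontal t : Defs.distribution (arc t) (arc' t).
Proof.
apply/distributionP; rewrite -/(hz _) hz_comb.
have -> : \sum_i (hx i (arc t) * hy i (arc' t) - hy i (arc t) * hx i (arc' t)) =
   (al t * be' t - be t * al' t) * s.
  rewrite /s sqnorm_xyE mulr_sumr; apply: eq_bigr => i _.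
  by rewrite !hx_comb !hy_comb; ring.
rewrite /ze' /al /be' /be /al' sinD cosD.
by field: (cos2sin2 (th * (t - 1))); rewrite gt_eqF.
Qed.

Lemma arc_ac : abs_continuous 0 1 arc.
Proof.
have s0 : sin th != 0 by rewrite gt_eqF.
have bnd (c u : R) : `|u| <= 1 -> `|c * u| <= `|c|.
  by move=> u1; rewrite normrM ler_piMr.
pose K := `|th / sin th|; pose K' := `|s * th / (2 * sin th ^+ 2)|.
have L1 := derivative_lipschitz al_derive (fun t => bnd (th / sin th) _ (cos_max _)).
have L2 := derivative_lipschitz be_derive (fun t => bnd (th / sin th) _ (sin_max _)).
have L3 := derivative_lipschitz ze_derive (fun t => bnd (s * th / (2 * sin th ^+ 2)) _ _).
pose C := K * `|e1| + K * `|e2| + K' * `|e3| + 1.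
have K0 : 0 <= K := normr_ge0 _; have K'0 : 0 <= K' := normr_ge0 _.
have Ke1 := mulr_ge0 K0 (normr_ge0 e1); have Ke2 := mulr_ge0 K0 (normr_ge0 e2).
have Ke3 := mulr_ge0 K'0 (normr_ge0 e3).
have C0 : 0 < C by rewrite /C; lra.
have Lip l r : l <= r -> `|arc r - arc l| <= C * (r - l).
  move=> lr; rewrite /arc.
  have -> : al r *: e1 + be r *: e2 + ze r *: e3 - (al l *: e1 + be l *: e2 + ze l *: e3) =
     (al r - al l) *: e1 + (be r - be l) *: e2 + (ze r - ze l) *: e3.
    by rewrite !opprD !scalerBl addrACA; congr (_ + _); rewrite addrACA.
  apply: le_trans (ler_normD _ _) _.
  have H1 := L1 _ _ lr; have H2 := L2 _ _ lr.
  have H3 : `|ze r - ze l| <= K' * (r - l).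
    apply: L3 => // t; rewrite normrX expr_le1 //; exact: sin_max.
  have N1 : `|(al r - al l) *: e1| <= K * (r - l) * `|e1| by rewrite normrZ ler_wpM2r.
  have N2 : `|(be r - be l) *: e2| <= K * (r - l) * `|e2| by rewrite normrZ ler_wpM2r.
  have N3 : `|(ze r - ze l) *: e3| <= K' * (r - l) * `|e3| by rewrite normrZ ler_wpM2r.
  have := ler_normD ((al r - al l) *: e1) ((be r - be l) *: e2).
  have rl : 0 <= r - l by rewrite subr_ge0.
  by rewrite /C; nra.
move=> e0 e00; exists (e0 / C); first exact: divr_gt0.
move=> m l r lr _ suml.
apply: (@le_lt_trans _ _ (\sum_i C * (r i - l i))).
  by apply: ler_sum => i _; apply: Lip; have [] := lr i.
by rewrite -mulr_sumr mulrC -ltr_pdivlMr.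
Qed.

Lemma arc0 : arc 0 = 0.
Proof.
rewrite /arc /al /be /ze !mulr0 sin0 !(mul0r, subrr, mulr0).
by rewrite !scale0r !addr0.
Qed.

Lemma arc1 : hz p = s * (th - sin th * cos th) / (4 * sin th ^+ 2) -> arc 1 = p.
Proof.
have s0 : sin th != 0 by rewrite gt_eqF.
move=> pz; rewrite /arc /al /be /ze subrr !mulr1 mulr0 cos0 sin0 mulr1 mulr0 mul0r.
rewrite divff // scale0r addr0 scale1r mulrAC -pz.
rewrite [RHS](surjective_pairing p) [p.1]surjective_pairing; congr (_, _, _) => /=.
- by rewrite scaler0 addr0.
- by rewrite scaler0 addr0.
- by rewrite /GRing.scale /= mulr1 add0r.
Qed.

Lemma arc_length : 0 <= th -> curve_length arc = (th * Num.sqrt s / sin th)%:E.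
Proof.
move=> th0; rewrite /curve_length.
under eq_integral => t _.
  rewrite derive1E (@derive_val _ _ _ _ _ _ _ (arc_derive t)) hnorm_arc' //.
  over.
rewrite integral_cst //= lebesgue_measure_itv /= lte_fin ltr01 oppr0 adde0.
by rewrite mule1.
Qed.

End arc.

(** The infimum is attained by [arc], hence finite, so that [fine] in the definition of [cc_dist0]
    is harmless. *)
Lemma cc_dist0E p : 0 < sqnorm_xy p -> 0 < hz p ->
  cc_dist0 p = dist_sz (sqnorm_xy p) (hz p).
Proof.
move=> s0 z0; rewrite /cc_dist0.
set th := theta (sqnorm_xy p / hz p).
have thin : 0 < th < pi := theta_div_itv s0 z0.
have sth := sin_gt0_pi thin.
rewrite (_ : ereal_inf _ = (dist_sz (sqnorm_xy p) (hz p))%:E) //.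
apply/eqP; rewrite eq_le; apply/andP; split; last first.
  apply: le_ereal_inf_tmp => _ [g [hg g0 g1] <-].
  by rewrite -g1 in s0 z0 *; exact: curve_length_ge.
apply: ereal_inf_lbound; exists (arc p th).
  split; [split|exact: arc0|].
  - exact: arc_ac.
  - apply: aeW => t _; have D := arc_derive p sth t.
    split; first by case: D.
    by rewrite derive1E (@derive_val _ _ _ _ _ _ _ D); exact: arc_horizontal.
  - by apply: arc1 => //; exact: theta_divE.
by rewrite arc_length //; case/andP: thin => /ltW.
Qed.

End geodesic.

Lemma near_gt0 {R : realType} {V : topologicalType} (f : V -> R) (p : V) :
  {for p, continuous f} -> 0 < f p -> \forall q \near p, 0 < f q.
Proof. by move=> fc fp; exact: (cvgr_gt _ fc). Qed.

(** * Horizontal gradients and the gradient of the distance *)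

Section horizontal_gradient.
Context {R : realType} {n : nat}.
Implicit Types (p v w : heis R n) (u : heis R n -> R).

Lemma hinnerC v w : hinner v w = hinner w v.
Proof. by apply: eq_bigr => i _; rewrite ![_ * (w.1 : 'rV__ * 'rV__)%type.1 _ _]mulrC ![_ * (w.1 : 'rV__ * 'rV__)%type.2 _ _]mulrC. Qed.

Lemma hinnerE v w : hinner v w = \sum_i (hx i v * hx i w + hy i v * hy i w).
Proof. by []. Qed.

Lemma hinnerDl v v' w : hinner (v + v') w = hinner v w + hinner v' w.
Proof. by rewrite -big_split; apply: eq_bigr => i _ /=; rewrite !mxE; ring. Qed.

Lemma hinnerZl k v w : hinner (k *: v) w = k * hinner v w.
Proof. by rewrite mulr_sumr; apply: eq_bigr => i _ /=; rewrite !mxE; ring. Qed.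

Lemma hinnerBl v v' w : hinner (v - v') w = hinner v w - hinner v' w.
Proof. by rewrite -scaleN1r hinnerDl hinnerZl mulN1r. Qed.

(** Since [hinner] does not see the vertical component, gradients are identified below through [.1]
    only. *)
Lemma hinner_fst v v' w : v.1 = v'.1 -> hinner v w = hinner v' w.
Proof. by move=> E; apply: eq_bigr => i _; rewrite E. Qed.

(** The vectors [xi] and, next, [J xi]. Their vertical component is set to [0] rather than to the
    value that would make them horizontal, as they are used through [hinner] or [.1]. *)
Definition radial p : heis R n := (p.1.1, p.1.2, 0).
Definition rotational p : heis R n := (- p.1.2, p.1.1, 0).

Lemma hinner_radial p : hinner (radial p) (radial p) = sqnorm_xy p.
Proof. by apply: eq_bigr => i _; rewrite !expr2. Qed.
Lemma hinner_rotational p : hinner (rotational p) (rotational p) = sqnorm_xy p.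
Proof. by apply: eq_bigr => i _ /=; rewrite !mxE; ring. Qed.
Lemma hinner_radial_rotational p : hinner (radial p) (rotational p) = 0.
Proof. by apply: big1 => i _ /=; rewrite !mxE; ring. Qed.

Lemma hx_hgrad u p i : hx i (hgrad u p) = 'D_(Xfield i p) u p.
Proof.
have := frame_comb p (\row_i 'D_(Xfield i p) u p) (\row_i 'D_(Yfield i p) u p).
by under eq_bigr do rewrite !mxE; rewrite -/(hgrad u p) /hx => -> /=; rewrite mxE.
Qed.

Lemma hy_hgrad u p i : hy i (hgrad u p) = 'D_(Yfield i p) u p.
Proof.
have := frame_comb p (\row_i 'D_(Xfield i p) u p) (\row_i 'D_(Yfield i p) u p).
by under eq_bigr do rewrite !mxE; rewrite -/(hgrad u p) /hy => -> /=; rewrite mxE.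
Qed.

(* [us] and [uz] are the derivatives of [u] in the variables [sqnorm_xy] and [hz]. *)
Definition is_derive_sz u p (us uz : R) := forall v,
  is_derive p v u (us * (2 * \sum_i (hx i p * hx i v + hy i p * hy i v)) + uz * hz v).

Lemma sum_deltal (a b : 'I_n -> R) i :
  \sum_j (a j * (delta_mx ord0 i : 'rV[R]_n) ord0 j + b j * (0 : 'rV[R]_n) ord0 j) = a i.
Proof.
rewrite (bigD1 i) //= big1 => [|j ji]; rewrite !mxE ?eqxx /=.
  by rewrite mulr1 mulr0 !addr0.
by rewrite (negbTE ji) !mulr0 addr0.
Qed.

Lemma hgrad_sz u p us uz : is_derive_sz u p us uz ->
  (hgrad u p).1 = ((2 * us) *: radial p + (uz / 2) *: rotational p).1.
Proof.
move=> Du; rewrite [LHS]surjective_pairing; congr (_, _); apply/rowP => i.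
  rewrite -/(hx i (hgrad u p)) hx_hgrad (@derive_val _ _ _ _ _ _ _ (Du _)).
  rewrite /hz /hx /hy /= sum_deltal !mxE; by field.
rewrite -/(hy i (hgrad u p)) hy_hgrad (@derive_val _ _ _ _ _ _ _ (Du _)).
rewrite /hz /hx /hy /=.
under eq_bigr do rewrite addrC; rewrite sum_deltal !mxE; by field.
Qed.

Definition th p : R := theta (sqnorm_xy p / hz p).

Lemma psiE p : psi p = 2 * th p.
Proof. by rewrite /th /theta mulrC divfK. Qed.

Lemma th_itv p : 0 < sqnorm_xy p -> 0 < hz p -> 0 < th p < pi.
Proof. exact: theta_div_itv. Qed.

Lemma hzE p : 0 < sqnorm_xy p -> 0 < hz p ->
  hz p = sqnorm_xy p * (th p - sin (th p) * cos (th p)) / (4 * sin (th p) ^+ 2).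
Proof. exact: theta_divE. Qed.

(** After the chain rule [z] is eliminated through [hzE], which leaves rational expressions in [t],
    [sin t], [cos t] and [s]. *)
Lemma is_derive_th p : 0 < sqnorm_xy p -> 0 < hz p ->
  let t := th p in let m := sin t - t * cos t in
  is_derive_sz th p (- (sin t * (t - sin t * cos t) / (2 * sqnorm_xy p * m)))
    (2 * sin t ^+ 3 / (sqnorm_xy p * m)).
Proof.
move=> s0 z0 t m v.
have tin : 0 < t < pi := th_itv s0 z0; have [t0 tpi] := andP tin.
have m0 : 0 < m by rewrite subr_gt0 mul_cos_lt_sin.
have d0 : 0 < t - sin t * cos t by rewrite subr_gt0 sincos_lt.
have st := sin_gt0_pi tin.
have := is_derive_theta tin.
have -> : qratio t = sqnorm_xy p / hz p by have [_ ->] := thetaP (divr_gt0 s0 z0).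
move=> Dth; have Dp := @is_derive_id R (heis R n) p v.
have Dz := is_derive_hz Dp; have Ds := is_derive_sqnorm_xy Dp.
have zn : hz p != 0 by rewrite gt_eqF.
eapply is_derive_eq.
  apply: (@is_derive_compL _ _ theta (fun q : heis R n => sqnorm_xy q / hz q) _ _ _ _ Dth).
  by repeat der1.
move: (\sum_i _) => S; rewrite -/t -/m (hzE s0 z0) -/t.
by field; rewrite !gt_eqF.
Qed.

Lemma is_derive_dist p : 0 < sqnorm_xy p -> 0 < hz p ->
  is_derive_sz cc_dist0 p (cos (th p) / (2 * Num.sqrt (sqnorm_xy p)))
    (2 * sin (th p) / Num.sqrt (sqnorm_xy p)).
Proof.
move=> s0 z0 v; set t := th p.
have tin : 0 < t < pi := th_itv s0 z0; have [t0 tpi] := andP tin.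
have st := sin_gt0_pi tin.
have m0 : 0 < sin t - t * cos t by rewrite subr_gt0 mul_cos_lt_sin.
have H1 := near_gt0 (@sqnorm_xy_continuous R n p) s0.
have H2 := near_gt0 (@hz_continuous R n p) z0.
apply: (@is_derive_near _ _ (fun p => th p * Num.sqrt (sqnorm_xy p) / sin (th p))).
  near=> q; rewrite cc_dist0E //; near: q.
    exact: H1.
  exact: H2.
have Dp := @is_derive_id R (heis R n) p v.
have Dt := is_derive_th s0 z0 v.
have Ds := is_derive_sqnorm_xy Dp.
have Dr := is_derive_compL (is_derive1_sqrt s0) Ds.
have sn : sin (th p) != 0 by rewrite gt_eqF.
eapply is_derive_eq; first by repeat der1.
rewrite -/t; move: (\sum_i _) => S.
have r0 : 0 < Num.sqrt (sqnorm_xy p) by rewrite sqrtr_gt0.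
rewrite -(sqr_sqrtr (ltW s0)); move: (Num.sqrt _) r0 => r r0.
rewrite sqrtr_sqr (gtr0_norm r0).
by field: (sin2cos2 t); rewrite !gt_eqF.
Unshelve. all: by end_near. Qed.

(** Represents [hgrad cc_dist0], with which it agrees up to the vertical component; see
    [hgrad_dist]. *)
Definition nu p : heis R n :=
  (cos (th p) / Num.sqrt (sqnorm_xy p)) *: radial p +
  (sin (th p) / Num.sqrt (sqnorm_xy p)) *: rotational p.

Lemma hgrad_dist p : 0 < sqnorm_xy p -> 0 < hz p -> (hgrad cc_dist0 p).1 = (nu p).1.
Proof.
move=> s0 z0; rewrite (hgrad_sz (is_derive_dist s0 z0)).
have r0 : Num.sqrt (sqnorm_xy p) != 0 by rewrite gt_eqF // sqrtr_gt0.
by congr ((_ *: _ + _ *: _).1); field.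
Qed.

Lemma hinner_sz p (a b c d : R) :
  hinner (a *: radial p + b *: rotational p) (c *: radial p + d *: rotational p) =
  (a * c + b * d) * sqnorm_xy p.
Proof.
rewrite !(hinnerDl, hinnerZl) ![hinner _ (_ + _)]hinnerC !(hinnerDl, hinnerZl).
rewrite hinner_radial hinner_rotational [hinner (rotational p) _]hinnerC.
by rewrite hinner_radial_rotational; ring.
Qed.

Lemma hinner_nu p : 0 < sqnorm_xy p -> hinner (nu p) (nu p) = 1.
Proof.
move=> s0; rewrite hinner_sz -{5}(sqr_sqrtr (ltW s0)).
have : 0 < Num.sqrt (sqnorm_xy p) by rewrite sqrtr_gt0.
move: (Num.sqrt _) => r r0.
by field: (sin2cos2 (th p)); rewrite gt_eqF.
Qed.

Lemma hinner_perp u p w : 0 < sqnorm_xy p -> 0 < hz p ->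
  hinner (hgrad_perp u p) w =
  hinner (hgrad u p) w - hinner (hgrad u p) (nu p) * hinner (nu p) w.
Proof.
move=> s0 z0; rewrite /hgrad_perp hinnerBl hinnerZl.
have D := hgrad_dist s0 z0.
by rewrite (hinner_fst w D) [hinner (hgrad u p) (hgrad cc_dist0 p)]hinnerC
  (hinner_fst _ D) [hinner (nu p) (hgrad u p)]hinnerC.
Qed.

Lemma hnorm_perp u p : 0 < sqnorm_xy p -> 0 < hz p ->
  hnorm (hgrad_perp u p) ^+ 2 =
  hinner (hgrad u p) (hgrad u p) - hinner (hgrad u p) (nu p) ^+ 2.
Proof.
move=> s0 z0; rewrite hnorm_sqr hinner_perp //.
rewrite ![hinner _ (hgrad_perp u p)]hinnerC !hinner_perp //.
by rewrite hinner_nu // [hinner (nu p) (hgrad u p)]hinnerC; ring.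
Qed.

(** Expands [|P - k w| ^ 2 >= 0] for the orthogonal part [P] of the gradient. As [w] is orthogonal
    to [nu], the full gradient may replace [P] in the pairing. The factor [k] stays free for
    completing the square. *)
Lemma hnorm_perp_ge u p w (k : R) : 0 < sqnorm_xy p -> 0 < hz p ->
  hinner (nu p) w = 0 ->
  2 * k * hinner (hgrad u p) w - k ^+ 2 * hinner w w <= hnorm (hgrad_perp u p) ^+ 2.
Proof.
move=> s0 z0 nw; rewrite hnorm_sqr.
have := hinner_perp u w s0 z0; rewrite nw mulr0 subr0.
move: (hgrad_perp u p) => P <-; have := hinner_ge0 (P - k *: w).
rewrite !(hinnerBl, hinnerZl) ![hinner _ (_ - _)]hinnerC !(hinnerBl, hinnerZl).
by rewrite [hinner w P]hinnerC; lra.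
Qed.

(** The gradient of a function of [s] and [z] lies in the plane of [radial] and [rotational], where
    the direction orthogonal to [nu] is [sin t xi - cos t J xi]; the bracket is the component along
    it, up to the factor [sqrt s]. *)
Lemma hnorm_perp_sz u p us uz : 0 < sqnorm_xy p -> 0 < hz p ->
  is_derive_sz u p us uz ->
  hnorm (hgrad_perp u p) ^+ 2 =
  sqnorm_xy p * (2 * us * sin (th p) - uz / 2 * cos (th p)) ^+ 2.
Proof.
move=> s0 z0 Du; rewrite hnorm_perp //.
set a := (2 * us) *: radial p + (uz / 2) *: rotational p.
have E w : hinner (hgrad u p) w = hinner a w := hinner_fst w (hgrad_sz Du).
rewrite !E hinnerC E !hinner_sz.
rewrite -(sqr_sqrtr (ltW s0)).
have : 0 < Num.sqrt (sqnorm_xy p) by rewrite sqrtr_gt0.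
move: (Num.sqrt (sqnorm_xy p)) => r r0; rewrite sqrtr_sqr gtr0_norm //.
by field: (sin2cos2 (th p)); rewrite gt_eqF.
Qed.

End horizontal_gradient.

(** The same triples as [heis R n], read in the measurable copy of [R]: topology lives on [heis],
    the sigma-algebra on [mheis]. *)
Notation mheis R n :=
  ('rV[measurableTypeR R]_n * 'rV[measurableTypeR R]_n * measurableTypeR R)%type.

(** * Measurability of open sets and of continuous functions *)

Section heisenberg_measurability.
Context {R : realType} {n : nat}.

Lemma measurable_hx i : measurable_fun [set: mheis R n] (hx i : mheis R n -> measurableTypeR R).
Proof.
apply: (@measurableT_comp _ _ _ _ _ _ (fun x : 'rV[measurableTypeR R]_n => x ord0 i)
  _ (fun p : mheis R n => p.1.1)); first exact: measurable_coord.
exact: (measurableT_comp measurable_fst measurable_fst).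
Qed.

Lemma measurable_hy i : measurable_fun [set: mheis R n] (hy i : mheis R n -> measurableTypeR R).
Proof.
apply: (@measurableT_comp _ _ _ _ _ _ (fun x : 'rV[measurableTypeR R]_n => x ord0 i)
  _ (fun p : mheis R n => p.1.2)); first exact: measurable_coord.
exact: (measurableT_comp measurable_snd measurable_fst).
Qed.

Lemma measurable_hz : measurable_fun [set: mheis R n] (hz : mheis R n -> measurableTypeR R).
Proof. exact: measurable_snd. Qed.

Lemma measurable_box (A B : 'I_n -> set (measurableTypeR R)) (C : set (measurableTypeR R)) :
  (forall i, measurable (A i)) -> (forall i, measurable (B i)) -> measurable C ->
  measurable [set p : mheis R n | [/\ forall i, A i (hx i p), forall i, B i (hy i p) & C (hz p)]].
Proof.
move=> mA mB mC.
have -> : [set p : mheis R n | [/\ forall i, A i (hx i p), forall i, B i (hy i p) & C (hz p)]] =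
  (\bigcap_(i in [set: 'I_n]) (setT `&` (hx i : mheis R n -> _) @^-1` A i)) `&`
  (\bigcap_(i in [set: 'I_n]) (setT `&` (hy i : mheis R n -> _) @^-1` B i)) `&`
  (setT `&` (hz : mheis R n -> _) @^-1` C).
  apply/seteqP; split=> [p [Ap Bp Cp]|p [[Ap Bp] [_ Cp]]].
    by split; [split|] => // i _; split.
  by split => // i; [have [] := Ap i|have [] := Bp i].
apply: measurableI; first apply: measurableI.
- by apply: fin_bigcap_measurable => // i _; exact: measurable_hx.
- by apply: fin_bigcap_measurable => // i _; exact: measurable_hy.
- exact: measurable_hz.
Qed.

Let cell (c : 'rV[int]_n * 'rV[int]_n * int * nat) : set (mheis R n) :=
  let I (m : int) := [set` `[m%:~R / c.2.+1%:R, (m + 1)%:~R / c.2.+1%:R[ ] : set R in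
  [set p | [/\ forall i, I (c.1.1.1 ord0 i) (hx i p),
              forall i, I (c.1.1.2 ord0 i) (hy i p) & I c.1.2 (hz p)]].

(** An open set is the union of the grid cells inside it, of which there are countably many; a mesh
    smaller than the radius of a ball around a point gives a cell containing it. *)
Lemma open_measurable_heis (U : set (heis R n)) : open U -> measurable (U : set (mheis R n)).
Proof.
move=> oU.
have -> : U = \bigcup_(c in [set c | cell c `<=` U]) cell c.
  apply/seteqP; split=> [p Up|p [c cU]]; last exact: cU.
  have /nbhs_ballP[e /= e0 eU] : nbhs p U by apply: open_nbhs_nbhs.
  pose k := Num.bound e^-1.
  have ke : k.+1%:R^-1 < e.
    rewrite invf_plt ?posrE //; have := archi_boundP (ltW (_ : 0 < e^-1)).
    rewrite invr_gt0 => /(_ e0); move/lt_trans; apply.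
    by rewrite ltr_nat.
  have K0 : 0 < k.+1%:R :> R by [].
  pose fl (x : R) := Num.floor (x * k.+1%:R).
  pose c : 'rV[int]_n * 'rV[int]_n * int * nat :=
    (\row_i fl (hx i p), \row_i fl (hy i p), fl (hz p), k).
  have fli (x : R) : [set` `[(fl x)%:~R / k.+1%:R, (fl x + 1)%:~R / k.+1%:R[ ] x.
    rewrite /= in_itv /= ler_pdivrMr // ltr_pdivlMr //.
    by have /andP[-> ->] := floor_itv (x * k.+1%:R).
  have cl (x y : R) : [set` `[(fl x)%:~R / k.+1%:R, (fl x + 1)%:~R / k.+1%:R[ ] y ->
      `|x - y| < e.
    move=> yi; apply: le_lt_trans ke.
    have := fli x; move: yi; rewrite /= !in_itv /= intrD mulrDl mul1r.
    move=> /andP[h1 h2] /andP[h3 h4]; rewrite ler_norml lerNl opprB !lerBlDr.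
    rewrite [_ + y]addrC [_ + x]addrC; apply/andP; split; apply: ltW.
      by apply: lt_le_trans h2 _; rewrite lerD2r.
    by apply: lt_le_trans h4 _; rewrite lerD2r.
  exists c; last by split => [i|i|]; rewrite /c /= ?mxE; exact: fli.
  move=> q [qx qy qz]; apply: eU; split; [split|].
  - by split=> // i j; rewrite ord1 /ball /=; apply: cl; have := qx j; rewrite /c /= mxE.
  - by split=> // i j; rewrite ord1 /ball /=; apply: cl; have := qy j; rewrite /c /= mxE.
  - exact: cl.
rewrite bigcup_mkcond; apply: countable_bigcupT_measurable => [|c].
  exact: countableP.
case: ifP => // _.
have mI (a b : R) : measurable ([set` `[a, b[ ] : set (measurableTypeR R)).
  exact: measurable_itv.
exact: measurable_box (fun i => mI _ _) (fun i => mI _ _) (mI _ _).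
Qed.

Lemma continuous_measurable_heis (f : heis R n -> R) : continuous f ->
  measurable_fun [set: mheis R n] (f : mheis R n -> R).
Proof.
move=> /continuousP cf; apply: (measurability _ (RGenOpens.measurableE R)).
move=> _ [_ [a [b ->] <-]]; rewrite setTI.
by apply: open_measurable_heis; apply: cf; exact: interval_open.
Qed.

End heisenberg_measurability.

(** * Translation invariance of Lebesgue measure *)

Section translation_invariance.
Context {R : realType}.
Local Open Scope ereal_scope.

Lemma lebesgue_measure_translation (a : R) (A : set (measurableTypeR R)) :
  measurable A ->
  lebesgue_measure ((fun x : measurableTypeR R => (x + a)%R) @^-1` A) = lebesgue_measure A.
Proof.
move=> mA.
rewrite -[LHS]/(pushforward lebesgue_measure
  (fun x : measurableTypeR R => (x + a)%R : measurableTypeR R) A).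
have mt : measurable_fun setT (fun x : measurableTypeR R => (x + a)%R : measurableTypeR R).
  exact: measurable_funD.
apply/esym/lebesgue_measure_unique => //= _ [[b c]] _ <-.
rewrite /pushforward.
have -> : (fun x : measurableTypeR R => (x + a)%R) @^-1` `]b, c] = `](b - a)%R, (c - a)%R]%classic.
  by apply/seteqP; split=> x /=; rewrite !in_itv /= ltrBlDr lerBrDr.
rewrite !lebesgue_measure_itv /= !lte_fin ltrD2r.
by case: ifP => // _; rewrite -!EFinB; congr (_%:E); ring.
Qed.

(** Sections treat one factor at a time: invariance of [m2] identifies the measure of the section of
    the preimage at [x] with that of the section of [A] at [t1 x], and a change of variables along
    [t1] concludes by invariance of [m1]. *)
Lemma product_measure_invariant d1 d2 (T1 : measurableType d1) (T2 : measurableType d2)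
    (m1 : {measure set T1 -> \bar R}) (m2 : {sigma_finite_measure set T2 -> \bar R})
    (t1 : T1 -> T1) (t2 : T2 -> T2) :
  measurable_fun setT t1 -> measurable_fun setT t2 ->
  (forall A, measurable A -> m1 (t1 @^-1` A) = m1 A) ->
  (forall A, measurable A -> m2 (t2 @^-1` A) = m2 A) ->
  forall A, measurable A ->
  (m1 \x m2) ((fun p => (t1 p.1, t2 p.2)) @^-1` A) = (m1 \x m2) A.
Proof.
move=> mt1 mt2 inv1 inv2 A mA; rewrite /product_measure1.
have -> : (m2 \o xsection ((fun p => (t1 p.1, t2 p.2)) @^-1` A)) =
    (m2 \o xsection A) \o t1.
  apply/funext => x /=; rewrite -[RHS]inv2; last exact: measurable_xsection.
  by congr (m2 _); apply/seteqP; split=> y; rewrite /xsection /= !inE.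
rewrite -[X in \int[m1]_(x in X) _](preimage_setT t1).
rewrite -(ge0_integral_pushforward mt1) //.
- apply: (@eq_measure_integral _ _ _ _ m1) => B mB _; exact: inv1.
- by apply: measurable_fun_xsection.
Qed.

Lemma lebesgue_rV_translation n (v : 'rV[R]_n) (A : set 'rV[measurableTypeR R]_n) :
  measurable A ->
  lebesgue_rV R n ((fun x : 'rV[measurableTypeR R]_n => (x + v)%R) @^-1` A) = lebesgue_rV R n A.
Proof.
elim: n v A => [|n IH] v A mA.
  congr (lebesgue_rV R 0 _); apply/seteqP; split=> x /=;
    by rewrite (_ : (x + v)%R = x) //; apply/rowP => -[].
rewrite /= /lebesgue_rV_succ /pushforward.
pose tv (x : 'rV[measurableTypeR R]_n) : 'rV[measurableTypeR R]_n :=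
  (x + \row_(j < n) v ord0 (lift ord0 j))%R.
have mtv : measurable_fun setT tv.
  apply: measurable_fun_rV => i; rewrite (_ : (fun _ => _) =
    (fun x : 'rV[measurableTypeR R]_n => (x ord0 i + v ord0 (lift ord0 i))%R)).
    by apply: measurable_funD => //; exact: measurable_coord.
  by apply/funext => x; rewrite /tv !mxE.
have mt : measurable_fun setT (fun x : measurableTypeR R => (x + v ord0 ord0)%R : measurableTypeR R).
  exact: measurable_funD.
have mB : measurable (@rV_cons R n @^-1` A).
  by rewrite -[X in measurable X]setTI; exact: measurable_rV_cons.
rewrite -(product_measure_invariant mt mtv _ _ mB).
- congr ((_ \x _) _); apply/seteqP; split=> -[a x] /=.
    congr A; apply/rowP => i; rewrite !mxE.
    by case: (unliftP ord0 i) => [j ->|->] /=; rewrite ?liftK ?unlift_none /= ?mxE.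
  congr A; apply/rowP => i; rewrite !mxE.
  by case: (unliftP ord0 i) => [j ->|->] /=; rewrite ?liftK ?unlift_none /= ?mxE.
- by move=> B mB'; exact: lebesgue_measure_translation.
- by move=> B mB'; exact: IH.
Qed.

Lemma measurable_rV_translation n (w : 'rV[R]_n) : measurable_fun setT
  (fun x : 'rV[measurableTypeR R]_n => (x + w)%R : 'rV[measurableTypeR R]_n).
Proof.
apply: measurable_fun_rV => i; rewrite (_ : (fun _ => _) =
  (fun x : 'rV[measurableTypeR R]_n => (x ord0 i + w ord0 i)%R)).
  by apply: measurable_funD => //; exact: measurable_coord.
by apply/funext => x; rewrite !mxE.
Qed.

Lemma lebesgue_heis_translation n (v : heis R n) (A : set (mheis R n)) :
  measurable A ->
  @lebesgue_heis R n ((fun p : mheis R n => (p + v)%R) @^-1` A) = @lebesgue_heis R n A.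
Proof.
have mR : measurable_fun setT (fun x : measurableTypeR R => (x + v.2)%R : measurableTypeR R).
  exact: measurable_funD.
pose t1 (q : 'rV[measurableTypeR R]_n * 'rV[measurableTypeR R]_n) :
  'rV[measurableTypeR R]_n * 'rV[measurableTypeR R]_n := (q.1 + v.1.1, q.2 + v.1.2)%R.
have mt1 : measurable_fun setT t1.
  apply: measurable_fun_pair.
    exact: (measurableT_comp (measurable_rV_translation v.1.1) measurable_fst).
  exact: (measurableT_comp (measurable_rV_translation v.1.2) measurable_snd).
apply: (@product_measure_invariant _ _ _ _ (lebesgue_rV R n \x lebesgue_rV R n)
   lebesgue_measure t1 _ mt1 mR).
- apply: (product_measure_invariant (measurable_rV_translation v.1.1) (measurable_rV_translation v.1.2)) => B mB;
    exact: lebesgue_rV_translation.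
- by move=> B mB; exact: lebesgue_measure_translation.
Qed.

Lemma measurable_translation n (v : heis R n) :
  measurable_fun setT (fun p : mheis R n => (p + v)%R : mheis R n).
Proof.
apply: measurable_fun_pair; last first.
  apply: (measurableT_comp _ measurable_snd (f := fun x : measurableTypeR R => (x + v.2)%R : measurableTypeR R)).
  exact: measurable_funD.
apply: measurable_fun_pair.
  exact: (measurableT_comp (measurable_rV_translation v.1.1) (measurableT_comp measurable_fst measurable_fst)).
exact: (measurableT_comp (measurable_rV_translation v.1.2) (measurableT_comp measurable_snd measurable_fst)).
Qed.

End translation_invariance.

(** * Boxes, cubes and integrable functions *)

Section heisenberg_integration.
Context {R : realType} {n : nat}.
Local Notation mu := (@lebesgue_heis R n).

Lemma lebesgue_heis_box (A B : 'I_n -> set (measurableTypeR R)) (C : set (measurableTypeR R)) :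
  (forall i, measurable (A i)) -> (forall i, measurable (B i)) -> measurable C ->
  mu [set p : mheis R n | [/\ forall i, A i (hx i p), forall i, B i (hy i p) & C (hz p)]] =
  ((\prod_(i < n) lebesgue_measure (A i)) * (\prod_(i < n) lebesgue_measure (B i)) *
    lebesgue_measure C)%E.
Proof.
move=> mA mB mC.
pose A' := [set x : 'rV[measurableTypeR R]_n | forall i, A i (x ord0 i)].
pose B' := [set x : 'rV[measurableTypeR R]_n | forall i, B i (x ord0 i)].
have mrV (D : 'I_n -> set (measurableTypeR R)) : (forall i, measurable (D i)) ->
    measurable [set x : 'rV[measurableTypeR R]_n | forall i, D i (x ord0 i)].
  move=> mD; rewrite (_ : [set _ | _] = \bigcap_(i in [set: 'I_n])
      (setT `&` (fun y : 'rV[measurableTypeR R]_n => y ord0 i) @^-1` D i)).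
    by apply: fin_bigcap_measurable => // i _; exact: measurable_coord.
  by apply/seteqP; split => [y Dy i _|y Dy i]; [split => //; exact: Dy|have [] := Dy i].
rewrite -!lebesgue_rV_box //.
rewrite -product_measure1E //; [|exact: mrV|exact: mrV].
rewrite -product_measure1E //; last by apply: measurableX; exact: mrV.
congr (mu _); apply/seteqP; split => p; first by move=> [].
by move=> [[]].
Qed.

Definition cube (M : R) : set (heis R n) :=
  [set p | [/\ forall i, `[(- M), M]%classic (hx i p),
    forall i, `[(- M), M]%classic (hy i p) & `[(- M), M]%classic (hz p)]].

Lemma measurable_cube M : measurable (cube M : set (mheis R n)).
Proof.
have mI : measurable (`[(- M), M]%classic : set (measurableTypeR R)) by exact: measurable_itv.
exact: (measurable_box (fun=> mI) (fun=> mI) mI).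
Qed.

Lemma cube_measure_lty M : (mu (cube M) < +oo)%E.
Proof.
have mI : measurable (`[(- M), M]%classic : set (measurableTypeR R)) by exact: measurable_itv.
have fI : lebesgue_measure (`[(- M), M]%classic : set (measurableTypeR R)) \is a fin_num.
  by rewrite lebesgue_measure_itv /=; case: ifP.
rewrite ltey_eq; apply/orP; left.
have -> := lebesgue_heis_box (fun=> mI) (fun=> mI) mI : mu (cube M) = _.
have fp : (\prod_(i < n) lebesgue_measure (`[(- M)%R, M]%classic : set (measurableTypeR R)))%E
    \is a fin_num.
  by elim/big_ind: _ => // x y; exact: fin_numM.
by rewrite !fin_numM.
Qed.

Lemma cube_compact M : compact (cube M).
Proof.
have cI : compact (`[(- M), M]%classic : set R) by exact: segment_compact.
rewrite (_ : cube M = ([set x : 'rV[R]_n | forall i, `[(- M), M]%classic (x ord0 i)] `*`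
   [set x : 'rV[R]_n | forall i, `[(- M), M]%classic (x ord0 i)]) `*` `[(- M), M]%classic).
  have cr := @rV_compact _ n _ (fun=> cI).
  exact: (compact_setX (compact_setX cr cr) cI).
by apply/seteqP; split=> p; [case|case=> -[]].
Qed.

Lemma cubeP M p : `|p| <= M -> cube M p.
Proof.
move=> pM; split=> [i|i|]; rewrite /= in_itv /= -ler_norml.
- exact: le_trans (hx_norm _ _) pM.
- exact: le_trans (hy_norm _ _) pM.
- exact: le_trans (hz_norm _) pM.
Qed.

Lemma cube_norm M p : cube M p -> `|p| <= Num.max 0 M.
Proof.
move=> [px py pz]; rewrite prod_normE ge_max prod_normE ge_max.
have rn (x : 'rV[R]_n) : (forall i, `[(- M), M]%classic (x ord0 i)) -> `|x| <= Num.max 0 M.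
  move=> xM; rewrite [leLHS]/Num.Def.normr /= mx_normrE.
  apply/bigmax_leP; split; first by rewrite le_max lexx.
  move=> [i j] _ /=; rewrite (ord1 i) le_max; apply/orP; right.
  by have := xM j; rewrite /= in_itv /= -ler_norml.
rewrite (rn _ px) (rn _ py) /=.
by rewrite le_max; apply/orP; right; move: pz; rewrite /= in_itv /= -ler_norml.
Qed.

Definition bounded_support (f : heis R n -> R) :=
  exists M, forall p, f p != 0 -> `|p| <= M.

Lemma continuous_bounded_support_bounded (f : heis R n -> R) :
  continuous f -> bounded_support f -> exists C, forall p, `|f p| <= C.
Proof.
move=> fc [M fM].
have : compact (f @` cube M).
  by apply: continuous_compact; [exact: continuous_subspaceT|exact: cube_compact].
move=> /compact_bounded [N [_ NP]]; exists (Num.max 0 (N + 1)) => p.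
have [->|fp] := eqVneq (f p) 0; first by rewrite normr0 le_max lexx.
rewrite le_max; apply/orP; right; apply: (NP (N + 1)); first by rewrite ltrDl.
by exists p => //; apply: cubeP; exact: fM.
Qed.

Lemma bounded_support_integrable (f : heis R n -> R) (M C : R) :
  measurable_fun [set: mheis R n] (f : mheis R n -> R) ->
  (forall p, f p != 0 -> `|p| <= M) -> (forall p, `|f p| <= C) ->
  mu.-integrable setT (EFin \o f).
Proof.
move=> mf fM fC.
have mcube := measurable_cube M.
apply: (@le_integrable _ _ _ mu setT measurableT (EFin \o f)
  (EFin \o (fun p => C * \1_(cube M) p))).
- exact/measurable_EFinP.
- move=> p _ /=; rewrite lee_fin normrM.
  have [->|fp] := eqVneq (f p) 0; first by rewrite normr0 mulr_ge0.
  rewrite indicE mem_set ?normr1 ?mulr1; last by apply: cubeP; exact: fM.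
  by apply: le_trans (fC p) _; exact: ler_norm.
- rewrite (_ : _ \o _ = (fun p => C%:E * (\1_(cube M) p)%:E)%E) //.
  apply: integrableZl => //; apply/integrableP; split.
    by apply/measurable_EFinP; exact: measurable_indic.
  under eq_integral => p _ do rewrite /= ger0_norm //.
  by rewrite integral_indic // setIT; exact: cube_measure_lty.
Qed.

Lemma continuous_bounded_support_integrable (f : heis R n -> R) :
  continuous f -> bounded_support f -> mu.-integrable setT (EFin \o f).
Proof.
move=> fc fs; have [C fC] := continuous_bounded_support_bounded fc fs.
case: fs => M fM; apply: bounded_support_integrable fM fC.
exact: continuous_measurable_heis.
Qed.

Lemma integral_translation (f : heis R n -> R) (v : heis R n) :
  mu.-integrable setT (EFin \o f) -> continuous f ->
  mu.-integrable setT (EFin \o (fun p => f (p + v))) ->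
  (\int[mu]_p (f (p + v))%:E = \int[mu]_p (f p)%:E)%E.
Proof.
move=> intf fc intfv.
have mt := measurable_translation v.
have mf : measurable_fun [set: mheis R n] (EFin \o f : mheis R n -> \bar R).
  by apply/measurable_EFinP; exact: continuous_measurable_heis.
have := @integral_pushforward _ _ _ _ R _ mt mu setT _ mf.
rewrite preimage_setT => /(_ intfv measurableT) <-.
by apply: (@eq_measure_integral _ _ _ _ mu) => A mA _; exact: lebesgue_heis_translation.
Qed.

End heisenberg_integration.

(** * The integral of a directional derivative vanishes *)

Section integration_by_parts.
Context {R : realType} {n : nat}.
Local Notation mu := (@lebesgue_heis R n).

Lemma is_derive_along (g d : heis R n -> R) (v p : heis R n) (h : R) :
  (forall q, is_derive q v g (d q)) ->
  is_derive h (1 : R) (fun t => g (t *: v + p)) (d (h *: v + p)).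
Proof.
move=> gd; have /is_derive_line D0 := gd (h *: v + p).
have Dh : is_derive h (1 : R) (fun t : R => t - h) 1 by der; rewrite subr0.
have D1 : is_derive (h - h) (1 : R) (fun h0 : R => g (h0 *: v + (h *: v + p))) (d (h *: v + p)).
  by rewrite subrr.
have := @is_derive_compL _ _ _ (fun t : R => t - h) _ _ _ _ D1 Dh; rewrite mulr1.
by under eq_fun do rewrite addrA -scalerDl subrK.
Qed.

Lemma bounded_support_derive (g d : heis R n -> R) (v : heis R n) (M : R) :
  (forall q, is_derive q v g (d q)) -> (forall p, g p != 0 -> `|p| <= M) ->
  forall p, d p != 0 -> `|p| <= M.
Proof.
move=> gd gM p; apply: contraNT; rewrite -ltNge => pM.
have near0 : \forall q \near p, cst 0 q = g q.
  have nc : {for p, continuous (fun q : heis R n => `|q| - M)}.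
    by apply: cvgB; [exact: norm_continuous|exact: cvg_cst].
  have := near_gt0 nc; rewrite subr_gt0 => /(_ pM).
  apply: filterS => q; rewrite subr_gt0 => qM; apply/esym/eqP.
  by apply: contraTT qM => /gM; rewrite leNgt.
have D := is_derive_near near0 (is_derive_cst 0 p v).
by rewrite -(@derive_val _ _ _ _ _ _ _ (gd p)) (@derive_val _ _ _ _ _ _ _ D).
Qed.

(** The derivative is the limit of [(k + 1) (g (p + v / (k + 1)) - g p)]. Each of these integrates
    to [0] by translation invariance; the mean value theorem bounds them uniformly and they live on
    a common cube, so dominated convergence applies. *)
Lemma integral_derive0 (g d : heis R n -> R) (v : heis R n) :
  continuous g -> continuous d -> (forall q, is_derive q v g (d q)) ->
  bounded_support g -> (\int[mu]_p (d p)%:E = 0)%E.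
Proof.
move=> gc dc gd gs; have [M gM] := gs.
have dM := bounded_support_derive gd gM.
have [C dC] : exists C, forall p, `|d p| <= C.
  by apply: continuous_bounded_support_bounded => //; exists M.
have C0 : 0 <= C by exact: le_trans (dC 0).
have md : measurable_fun [set: mheis R n] (d : mheis R n -> R).
  exact: continuous_measurable_heis.
have intg := continuous_bounded_support_integrable gc gs.
pose sh k p : R := g (p + k.+1%:R^-1 *: v).
have shc k : continuous (sh k).
  move=> p; have H : {for p, continuous (fun p : heis R n => p + k.+1%:R^-1 *: v)}.
    by apply: cvgD; [exact: cvg_id|exact: cvg_cst].
  exact: (continuous_comp H (gc _)).
(* One radius serves all the shifts, since [1 / (k + 1) <= 1]. *)
have Mv k (p : heis R n) : `|p + k.+1%:R^-1 *: v| <= M -> `|p| <= M + `|v|.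
  move=> H; have := ler_normB (p + k.+1%:R^-1 *: v) (k.+1%:R^-1 *: v).
  rewrite addrK normrZ ger0_norm // => /le_trans; apply; apply: lerD => //.
  by rewrite ler_piMl // invf_le1 // ler1n.
have shs k : bounded_support (sh k).
  by exists (M + `|v|) => p /gM; exact: Mv.
have intsh k := continuous_bounded_support_integrable (shc k) (shs k).
pose f k p : R := k.+1%:R * (sh k p - g p).
have intf0 k : (\int[mu]_p (f k p)%:E = 0)%E.
  have -> : (\int[mu]_p (f k p)%:E = (k.+1%:R)%:E * \int[mu]_p ((sh k p)%:E - (g p)%:E))%E.
    rewrite -(integralZl measurableT (integrableB measurableT (intsh k) intg)).
    by apply: eq_integral => p _; rewrite /f EFinM EFinB.
  have E : (\int[mu]_p (sh k p)%:E = \int[mu]_p (g p)%:E)%E.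
    exact: (integral_translation intg gc (intsh k)).
  rewrite (integralB measurableT (intsh k) intg) /= E subee ?mule0 //.
  exact: (integrable_fin_num measurableT intg).
have fk k p : `|f k p| <= C * \1_(cube (M + `|v|)) p.
  have [fp|fp] := eqVneq (f k p) 0; first by rewrite fp normr0 mulr_ge0.
  rewrite indicE mem_set; last first.
    apply: cubeP; have [/eqP sh0|shn] := boolP (sh k p == 0); last by apply: Mv; exact: gM shn.
    have gp : g p != 0 by apply: contraNneq fp => gp0; rewrite /f sh0 gp0 subrr mulr0.
    by apply: le_trans (gM _ gp) _; rewrite lerDl.
  rewrite mulr1 /f normrM ger0_norm // mulrC -ler_pdivlMr // .
  have k0 : 0 < k.+1%:R^-1 :> R by rewrite invr_gt0.
  have [c _] := @mvt R _ _ 0 k.+1%:R^-1 k0 (fun t _ => is_derive_along p t gd).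
  rewrite scale0r add0r subr0 {1}[_ *: v + p]addrC -/(sh k p) => ->.
  by rewrite normrM [X in _ * X]gtr0_norm // ler_wpM2r // ltW.
have cv p : (fun k => (f k p)%:E) @ \oo --> (d p)%:E.
  apply: cvg_EFin; first exact: nearW.
  have [dg Dg] := gd p.
  have c0 : (fun h : R => h^-1 *: (g (h *: v + p) - g p)) @ 0^' --> d p by rewrite -Dg.
  have inv0 : (fun k : nat => k.+1%:R^-1 : R) @ \oo --> 0^'.
    move=> A /(@cvg_harmonic R) [N _ NA]; exists N => // k /NA; apply.
    by rewrite /= invr_eq0 pnatr_eq0.
  have := cvg_comp _ _ inv0 c0; apply: cvg_trans; apply: near_eq_cvg.
  by apply: nearW => k /=; rewrite invrK [_ *: v + p]addrC.
have mf k : measurable_fun [set: mheis R n] ((fun p => (f k p)%:E) : mheis R n -> \bar R).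
  apply/measurable_EFinP; apply: continuous_measurable_heis => p.
  by apply: cvgM; [exact: cvg_cst|apply: cvgB; [exact: shc|exact: gc]].
have mcube := @measurable_cube R n (M + `|v|).
have intC : mu.-integrable setT (fun p : mheis R n => (C * \1_(cube (M + `|v|)) p)%:E).
  apply: (@bounded_support_integrable _ _ (fun p => C * \1_(cube (M + `|v|)) p)
    (Num.max 0 (M + `|v|)) C).
  - by apply: measurable_funM => //; exact: measurable_indic.
  - move=> p; rewrite mulf_eq0 negb_or => /andP[_]; rewrite indicE.
    case: (boolP (p \in _)) => [|_]; last by rewrite eqxx.
    by rewrite inE => /cube_norm.
  - move=> p; rewrite normrM (ger0_norm C0) ler_piMr // indicE.
    by case: (_ \in _); rewrite ?normr1 ?normr0.
have md' : measurable_fun [set: mheis R n] ((fun p => (d p)%:E) : mheis R n -> \bar R).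
  exact/measurable_EFinP.
have ae1 : {ae mu, forall p : mheis R n, [set: mheis R n] p ->
    (fun k => (f k p)%:E) @ \oo --> (d p)%:E}.
  by apply: aeW => p _; exact: cv.
have ae2 : {ae mu, forall p : mheis R n, forall k, [set: mheis R n] p ->
    (`|(f k p)%:E| <= (C * \1_(cube (M + `|v|)) p)%:E)%E}.
  by apply: aeW => p k _; rewrite lee_fin.
have [_ _] := dominated_convergence measurableT mf md' ae1 intC ae2.
rewrite (_ : [sequence _]_k = fun=> 0%E); last by apply/funext => k; exact: intf0.
by move/cvg_lim => <- //; rewrite lim_cst.
Qed.

End integration_by_parts.

(** * Smooth cutoffs *)

Section bump.
Context {R : realType}.

(** The powers of [1 / t] in front of [exp (- 1 / t)] make the family closed under differentiation
    up to linear combinations, as [is_derive_bumpe] shows; [bumpe 0] is the cutoff itself. *)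
Definition bumpe (k : nat) (t : R) : R :=
  if 0 < t then t^-1 ^+ k * expR (- t^-1) else 0.

Lemma expR_ge_pow (m : nat) (x : R) : 0 <= x -> (x / m.+1%:R) ^+ m.+1 <= expR x.
Proof.
move=> x0; have m0 : 0 < m.+1%:R :> R by [].
have -> : expR x = expR (x / m.+1%:R) ^+ m.+1.
  by rewrite -expRM_natl; congr expR; field; rewrite gt_eqF.
apply: lerXn2r; rewrite ?nnegrE ?divr_ge0 ?expR_ge0 //.
by apply: le_trans (expR_ge1Dx _); rewrite lerDr.
Qed.

Lemma bumpe_ge0 k t : 0 <= bumpe k t.
Proof.
rewrite /bumpe; case: ifP => // t0.
by rewrite mulr_ge0 ?expR_ge0 // exprn_ge0 // invr_ge0 ltW.
Qed.

Lemma bumpe_le0 k t : t <= 0 -> bumpe k t = 0.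
Proof. by rewrite /bumpe leNgt => /negbTE ->. Qed.

Lemma bumpe_gt0 k t : 0 < t -> 0 < bumpe k t.
Proof.
by move=> t0; rewrite /bumpe t0 mulr_gt0 ?expR_gt0 // exprn_gt0 // invr_gt0.
Qed.

(* [e^{-x} <= (m / x)^m] with [m = k + j + 1] and [x = 1 / t]. *)
Lemma bumpe_le_pow k j t : bumpe k t <= (k + j).+1%:R ^+ (k + j).+1 * `|t| ^+ j.+1.
Proof.
have [t0|t0] := leP t 0; first by rewrite bumpe_le0 // mulr_ge0 // exprn_ge0.
rewrite /bumpe t0 gtr0_norm //; set m := (k + j)%N.
have := @expR_ge_pow m t^-1; rewrite invr_ge0 => /(_ (ltW t0)).
have m0 : 0 < m.+1%:R ^+ m.+1 :> R by rewrite exprn_gt0.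
rewrite expr_div_n ler_pdivrMr // => H.
have -> : t^-1 ^+ k = t^-1 ^+ m.+1 * t ^+ j.+1.
  rewrite /m -addnS exprD -mulrA -exprMn mulVf ?gt_eqF //.
  by rewrite expr1n mulr1.
rewrite expRN mulrAC; apply: ler_wpM2r; first by rewrite exprn_ge0 // ltW.
by rewrite ler_pdivrMr ?expR_gt0 // mulrC.
Qed.

(** At [0] the flatness bound [bumpe_le_pow] with [j = 1] gives a difference quotient of size at
    most [C |h|]. *)
Lemma is_derive_bumpe k t :
  is_derive t (1 : R) (bumpe k) (bumpe k.+2 t - k%:R * bumpe k.+1 t).
Proof.
have [t0|t0|->] := ltgtP t 0.
- rewrite !bumpe_le0 ?ltW // mulr0 subr0.
  apply: (is_derive_near _ (is_derive_cst (0 : R) t 1)).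
  by near=> x; rewrite bumpe_le0 //; near: x; exact: lt_le_nbhsl.
- have tn : t != 0 by rewrite gt_eqF.
  have D : is_derive t (1 : R) (fun t : R => t^-1 ^+ k * expR (- t^-1))
      (bumpe k.+2 t - k%:R * bumpe k.+1 t).
    der => //; rewrite /bumpe t0; case: k => [|k] /=; first by field.
    by rewrite !exprS; field.
  apply: is_derive_near D.
  by near=> x; rewrite /bumpe ifT //; near: x; exact: lt_nbhsr.
- rewrite !bumpe_le0 // mulr0 subr0.
  have cv : (fun h : R => h^-1 *: (bumpe k (h *: 1 + 0) - bumpe k 0)) @ 0^' --> (0 : R).
    apply/cvgrPdist_le => e e0; have [C C0 bC] : exists2 C : R, 0 < C &
        forall t, bumpe k t <= C * `|t| ^+ 2.
      by exists ((k + 1).+1%:R ^+ (k + 1).+1); [rewrite exprn_gt0|move=> t'; exact: bumpe_le_pow].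
    rewrite near_withinE; apply/nbhs_ballP; exists (e / C); first exact: divr_gt0.
    move=> h; rewrite /ball /= sub0r normrN => he h0.
    rewrite addr0 [h *: 1]mulr1 (bumpe_le0 k (lexx 0)) subr0 sub0r normrN.
    rewrite /GRing.scale /= normrM normfV ler_pdivrMl ?normr_gt0 //.
    rewrite ger0_norm ?bumpe_ge0 //; apply: le_trans (bC h) _.
    move: he; rewrite ltr_pdivlMr // => he.
    by have := normr_ge0 h; nra.
  split; first by apply/cvg_ex; exists 0.
  by apply/cvg_lim.
Unshelve. all: by end_near. Qed.

Lemma bumpe_continuous k : continuous (bumpe k).
Proof. by move=> t; exact: is_derive_continuous (is_derive_bumpe k t). Qed.

Lemma bumpe0_le1 t : bumpe 0 t <= 1.
Proof.
rewrite /bumpe; case: ifP => // t0; rewrite expr0 mul1r -expR0 ler_expR.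
by rewrite oppr_le0 invr_ge0 ltW.
Qed.

(** With [x = 1 / t] this is [x ^ 2 <= 4 exp x], a consequence of [(x / 2) ^ 2 <= exp x]. *)
Lemma bumpe2_le t : bumpe 2 t <= 4.
Proof.
rewrite /bumpe; case: ifP => // t0; have := @expR_ge_pow 1 t^-1.
rewrite invr_ge0 => /(_ (ltW t0)); rewrite expr_div_n ler_pdivrMr // -natrX => H.
by rewrite expRN ler_pdivrMr ?expR_gt0 // mulrC.
Qed.

Lemma is_derive_bumpe0 t : is_derive t (1 : R) (bumpe 0) (bumpe 2 t).
Proof. by have := is_derive_bumpe 0 t; rewrite mul0r subr0. Qed.

Lemma bumpe0_nondecreasing t t' : t <= t' -> bumpe 0 t <= bumpe 0 t'.
Proof.
rewrite le_eqVlt => /predU1P[->//|tt'].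
have [c _ E] := mvt tt' (fun x _ => is_derive_bumpe0 x).
by rewrite -subr_ge0 E mulr_ge0 ?bumpe_ge0 // subr_ge0 ltW.
Qed.

(* Removes the center, where [fieldA] is singular; being nondecreasing in [s], it
   contributes a term of the favourable sign to the divergence identity. *)
Definition cutoff (N : nat) (s : R) : R := bumpe 0 (N%:R * s - 1).

Lemma cutoff_cvg s : 0 < s -> cutoff N s @[N --> \oo] --> (1 : R).
Proof.
move=> s0; apply/cvgrPdist_le => e e0.
have H : exists2 N0 : nat, True & forall N, (N0 <= N)%N -> 1 + e^-1 <= N%:R * s.
  exists (Num.bound ((1 + e^-1) / s)) => // N N0N.
  have p0 : 0 <= (1 + e^-1) / s by rewrite divr_ge0 ?ltW // addr_gt0 // invr_gt0.
  rewrite -ler_pdivrMr //; apply: le_trans (ltW (archi_boundP p0)) _.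
  by rewrite ler_nat.
case: H => N0 _ HN; exists N0 => // N /= /HN Ns.
have t0 : e^-1 <= N%:R * s - 1 by lra.
have e1 : 0 < e^-1 by rewrite invr_gt0.
have tp : 0 < N%:R * s - 1 by exact: lt_le_trans t0.
rewrite /cutoff ger0_norm ?subr_ge0 ?bumpe0_le1 // /bumpe tp expr0 mul1r.
have := @expR_ge1Dx R (- (N%:R * s - 1)^-1).
have : (N%:R * s - 1)^-1 <= e by rewrite invf_ple ?posrE.
by lra.
Qed.

Lemma cutoff_nondecreasing s : 0 <= s -> {homo cutoff ^~ s : m k / (m <= k)%N >-> m <= k}.
Proof.
by move=> s0 m k mk; apply: bumpe0_nondecreasing; rewrite lerD2r ler_wpM2r // ler_nat.
Qed.

End bump.

(** * Continuous differentiability along one direction *)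

Section continuously_differentiable.
Context {R : realType} {V : normedModType R}.
Implicit Types (F G : V -> R) (p v : V).

(** One direction suffices because the divergence is integrated one coordinate at a time. The
    condition is local, so that fields singular on the center or for [z <= 0] can be handled where
    they are regular. *)
Definition C1d v F p : Prop := {for p, continuous F} /\
  exists d : V -> R, (\forall q \near p, is_derive q v F (d q)) /\ {for p, continuous d}.

Lemma C1d_near v F G p : (\forall q \near p, F q = G q) -> C1d v F p -> C1d v G p.
Proof.
move=> FG [Fc [d [Fd dc]]]; split.
  have FGp : F p = G p by exact: nbhs_singleton FG.
  suff : G @ p --> G p by []; rewrite -FGp; apply: cvg_trans Fc.
  by apply: near_eq_cvg; apply: filterS FG => q ->.
exists d; split=> //.
have FG' : \forall q \near p, \forall r \near q, F r = G r by exact: nbhs_interior FG.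
near=> q; apply: (@is_derive_near _ _ F); last by near: q.
by near: q.
Unshelve. all: by end_near. Qed.

Lemma C1d_cst v (c : R) p : C1d v (fun _ => c) p.
Proof.
split; first exact: cvg_cst.
by exists (fun=> 0); split; [apply: nearW => q; exact: is_derive_cstL|exact: cvg_cst].
Qed.

Lemma C1dD v F G p : C1d v F p -> C1d v G p -> C1d v (fun q => F q + G q) p.
Proof.
move=> [Fc [d [Fd dc]]] [Gc [e [Ge ec]]]; split; first exact: cvgD.
exists (fun q => d q + e q); split; last exact: cvgD.
by near=> q; apply: is_deriveDL; near: q.
Unshelve. all: by end_near. Qed.

Lemma C1dN v F p : C1d v F p -> C1d v (fun q => - F q) p.
Proof.
move=> [Fc [d [Fd dc]]]; split; first exact: cvgN.
exists (fun q => - d q); split; last exact: cvgN.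
by near=> q; apply: is_deriveNL; near: q.
Unshelve. all: by end_near. Qed.

Lemma C1dM v F G p : C1d v F p -> C1d v G p -> C1d v (fun q => F q * G q) p.
Proof.
move=> [Fc [d [Fd dc]]] [Gc [e [Ge ec]]]; split; first exact: cvgM.
exists (fun q => d q * G q + F q * e q); split.
  by near=> q; apply: is_deriveML; near: q.
by apply: cvgD; exact: cvgM.
Unshelve. all: by end_near. Qed.

Lemma C1dX v F k p : C1d v F p -> C1d v (fun q => F q ^+ k) p.
Proof.
move=> FC; elim: k => [|k IH]; first exact: C1d_cst.
by under eq_fun do rewrite exprS; exact: C1dM.
Qed.

Lemma C1d_comp v (h h' : R -> R) F p :
  (\forall t \near F p, is_derive t (1 : R) h (h' t)) -> {for F p, continuous h'} ->
  C1d v F p -> C1d v (fun q => h (F q)) p.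
Proof.
move=> hD hc [Fc [d [Fd dc]]].
have hc0 : {for F p, continuous h}.
  exact: is_derive_continuous (nbhs_singleton hD).
split; first exact: (continuous_comp Fc hc0).
exists (fun q => h' (F q) * d q); split; last first.
  by apply: cvgM => //; exact: (continuous_comp Fc hc).
have hDF : \forall q \near p, is_derive (F q) (1 : R) h (h' (F q)) by exact: Fc hD.
by near=> q; apply: is_derive_compL; near: q.
Unshelve. all: by end_near. Qed.

Lemma C1dV v F p : F p != 0 -> C1d v F p -> C1d v (fun q => (F q)^-1) p.
Proof.
move=> Fp0 [Fc [d [Fd dc]]]; split; first exact: cvgV.
exists (fun q => - F q ^- 2 * d q); split; last first.
  apply: cvgM => //; apply: cvgN; apply: cvgV; first by rewrite expf_neq0.
  by under eq_fun do rewrite expr2; rewrite expr2; exact: cvgM.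
have Fn : \forall q \near p, F q != 0 by exact: (cvgr_neq0 _ Fc).
by near=> q; apply: is_deriveVL; near: q.
Unshelve. all: by end_near. Qed.

Lemma C1d_derive v F : (forall p, C1d v F p) ->
  [/\ continuous F, continuous ('D_v F) & forall p, is_derive p v F ('D_v F p)].
Proof.
move=> FC; split => [p|p|p]; first by have [] := FC p.
  have [_ [d [Fd dc]]] := FC p.
  have E : \forall q \near p, d q = 'D_v F q.
    by apply: filterS Fd => q Fq; rewrite (@derive_val _ _ _ _ _ _ _ Fq).
  suff : 'D_v F @ p --> 'D_v F p by []; rewrite -(nbhs_singleton E); apply: cvg_trans dc.
  by apply: near_eq_cvg; apply: filterS E => q ->.
have [_ [d [Fd dc]]] := FC p; have := nbhs_singleton Fd.
by move=> [dF _]; split.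
Qed.

End continuously_differentiable.

(** * Regularity and derivatives of the coefficients of the field *)

Section hardy_fields.
Context {R : realType} {n : nat}.
Implicit Types (p v : heis R n).

Lemma C1d_hx v i p : C1d v (hx i) p.
Proof.
split; first exact: hx_continuous.
exists (fun=> hx i v); split; last exact: cvg_cst.
by near=> q; exact: (is_derive_hx i (is_derive_id q v)).
Unshelve. all: by end_near. Qed.

Lemma C1d_hy v i p : C1d v (hy i) p.
Proof.
split; first exact: hy_continuous.
exists (fun=> hy i v); split; last exact: cvg_cst.
by near=> q; exact: (is_derive_hy i (is_derive_id q v)).
Unshelve. all: by end_near. Qed.

Lemma C1d_hz v p : C1d v hz p.
Proof.
split; first exact: hz_continuous.
exists (fun=> hz v); split; last exact: cvg_cst.
by near=> q; exact: (is_derive_hz (is_derive_id q v)).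
Unshelve. all: by end_near. Qed.

Lemma C1d_sqnorm_xy v p : C1d v (@sqnorm_xy R n) p.
Proof.
split; first exact: sqnorm_xy_continuous.
exists (fun q => 2 * \sum_i (hx i q * hx i v + hy i q * hy i v)); split.
  by near=> q; exact: (is_derive_sqnorm_xy (is_derive_id q v)).
apply: cvgM; first exact: cvg_cst.
apply: (@continuous_sumL _ _ _ (fun i q => hx i q * hx i v + hy i q * hy i v)) => i q.
by apply: cvgD; apply: cvgM; solve [exact: cvg_cst|exact: hx_continuous|exact: hy_continuous].
Unshelve. all: by end_near. Qed.

Lemma C1d_th v p : 0 < sqnorm_xy p -> 0 < hz p -> C1d v th p.
Proof.
move=> s0 z0.
have y0 : 0 < sqnorm_xy p / hz p by rewrite divr_gt0.
pose h' (y : R) := let t := theta y in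
  - ((t - sin t * cos t) ^+ 2 / (8 * sin t * (sin t - t * cos t))).
have hD (y : R) : 0 < y -> is_derive y (1 : R) theta (h' y).
  by move=> yp; have [tin E] := thetaP yp; have := is_derive_theta tin; rewrite E.
apply: (@C1d_comp _ _ _ theta h' (fun q => sqnorm_xy q / hz q)).
- by near=> y; apply: hD; near: y; exact: lt_nbhsr.
- pose k (t : R) : R := - ((t - sin t * cos t) ^+ 2 / (8 * sin t * (sin t - t * cos t))).
  have tc : {for sqnorm_xy p / hz p, continuous theta}.
    exact: is_derive_continuous (hD _ y0).
  apply: (continuous_comp (g := k) tc).
  have [tin _] := thetaP y0; move: (theta _) tin => t tin.
  have st := sin_gt0_pi tin; have mt := mul_cos_lt_sin tin.
  have nz : 8 * sin t * (sin t - t * cos t) != 0.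
    by rewrite gt_eqF // !mulr_gt0 // subr_gt0.
  by apply: is_derive_continuous; rewrite /k; repeat der1.
- apply: C1dM; first exact: C1d_sqnorm_xy.
  by apply: C1dV; [rewrite gt_eqF|exact: C1d_hz].
Unshelve. all: by end_near. Qed.

Definition fieldA p : R := sin (th p) ^+ 2 / (th p * sqnorm_xy p).
Definition fieldB p : R := sin (th p) * cos (th p) / (th p * sqnorm_xy p).

Lemma C1d_sin v (F : heis R n -> R) p : C1d v F p -> C1d v (fun q => sin (F q)) p.
Proof.
apply: (@C1d_comp _ _ _ sin cos); last exact: continuous_cos.
by near=> t; exact: is_derive_sin.
Unshelve. all: by end_near. Qed.

Lemma C1d_cos v (F : heis R n -> R) p : C1d v F p -> C1d v (fun q => cos (F q)) p.
Proof.
apply: (@C1d_comp _ _ _ cos (fun t => - sin t)).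
  by near=> t; exact: is_derive_cos.
by apply: cvgN; exact: continuous_sin.
Unshelve. all: by end_near. Qed.

Lemma th_sqnorm_neq0 p : 0 < sqnorm_xy p -> 0 < hz p -> th p * sqnorm_xy p != 0.
Proof.
move=> s0 z0; have /andP[t0 _] := th_itv s0 z0.
by rewrite gt_eqF // mulr_gt0.
Qed.

Lemma C1d_fieldA v p : 0 < sqnorm_xy p -> 0 < hz p -> C1d v fieldA p.
Proof.
move=> s0 z0; have tC := C1d_th v s0 z0.
apply: C1dM; first by apply: C1dX; exact: C1d_sin.
apply: C1dV; first exact: th_sqnorm_neq0.
by apply: C1dM => //; exact: C1d_sqnorm_xy.
Qed.

Lemma C1d_fieldB v p : 0 < sqnorm_xy p -> 0 < hz p -> C1d v fieldB p.
Proof.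
move=> s0 z0; have tC := C1d_th v s0 z0.
apply: C1dM; first by apply: C1dM; [exact: C1d_sin|exact: C1d_cos].
apply: C1dV; first exact: th_sqnorm_neq0.
by apply: C1dM => //; exact: C1d_sqnorm_xy.
Qed.

Lemma C1d_cutoff v N p : C1d v (fun q => cutoff N (sqnorm_xy q)) p.
Proof.
change (C1d v (fun q => bumpe 0 (N%:R * sqnorm_xy q - 1)) p).
apply: (@C1d_comp _ _ _ (bumpe 0) (bumpe 2) (fun q => N%:R * sqnorm_xy q - 1)).
- by near=> t; exact: is_derive_bumpe0.
- exact: bumpe_continuous.
- apply: C1dD; last exact: C1d_cst.
  by apply: C1dM; [exact: C1d_cst|exact: C1d_sqnorm_xy].
Unshelve. all: by end_near. Qed.

(** The partial derivative of [fieldA] in [s], with [z] eliminated. *)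
Definition dAs p : R := let t := th p in let s := sqnorm_xy p in
  sin t ^+ 3 * (t * (2 * cos t ^+ 2 - 1) - sin t * cos t) /
    (2 * t ^+ 2 * s ^+ 2 * (sin t - t * cos t)).

(* [4 dA/ds = dB/dz]: the field [fieldA radial - fieldB rotational] has
   horizontal divergence [2 n fieldA]. *)
Lemma is_derive_fields p : 0 < sqnorm_xy p -> 0 < hz p -> exists az bs,
  is_derive_sz fieldA p (dAs p) az /\ is_derive_sz fieldB p bs (4 * dAs p).
Proof.
move=> s0 z0; set t := th p; set s := sqnorm_xy p.
have tin : 0 < t < pi := th_itv s0 z0; have [t0 tpi] := andP tin.
have st := sin_gt0_pi tin; have m0 : 0 < sin t - t * cos t by rewrite subr_gt0 mul_cos_lt_sin.
have nz := th_sqnorm_neq0 s0 z0.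
pose ts := - (sin t * (t - sin t * cos t) / (2 * s * (sin t - t * cos t))).
pose tz := 2 * sin t ^+ 3 / (s * (sin t - t * cos t)).
pose At := (2 * sin t * cos t * t - sin t ^+ 2) / (t ^+ 2 * s).
pose Bt := ((cos t ^+ 2 - sin t ^+ 2) * t - sin t * cos t) / (t ^+ 2 * s).
exists (At * tz), (Bt * ts - sin t * cos t / (t * s ^+ 2)); split=> v.
  have Dt := is_derive_th s0 z0 v; have Ds := is_derive_sqnorm_xy (is_derive_id p v).
  rewrite /fieldA; der => //.
  rewrite /dAs -/t -/s; move: (\sum_i _) => S; rewrite /At /tz.
  by field: (sin2cos2 t); rewrite !gt_eqF.
have Dt := is_derive_th s0 z0 v; have Ds := is_derive_sqnorm_xy (is_derive_id p v).
rewrite /fieldB; der => //.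
rewrite /dAs -/t -/s; move: (\sum_i _) => S; rewrite /Bt /ts.
by field: (sin2cos2 t); rewrite !gt_eqF.
Qed.

End hardy_fields.

(** * The divergence identity and the pointwise inequality *)

Section pointwise_hardy.
Context {R : realType} {n : nat}.
Implicit Types (p v : heis R n) (u : heis R n -> R).

(** Constant directions, to which [integral_derive0] applies, in place of [Xfield] and [Yfield],
    which vary with the point. *)
Definition ex (i : 'I_n) : heis R n := (delta_mx ord0 i, 0, 0).
Definition ey (i : 'I_n) : heis R n := (0, delta_mx ord0 i, 0).
Definition ez : heis R n := (0, 0, 1).

Lemma hx_ex i : hx i (ex i) = 1. Proof. by rewrite /hx /= mxE !eqxx. Qed.
Lemma hy_ey i : hy i (ey i) = 1. Proof. by rewrite /hy /= mxE !eqxx. Qed.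
Lemma hy_ex i j : hy j (ex i) = 0. Proof. by rewrite /hy /= mxE. Qed.
Lemma hx_ey i j : hx j (ey i) = 0. Proof. by rewrite /hx /= mxE. Qed.

Lemma sum_ex p i : \sum_j (hx j p * hx j (ex i) + hy j p * hy j (ex i)) = hx i p.
Proof. by rewrite /hx /hy /= sum_deltal. Qed.
Lemma sum_ey p i : \sum_j (hx j p * hx j (ey i) + hy j p * hy j (ey i)) = hy i p.
Proof. by rewrite /hx /hy /=; under eq_bigr do rewrite addrC; rewrite sum_deltal. Qed.
Lemma sum_ez p : \sum_j (hx j p * hx j ez + hy j p * hy j ez) = 0.
Proof. by apply: big1 => j _; rewrite /hx /hy /= !mxE !mulr0 addr0. Qed.

Lemma is_derive_sz_ex u p us uz i : is_derive_sz u p us uz ->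
  is_derive p (ex i) u (2 * us * hx i p).
Proof. by move=> /(_ (ex i)); rewrite sum_ex /hz /= mulr0 addr0 mulrA [us * 2]mulrC. Qed.
Lemma is_derive_sz_ey u p us uz i : is_derive_sz u p us uz ->
  is_derive p (ey i) u (2 * us * hy i p).
Proof. by move=> /(_ (ey i)); rewrite sum_ey /hz /= mulr0 addr0 mulrA [us * 2]mulrC. Qed.
Lemma is_derive_sz_ez u p us uz : is_derive_sz u p us uz -> is_derive p ez u uz.
Proof. by move=> /(_ ez); rewrite sum_ez /hz /= !mulr0 add0r mulr1. Qed.

Lemma derive_Xfield u p i : differentiable u p ->
  'D_(Xfield i p) u p = 'D_(ex i) u p - hy i p / 2 * 'D_ez u p.
Proof.
move=> du; rewrite !deriveE //.
have -> : Xfield i p = ex i + (- (hy i p / 2)) *: ez.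
  by congr (_, _, _); rewrite /= ?scaler0 ?addr0 // add0r /GRing.scale /= mulr1.
transitivity ('d u p (ex i) + (- (hy i p / 2)) * 'd u p ez); last by ring.
by rewrite linearD linearZ.
Qed.

Lemma derive_Yfield u p i : differentiable u p ->
  'D_(Yfield i p) u p = 'D_(ey i) u p + hx i p / 2 * 'D_ez u p.
Proof.
move=> du; rewrite !deriveE //.
have -> : Yfield i p = ey i + (hx i p / 2) *: ez.
  by congr (_, _, _); rewrite /= ?scaler0 ?addr0 // add0r /GRing.scale /= mulr1.
by rewrite linearD linearZ.
Qed.

Definition fieldW p : heis R n := fieldA p *: radial p + (- fieldB p) *: rotational p.

(** The right side is the derivative of [u] along the horizontal lift of [fieldW], whose vertical
    coefficient [(x W_y - y W_x) / 2] equals [- s B / 2]. *)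
Lemma hinner_fieldW u p : differentiable u p ->
  hinner (hgrad u p) (fieldW p) =
  \sum_i ('D_(ex i) u p * (fieldA p * hx i p + fieldB p * hy i p) +
          'D_(ey i) u p * (fieldA p * hy i p - fieldB p * hx i p)) -
  sqnorm_xy p / 2 * fieldB p * 'D_ez u p.
Proof.
move=> du; rewrite hinnerE sqnorm_xyE !mulr_suml -sumrB; apply: eq_bigr => i _.
rewrite hx_hgrad hy_hgrad derive_Xfield // derive_Yfield //.
have -> : hx i (fieldW p) = fieldA p * hx i p + fieldB p * hy i p.
  by rewrite /hx /hy /= !mxE; ring.
have -> : hy i (fieldW p) = fieldA p * hy i p - fieldB p * hx i p.
  by rewrite /hx /hy /= !mxE; ring.
move: ('D_(ex i) u p) ('D_(ey i) u p) ('D_ez u p) (fieldA p) (fieldB p) (hx i p) (hy i p).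
by move=> a b c A B x y; field.
Qed.

Lemma hinner_nu_fieldW p : 0 < sqnorm_xy p -> 0 < hz p -> hinner (nu p) (fieldW p) = 0.
Proof.
move=> s0 z0; rewrite hinner_sz /fieldA /fieldB; have := th_sqnorm_neq0 s0 z0.
rewrite mulf_eq0 negb_or => /andP[t0 sn0].
have r0 : Num.sqrt (sqnorm_xy p) != 0 by rewrite gt_eqF // sqrtr_gt0.
by field; rewrite t0 sn0.
Qed.

Lemma hinner_fieldW_fieldW p : 0 < sqnorm_xy p -> 0 < hz p ->
  psi p * hinner (fieldW p) (fieldW p) = 2 * fieldA p.
Proof.
move=> s0 z0; rewrite hinner_sz psiE /fieldA /fieldB; have := th_sqnorm_neq0 s0 z0.
rewrite mulf_eq0 negb_or => /andP[t0 sn0].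
by field: (cos2sin2 (th p)); rewrite t0 sn0.
Qed.

Lemma psi_dist p : 0 < sqnorm_xy p -> 0 < hz p ->
  psi p / cc_dist0 p ^+ 2 = 2 * fieldA p.
Proof.
move=> s0 z0; rewrite cc_dist0E // /dist_sz /= -/(th p) psiE /fieldA.
rewrite expr_div_n exprMn sqr_sqrtr ?ltW //.
have tin := th_itv s0 z0; have [t0 _] := andP tin; have st := sin_gt0_pi tin.
by field; rewrite !gt_eqF.
Qed.

Lemma fieldA_gt0 p : 0 < sqnorm_xy p -> 0 < hz p -> 0 < fieldA p.
Proof.
move=> s0 z0; have tin := th_itv s0 z0; have [t0 _] := andP tin.
have st := sin_gt0_pi tin.
by rewrite /fieldA divr_gt0 ?exprn_gt0 // mulr_gt0.
Qed.

Variables (u : heis R n -> R) (N : nat).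

Definition eta p : R := cutoff N (sqnorm_xy p).
Definition eta' p : R := N%:R * bumpe 2 (N%:R * sqnorm_xy p - 1).

Lemma eta_derive p : is_derive_sz eta p (eta' p) 0.
Proof.
move=> v; have Ds := is_derive_sqnorm_xy (is_derive_id p v).
change (is_derive p v (fun q => bumpe 0 (N%:R * sqnorm_xy q - 1))
  (eta' p * (2 * \sum_i (hx i p * hx i v + hy i p * hy i v)) + 0 * hz v)).
eapply is_derive_eq.
  apply: (@is_derive_compL _ _ (bumpe 0) (fun q : heis R n => N%:R * sqnorm_xy q - 1) _ _ _ _
    (is_derive_bumpe0 _)).
by rewrite /eta' /GRing.scale /=; ring.
Qed.

Lemma eta_ge0 p : 0 <= eta p. Proof. exact: bumpe_ge0. Qed.
Lemma eta_le1 p : eta p <= 1. Proof. exact: bumpe0_le1. Qed.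
Lemma eta'_ge0 p : 0 <= eta' p.
Proof. by rewrite mulr_ge0 ?bumpe_ge0. Qed.

(** [gx], [gy] and [gz] are the Euclidean components of the horizontal lift of [u ^ 2 eta W], and
    [divg] is its divergence. *)
Definition gx i p : R := u p ^+ 2 * (eta p * (fieldA p * hx i p + fieldB p * hy i p)).
Definition gy i p : R := u p ^+ 2 * (eta p * (fieldA p * hy i p - fieldB p * hx i p)).
Definition gz p : R := u p ^+ 2 * (eta p * (- (sqnorm_xy p / 2 * fieldB p))).

Definition divg p : R :=
  \sum_i ('D_(ex i) (gx i) p + 'D_(ey i) (gy i) p) + 'D_ez gz p.

(** The terms in [dB/ds] cancel between [x] and [y], and [2 s dA/ds] from the horizontal coordinates
    cancels [- (s / 2) dB/dz] by [is_derive_fields]. There remain the derivative of [u ^ 2], the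
    term [2 n A] due to [div xi = 2 n], and the slope of the cutoff. *)
Lemma divgE p : differentiable u p -> 0 < sqnorm_xy p -> 0 < hz p ->
  divg p = eta p * (2 * u p * hinner (hgrad u p) (fieldW p)) +
    (2 * n%:R * fieldA p * eta p + 2 * sqnorm_xy p * eta' p * fieldA p) * u p ^+ 2.
Proof.
move=> du s0 z0; rewrite hinner_fieldW //.
have [az [bs [DA DB]]] := is_derive_fields s0 z0.
have De := eta_derive p.
have Du v : is_derive p v u ('D_v u p).
  by apply: DeriveDef => //; exact: diff_derivable.
pose E := eta p; pose A := fieldA p; pose B := fieldB p.
have Dx i : is_derive p (ex i) (gx i) (2 * u p * 'D_(ex i) u p * (E * (A * hx i p + B * hy i p)) +
    u p ^+ 2 * (2 * eta' p * hx i p * (A * hx i p + B * hy i p) +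
      E * (2 * dAs p * hx i p * hx i p + A + 2 * bs * hx i p * hy i p))).
  have h1 := is_derive_sz_ex i DA; have h2 := is_derive_sz_ex i DB.
  have h3 := is_derive_sz_ex i De; have h4 := Du (ex i).
  have h5 := is_derive_hx i (is_derive_id p (ex i)).
  have h6 := is_derive_hy i (is_derive_id p (ex i)).
  rewrite hx_ex in h5; rewrite hy_ex in h6.
  by rewrite /gx; der; rewrite -/E -/A -/B /= expr1; ring.
have Dy i : is_derive p (ey i) (gy i) (2 * u p * 'D_(ey i) u p * (E * (A * hy i p - B * hx i p)) +
    u p ^+ 2 * (2 * eta' p * hy i p * (A * hy i p - B * hx i p) +
      E * (2 * dAs p * hy i p * hy i p + A - 2 * bs * hy i p * hx i p))).
  have h1 := is_derive_sz_ey i DA; have h2 := is_derive_sz_ey i DB.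
  have h3 := is_derive_sz_ey i De; have h4 := Du (ey i).
  have h5 := is_derive_hx i (is_derive_id p (ey i)).
  have h6 := is_derive_hy i (is_derive_id p (ey i)).
  rewrite hx_ey in h5; rewrite hy_ey in h6.
  by rewrite /gy; der; rewrite -/E -/A -/B /= expr1; ring.
have Dz : is_derive p ez gz (- (sqnorm_xy p / 2 * E * (2 * u p * 'D_ez u p * B + u p ^+ 2 * (4 * dAs p)))).
  have h1 := is_derive_sz_ez DB; have h3 := is_derive_sz_ez De; have h4 := Du ez.
  have h5 := is_derive_sqnorm_xy (is_derive_id p ez); rewrite sum_ez mulr0 in h5.
  by rewrite /gz; der; rewrite -/E -/B /= expr1; field.
rewrite /divg (@derive_val _ _ _ _ _ _ _ Dz).
under eq_bigr => i _ do rewrite (@derive_val _ _ _ _ _ _ _ (Dx i)) (@derive_val _ _ _ _ _ _ _ (Dy i)).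
rewrite -/E -/A -/B.
have -> : \sum_i (2 * u p * 'D_(ex i) u p * (E * (A * hx i p + B * hy i p)) +
    u p ^+ 2 * (2 * eta' p * hx i p * (A * hx i p + B * hy i p) +
      E * (2 * dAs p * hx i p * hx i p + A + 2 * bs * hx i p * hy i p)) +
   (2 * u p * 'D_(ey i) u p * (E * (A * hy i p - B * hx i p)) +
    u p ^+ 2 * (2 * eta' p * hy i p * (A * hy i p - B * hx i p) +
      E * (2 * dAs p * hy i p * hy i p + A - 2 * bs * hy i p * hx i p)))) =
  2 * u p * E * (\sum_i ('D_(ex i) u p * (A * hx i p + B * hy i p) +
          'D_(ey i) u p * (A * hy i p - B * hx i p))) +
  (2 * eta' p * A + 2 * E * dAs p) * u p ^+ 2 * sqnorm_xy p +
  2 * A * E * u p ^+ 2 * n%:R.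
  have -> : n%:R = \sum_(i < n) (1 : R) by rewrite sumr_const card_ord.
  rewrite sqnorm_xyE !mulr_sumr -!big_split /=.
  apply: eq_bigr => i _; clearbody E A B.
  move: ('D_(ex i) u p) ('D_(ey i) u p) (hx i p) (hy i p) (eta' p) (dAs p) (u p).
  by move=> a b x y e' As u0; ring.
move: (\sum_i _); clearbody E A B.
move: ('D_ez u p) (eta' p) (dAs p) (u p) (sqnorm_xy p).
by move=> c e' As u0 s' S; field.
Qed.

(** Once the square is dropped, the difference of the two sides, multiplied by [psi], is [psi] times
    the sum of [n s eta' A u ^ 2] and a nonnegative multiple of [eta - eta ^ 2]; hence the need for
    [eta' >= 0] and [0 <= eta <= 1]. *)
Lemma hardy_pointwise p : differentiable u p -> 0 < sqnorm_xy p -> 0 < hz p ->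
  n%:R ^+ 2 / 2 * (u p ^+ 2 * (eta p * fieldA p)) - n%:R / 2 * divg p <=
  hnorm (hgrad_perp u p) ^+ 2 / psi p.
Proof.
move=> du s0 z0; rewrite divgE //.
have psi0 : 0 < psi p by rewrite psiE mulr_gt0 //; case/andP: (th_itv s0 z0).
rewrite ler_pdivlMr //.
(* Where [eta = 1] this is the optimal coefficient [- (n / 2) u psi] of [W]; the factor [eta]
   matches the field whose divergence is subtracted. *)
have := hnorm_perp_ge u (- (n%:R / 2) * eta p * u p * psi p) s0 z0 (hinner_nu_fieldW s0 z0).
apply: le_trans.
set I := hinner (hgrad u p) (fieldW p).
have -> : (- (n%:R / 2) * eta p * u p * psi p) ^+ 2 * hinner (fieldW p) (fieldW p) =
  n%:R ^+ 2 / 4 * (eta p ^+ 2 * u p ^+ 2) * psi p * (2 * fieldA p).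
  by rewrite -(hinner_fieldW_fieldW s0 z0); field.
have A0 := ltW (fieldA_gt0 s0 z0).
have e0 := eta_ge0 p; have e1 := eta_le1 p.
have h1 : 0 <= n%:R * (sqnorm_xy p * eta' p * fieldA p * u p ^+ 2).
  exact: mulr_ge0 (ler0n _ _) (mulr_ge0 (mulr_ge0 (mulr_ge0 (ltW s0) (eta'_ge0 p)) A0) (sqr_ge0 _)).
have h2 : eta p ^+ 2 * (n%:R ^+ 2 * u p ^+ 2 * fieldA p) <= eta p * (n%:R ^+ 2 * u p ^+ 2 * fieldA p).
  apply: ler_wpM2r; last by rewrite expr2 ler_piMl.
  exact: mulr_ge0 (mulr_ge0 (sqr_ge0 _) (sqr_ge0 _)) A0.
rewrite -subr_ge0.
have -> : 2 * (- (n%:R / 2) * eta p * u p * psi p) * I -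
   n%:R ^+ 2 / 4 * (eta p ^+ 2 * u p ^+ 2) * psi p * (2 * fieldA p) -
   (n%:R ^+ 2 / 2 * (u p ^+ 2 * (eta p * fieldA p)) -
    n%:R / 2 * (eta p * (2 * u p * I) + (2 * n%:R * fieldA p * eta p +
      2 * sqnorm_xy p * eta' p * fieldA p) * u p ^+ 2)) * psi p =
  psi p * (n%:R * (sqnorm_xy p * eta' p * fieldA p * u p ^+ 2) +
    (eta p * (n%:R ^+ 2 * u p ^+ 2 * fieldA p) - eta p ^+ 2 * (n%:R ^+ 2 * u p ^+ 2 * fieldA p)) / 2).
  move: (fieldA p) (eta' p) (eta p) (u p) (sqnorm_xy p) (psi p) => A e' e u0 s' ps.
  by clearbody I; field.
by apply: mulr_ge0 (ltW psi0) _; apply: addr_ge0 h1 _; rewrite divr_ge0 // subr_ge0.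
Qed.

End pointwise_hardy.

(** * The Hardy inequality *)

Section hardy_inequality.
Context {R : realType} {n : nat}.
Local Notation mu := (@lebesgue_heis R n).
Implicit Types (p v : heis R n) (u : heis R n -> R).

Lemma sqnorm_xy_gt0 p : sqnorm_xy p <> 0 -> 0 < sqnorm_xy p.
Proof. by move=> /eqP s0; rewrite lt_neqAle eq_sym s0 sqnorm_xy_ge0. Qed.

(** For a positive quotient this is [thetaP]. For the quotient [0] the value lies in [[0, 2 pi]]
    because [phi] does take the value [0] there, at [2 pi]. *)
Lemma psi_ge0 p : 0 <= sqnorm_xy p / hz p -> 0 <= psi p.
Proof.
rewrite le_eqVlt => /predU1P[y0|y0]; last first.
  have [/andP[t0 _] _] := thetaP y0.
  by rewrite psiE mulr_ge0 // ltW.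
have phi0 : phi (2 * pi) = 0%:E :> \bar R by rewrite phi_qratio ?pi_gt0 // qratio_pi.
have : `[0, 2 * pi]%classic (psi p).
  rewrite /psi -/(hz p) -y0.
  have := @surjpinv_image_sub _ _ (fun=> point) `[0, 2 * pi]%classic
    (phi @` `[0, 2 * (pi : R)]%classic) phi.
  apply => //; exists 0%:E => //; exists (2 * pi) => //.
  by rewrite /= in_itv /= lexx andbT mulr_ge0 // pi_ge0.
by rewrite /= in_itv /= => /andP[].
Qed.

(** The center lies in the coordinate hyperplane where [hx i0] vanishes. *)
Lemma center_negligible : (0 < n)%N -> mu.-negligible [set p : mheis R n | sqnorm_xy p = 0].
Proof.
move=> n0; pose i0 := Ordinal n0.
pose A (i : 'I_n) : set (measurableTypeR R) := if i == i0 then [set 0] else setT.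
have mA i : measurable (A i) by rewrite /A; case: ifP.
have mT : measurable (setT : set (measurableTypeR R)) by [].
exists [set p : mheis R n | [/\ forall i, A i (hx i p), forall i : 'I_n, setT (hy i p) & setT (hz p)]].
split; first exact: (measurable_box mA (fun=> mT) mT).
  rewrite [LHS](lebesgue_heis_box mA (fun=> mT) mT) (bigD1 i0) //= {1}/A eqxx lebesgue_measure_set1.
  by rewrite !mul0e.
move=> p /= /eqP; rewrite sqnorm_xyE psumr_eq0 => [/allP H|i _]; last first.
  by rewrite addr_ge0 // sqr_ge0.
split => // i; rewrite /A; case: ifP => // /eqP ->.
have := H i0; rewrite mem_index_enum => /(_ isT).
by rewrite paddr_eq0 ?sqr_ge0 // !sqrf_eq0 => /andP[/eqP].
Qed.

Lemma smooth_C1d u v p : smooth u -> C1d v u p.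
Proof.
move=> su; split; first exact: differentiable_continuous (su [::] p).
exists ('D_v u); split; last exact: differentiable_continuous (su [:: v] p).
by near=> q; apply: DeriveDef => //; apply: diff_derivable; exact: (su [::] q).
Unshelve. all: by end_near. Qed.

(** Continuity and bounded support are carried along because they provide the integrability that
    closes the class under sums. *)
Definition mean0 (h : heis R n -> R) :=
  [/\ continuous h, bounded_support h & (\int[mu]_p (h p)%:E = 0)%E].

Lemma bounded_supportD (g h : heis R n -> R) :
  bounded_support g -> bounded_support h -> bounded_support (fun p => g p + h p).
Proof.
move=> [M gM] [M' hM]; exists (Num.max M M') => p gh; rewrite le_max.
have [g0|gn] := eqVneq (g p) 0; last by rewrite gM.
by rewrite hM ?orbT //; move: gh; rewrite g0 add0r.
Qed.

Lemma mean0D g h : mean0 g -> mean0 h -> mean0 (fun p => g p + h p).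
Proof.
move=> [gc gs g0] [hc hs h0]; split; first by move=> p; apply: cvgD; [exact: gc|exact: hc].
  exact: bounded_supportD.
have ig := continuous_bounded_support_integrable gc gs.
have ih := continuous_bounded_support_integrable hc hs.
under eq_integral do rewrite EFinD.
by rewrite (integralD measurableT ig ih) /= g0 h0 adde0.
Qed.

Lemma mean0_sum m (g : 'I_m -> heis R n -> R) :
  (forall i, mean0 (g i)) -> mean0 (fun p => \sum_i g i p).
Proof.
elim: m g => [|m IH] g g0; last first.
  by under eq_fun do rewrite big_ord_recl; apply: mean0D => //; exact: IH.
under eq_fun do rewrite big_ord0; split; first by move=> p; exact: cvg_cst.
  by exists 0 => p; rewrite eqxx.
exact: integral0.
Qed.

Lemma mean0_derive (g : heis R n -> R) v :
  (forall p, C1d v g p) -> bounded_support g -> mean0 ('D_v g).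
Proof.
move=> gC gs; have [gc dc gd] := C1d_derive gC; split => //.
  by case: gs => M gM; exists M; exact: bounded_support_derive gd gM.
exact: integral_derive0 gc dc gd gs.
Qed.

Section fixed_function.
Variable u : heis R n -> R.
Hypothesis su : smooth u.
Hypothesis bu : bounded_support u.
Hypothesis zu : forall p, hz p <= 0 -> \forall q \near p, u q = 0.

(** [K] may be singular on the center and for [z <= 0]: near points of the latter kind [u] vanishes,
    near points of the former the cutoff does. *)
Lemma C1d_cut v (K : heis R n -> R) N p :
  (forall q, 0 < sqnorm_xy q -> 0 < hz q -> C1d v K q) ->
  C1d v (fun q => u q ^+ 2 * (eta N q * K q)) p.
Proof.
move=> KC; have [z0|z0] := leP (hz p) 0.
  apply: (C1d_near (F := fun _ => 0)); last exact: C1d_cst.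
  by apply: filterS (zu z0) => q ->; rewrite expr0n mul0r.
have := sqnorm_xy_ge0 p; rewrite le_eqVlt => /predU1P[s0|s0]; last first.
  apply: C1dM; first by apply: C1dX; exact: smooth_C1d.
  by apply: C1dM; [exact: C1d_cutoff|exact: KC].
apply: (C1d_near (F := fun _ => 0)); last exact: C1d_cst.
have c1 : {for p, continuous (fun q : heis R n => 1 - N%:R * sqnorm_xy q)}.
  apply: cvgB; first exact: cvg_cst.
  by apply: cvgM; [exact: cvg_cst|exact: sqnorm_xy_continuous].
have := near_gt0 c1; rewrite /= -s0 mulr0 subr0 => /(_ ltr01).
apply: filterS => q q1.
by rewrite /eta /cutoff bumpe_le0 ?mul0r ?mulr0 // subr_le0 ltW // -subr_gt0.
Qed.

Lemma bounded_support_cut (K : heis R n -> R) : bounded_support (fun q => u q ^+ 2 * K q).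
Proof.
case: bu => M uM; exists M => p; rewrite mulf_eq0 negb_or sqrf_eq0 => /andP[up _].
exact: uM.
Qed.

Lemma mean0_divg N : mean0 (divg u N).
Proof.
apply: mean0D; last first.
  apply: mean0_derive; last exact: bounded_support_cut.
  move=> p; apply: (@C1d_cut _ (fun q => - (sqnorm_xy q / 2 * fieldB q))) => q s0 z0.
  apply: C1dN; apply: C1dM; last exact: C1d_fieldB.
  by apply: C1dM; [exact: C1d_sqnorm_xy|exact: C1d_cst].
apply: mean0_sum => i; apply: mean0D.
  apply: mean0_derive; last exact: bounded_support_cut.
  move=> p; apply: (@C1d_cut _ (fun q => fieldA q * hx i q + fieldB q * hy i q)) => q s0 z0.
  apply: C1dD; apply: C1dM;
    solve [exact: C1d_fieldA|exact: C1d_fieldB|exact: C1d_hx|exact: C1d_hy].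
apply: mean0_derive; last exact: bounded_support_cut.
move=> p; apply: (@C1d_cut _ (fun q => fieldA q * hy i q - fieldB q * hx i q)) => q s0 z0.
apply: C1dD; last apply: C1dN; apply: C1dM;
  solve [exact: C1d_fieldA|exact: C1d_fieldB|exact: C1d_hx|exact: C1d_hy].
Qed.

(** By [psi_dist], half the integrand of [hardy_rhs] with the center cut off; it is continuous and
    increases with [N]. *)
Definition weight N p : R := u p ^+ 2 * (eta N p * fieldA p).

Lemma weight_continuous N : continuous (weight N).
Proof.
move=> p; have [] := @C1d_cut 0 fieldA N p; last by [].
by move=> q s0 z0; exact: C1d_fieldA.
Qed.

Lemma vanishing p : hz p <= 0 -> u p = 0.
Proof. by move=> z0; exact: nbhs_singleton (zu z0). Qed.

Lemma eta_center N p : sqnorm_xy p = 0 -> eta N p = 0.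
Proof. by move=> s0; rewrite /eta /cutoff s0 mulr0 sub0r bumpe_le0 // oppr_le0. Qed.

Lemma weight_cases (P : R -> Prop) N p : P 0 ->
  (0 < sqnorm_xy p -> 0 < hz p -> P (weight N p)) -> P (weight N p).
Proof.
move=> P0 HP; have [z0|z0] := leP (hz p) 0.
  by rewrite /weight vanishing // expr0n mul0r.
have := sqnorm_xy_ge0 p; rewrite le_eqVlt => /predU1P[s0|s0]; last exact: HP.
by rewrite /weight eta_center // mul0r mulr0.
Qed.

Lemma weight_ge0 N p : 0 <= weight N p.
Proof.
apply: (@weight_cases (fun x => 0 <= x)) => // s0 z0.
by apply: mulr_ge0 (sqr_ge0 _) (mulr_ge0 (eta_ge0 _ _) (ltW (fieldA_gt0 s0 z0))).
Qed.

Lemma weight_nondecreasing p : {homo weight ^~ p : m k / (m <= k)%N >-> m <= k}.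
Proof.
move=> m k mk; have [z0|z0] := leP (hz p) 0.
  by rewrite /weight vanishing // expr0n !mul0r.
have := sqnorm_xy_ge0 p; rewrite le_eqVlt => /predU1P[s0|s0].
  by rewrite /weight !eta_center // !mul0r.
apply: ler_wpM2l (sqr_ge0 _) _ _ _; apply: ler_wpM2r; first exact: ltW (fieldA_gt0 s0 z0).
exact: cutoff_nondecreasing (sqnorm_xy_ge0 p) _ _ mk.
Qed.

Lemma weight_integrable N : mu.-integrable setT (EFin \o weight N).
Proof.
apply: continuous_bounded_support_integrable; first exact: weight_continuous.
exact: bounded_support_cut.
Qed.

Lemma weight_cvg p : 0 < sqnorm_xy p ->
  weight N p @[N --> \oo] --> u p ^+ 2 * fieldA p.
Proof.
move=> s0; have := cutoff_cvg s0 => etac.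
rewrite -[fieldA p]mul1r; apply: cvgM; first exact: cvg_cst.
by apply: cvgM => //; exact: cvg_cst.
Qed.

Lemma psi_posz p : 0 < hz p -> 0 <= psi p.
Proof. by move=> z0; rewrite psi_ge0 // divr_ge0 ?sqnorm_xy_ge0 // ltW. Qed.

Variable C : set (heis R n).
Hypothesis Cz : forall p, C p -> 0 < hz p.

Lemma hardy_rhs_integrand_ge0 p :
  (0 <= ((fun q => (`|u q| ^+ 2 / cc_dist0 q ^+ 2 * psi q)%:E) \_ C) p)%E.
Proof.
rewrite patchE; case: ifPn => // /set_mem Cp.
by rewrite lee_fin mulr_ge0 ?psi_posz ?Cz // divr_ge0 // sqr_ge0.
Qed.

Hypothesis uC : forall p, ~ C p -> \forall q \near p, u q = 0.
Hypothesis n0 : (0 < n)%N.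

(** Integrates [hardy_pointwise], the divergence having mean [0]. At a point outside [C] the
    function [u] vanishes nearby, so [weight] and [divg] are [0] there. *)
Lemma hardy_lhs_weight N :
  ((n%:R ^+ 2 / 2)%:E * \int[mu]_p (weight N p)%:E <= hardy_lhs C u)%E.
Proof.
have [dc ds d0] := mean0_divg N.
pose h p := n%:R ^+ 2 / 2 * weight N p - n%:R / 2 * divg u N p.
have wi := weight_integrable N.
have di := continuous_bounded_support_integrable dc ds.
have hc : continuous h.
  move=> p; apply: cvgB; (apply: cvgM; first exact: cvg_cst); [exact: weight_continuous|exact: dc].
have hs : bounded_support h.
  case: (bounded_support_cut (fun q => eta N q * fieldA q)) => M wM; case: ds => M' dM.
  exists (Num.max M M') => p hp; rewrite le_max.
  have [w0|wn] := eqVneq (weight N p) 0; last by rewrite wM.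
  rewrite dM ?orbT //; apply: contraNneq hp => dp; rewrite /h w0 dp !mulr0 subrr //.
have hi := continuous_bounded_support_integrable hc hs.
have -> : ((n%:R ^+ 2 / 2)%:E * \int[mu]_p (weight N p)%:E = \int[mu]_p (h p)%:E)%E.
  have E p : (h p)%:E = ((n%:R ^+ 2 / 2)%:E * (weight N p)%:E - (n%:R / 2)%:E * (divg u N p)%:E)%E.
    by [].
  under [RHS]eq_integral do rewrite E.
  rewrite (integralB measurableT (integrableZl measurableT _ wi) (integrableZl measurableT _ di)) /=.
  by rewrite (integralZl measurableT wi) (integralZl measurableT di) /= d0 mule0 sube0.
(* [ge0_ae_le_integral_lower] compares nonnegative functions; the positive part is still below the
   integrand of [hardy_lhs]. *)
pose hp p := Num.max 0 (h p).
have hpc : continuous hp.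
  by move=> p; apply: continuous_max; [exact: cvg_cst|exact: hc].
have hps : bounded_support hp.
  case: hs => M hM; exists M => p hpn; apply: hM; apply: contraNneq hpn => h0.
  by rewrite /hp h0 maxxx.
have hpi := continuous_bounded_support_integrable hpc hps.
apply: (@le_trans _ _ (\int[mu]_p (hp p)%:E)%E).
  by apply: le_integral => // p _; rewrite lee_fin /hp le_max lexx orbT.
rewrite /hardy_lhs [leRHS]integral_mkcond.
apply: (ge0_ae_le_integral_lower (center_negligible n0)) => [p _|p _|p _ sn].
- by rewrite lee_fin /hp le_max lexx.
- rewrite patchE; case: ifPn => // /set_mem Cp.
  by rewrite lee_fin divr_ge0 ?sqr_ge0 // psi_posz // Cz.
- have [Cp|Cp] := pselect (C p).
    rewrite patchE mem_set // lee_fin /hp ge_max; have z0 := Cz Cp.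
    rewrite divr_ge0 ?sqr_ge0 ?psi_posz //=.
    have s0 := sqnorm_xy_gt0 sn.
    by apply: hardy_pointwise => //; exact: (su [::] p).
  have z0 : \forall q \near p, u q = 0 := uC Cp.
  rewrite patchE memNset // lee_fin /hp ge_max lexx /=.
  have -> : h p = 0; last by [].
  have up := nbhs_singleton z0; rewrite /h /weight up expr0n mul0r mulr0 sub0r.
  have D (K : heis R n -> R) v : 'D_v (fun q => u q ^+ 2 * K q) p = 0.
    have near0 : \forall q \near p, cst 0 q = u q ^+ 2 * K q.
      by apply: filterS z0 => q ->; rewrite expr0n mul0r.
    exact: (@derive_val _ _ _ _ _ _ _ (is_derive_near near0 (is_derive_cst 0 p v))).
  rewrite /divg big1 => [|i _]; first by rewrite [X in _ + X]D addr0 mulr0 oppr0.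
  by rewrite [X in X + _]D [X in _ + X]D addr0.
Qed.

(** Off the center the cutoff increases to [1], so monotone convergence recovers the integrand
    almost everywhere. *)
Lemma hardy_rhs_weight :
  (hardy_rhs C u <= limn (fun N => \int[mu]_p (2 * weight N p)%:E))%E.
Proof.
rewrite -monotone_convergence //.
- rewrite /hardy_rhs [leLHS]integral_mkcond.
  apply: (ge0_ae_le_integral_lower (center_negligible n0)) => [p _|p _|p _ sn].
  + exact: hardy_rhs_integrand_ge0.
  + by apply: lime_ge; [apply: ereal_nondecreasing_is_cvgn => m k mk;
      rewrite lee_fin ler_pM2l // weight_nondecreasing|
      apply: nearW => N; rewrite lee_fin mulr_ge0 // weight_ge0].
  + have [Cp|Cp] := pselect (C p); last first.
      rewrite patchE memNset //; apply: lime_ge; [apply: ereal_nondecreasing_is_cvgn => m k mk;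
        by rewrite lee_fin ler_pM2l // weight_nondecreasing|
        by apply: nearW => N; rewrite lee_fin mulr_ge0 // weight_ge0].
    rewrite patchE mem_set //; have z0 := Cz Cp.
    have s0 := sqnorm_xy_gt0 sn.
    have -> : limn (fun N => (2 * weight N p)%:E) = (2 * (u p ^+ 2 * fieldA p))%:E.
      apply/cvg_lim => //; apply: cvg_EFin; first exact: nearW.
      by apply: cvgM; [exact: cvg_cst|exact: weight_cvg].
    rewrite lee_fin real_normK ?num_real // mulrAC -mulrA psi_dist //.
    by rewrite mulrCA.
- move=> N; apply/measurable_EFinP; apply: continuous_measurable_heis => p.
  by apply: cvgM; [exact: cvg_cst|exact: weight_continuous].
- by move=> N p _; rewrite lee_fin mulr_ge0 // weight_ge0.
- by move=> p _ m k mk; rewrite lee_fin ler_pM2l // weight_nondecreasing.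
Qed.

Lemma hardy_inequality : ((n%:R ^+ 2 / 4)%:E * hardy_rhs C u <= hardy_lhs C u)%E.
Proof.
have c0 : 0 < n%:R ^+ 2 / 4 :> R by rewrite divr_gt0 // exprn_gt0 // ltr0n.
have H : (hardy_rhs C u <= ((n%:R ^+ 2 / 4)^-1)%:E * hardy_lhs C u)%E.
  apply: le_trans hardy_rhs_weight _; apply: lime_le.
    apply: ereal_nondecreasing_is_cvgn => m k mk; apply: le_integral => //.
    - exact: (integrableZl measurableT 2 (weight_integrable m)).
    - exact: (integrableZl measurableT 2 (weight_integrable k)).
    - by move=> p _; rewrite lee_fin ler_pM2l // weight_nondecreasing.
  apply: nearW => N.
  have -> : (\int[mu]_p (2 * weight N p)%:E =
      ((n%:R ^+ 2 / 4)^-1)%:E * ((n%:R ^+ 2 / 2)%:E * \int[mu]_p (weight N p)%:E))%E.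
    rewrite muleA -EFinM (_ : _^-1 * _ = 2); last first.
      by field; rewrite pnatr_eq0 -lt0n.
    rewrite -(integralZl measurableT (weight_integrable N)).
    by apply: eq_integral => p _; rewrite EFinM.
  by apply: lee_wpmul2l; [rewrite lee_fin ltW // invr_gt0|exact: hardy_lhs_weight].
have := lee_wpmul2l (x := (n%:R ^+ 2 / 4)%:E) _ H; rewrite lee_fin => /(_ (ltW c0)).
by rewrite muleA -EFinM mulfV ?gt_eqF // mul1e.
Qed.

End fixed_function.

End hardy_inequality.

(** * Test functions on cones: positivity and finiteness of [hardy_rhs] *)

Section test_functions_on_cones.
Context {R : realType} {n : nat}.
Local Notation mu := (@lebesgue_heis R n).
Implicit Types (p v : heis R n) (u : heis R n -> R).

Lemma sin_le_id (t : R) : 0 <= t -> sin t <= t.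
Proof.
rewrite le_eqVlt => /predU1P[<-|t0]; first by rewrite sin0.
have [c _] := mvt t0 (fun x _ => is_derive_sin x).
by rewrite sin0 !subr0 => ->; rewrite ler_piMl ?cos_le1 // ltW.
Qed.

Lemma homogeneous_cone_hz (S : set (heis R n)) p :
  spherical_cap S -> homogeneous_cone S p -> 0 < hz p.
Proof.
move=> [c _ ->] [q [l [l0 [[_ q0] _] ->]]].
by rewrite /hz /= mulr_gt0 // exprn_gt0.
Qed.

Lemma test_function_notin (C : set (heis R n)) u p :
  test_function C u -> ~ C p -> \forall q \near p, u q = 0.
Proof.
move=> [_ _ clC] Cp.
have : nbhs p (~` closure [set p | u p != 0]).
  apply: open_nbhs_nbhs; split; first by apply: closed_openC; exact: closed_closure.
  by move/clC.
apply: filterS => q qn; apply/eqP/negPn/negP => uq; apply: qn.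
exact: subset_closure.
Qed.

Lemma test_function_bounded_support (C : set (heis R n)) u :
  test_function C u -> bounded_support u.
Proof.
move=> [_ /compact_bounded [N [_ NP]] _]; exists (N + 1) => p up.
by apply: (NP (N + 1)); [rewrite ltrDl|exact: subset_closure].
Qed.

Lemma continuous_gt0_integral (h : heis R n -> R) p0 : continuous h ->
  (forall p, 0 <= h p) -> 0 < h p0 -> (0 < \int[mu]_p (h p)%:E)%E.
Proof.
move=> hc h0 hp0.
have hp2 : 0 < h p0 / 2 by rewrite divr_gt0.
have : \forall q \near p0, h p0 / 2 < h q.
  by apply: (cvgr_gt _ (hc p0)); lra.
move=> /nbhs_ballP[e /= e0 He].
pose I (x : R) : set (measurableTypeR R) := `](x - e), (x + e)[%classic.
have mI x : measurable (I x) by exact: measurable_itv.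
pose B := [set p : mheis R n | [/\ forall i, I (hx i p0) (hx i p),
   forall i, I (hy i p0) (hy i p) & I (hz p0) (hz p)]].
have mB : measurable B := measurable_box (fun i => mI _) (fun i => mI _) (mI _).
have IE x : lebesgue_measure (I x) = (2 * e)%:E.
  rewrite lebesgue_measure_itv /= lte_fin ifT; last by lra.
  by rewrite -EFinB; congr (_%:E); ring.
have muB : (0 < mu B)%E.
  have := lebesgue_heis_box (fun i => mI (hx i p0)) (fun i => mI (hy i p0)) (mI (hz p0)).
  rewrite -/B => ->; have e2 : (0 < (2 * e)%:E)%E by rewrite lte_fin mulr_gt0.
  rewrite IE; under eq_bigr do rewrite IE; under [X in (_ * X * _)%E]eq_bigr do rewrite IE.
  have pp : (0 < \prod_(i < n) (2 * e)%:E)%E.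
    by elim/big_ind: _ => // x y; exact: mule_gt0.
  by rewrite !mule_gt0.
apply: (@lt_le_trans _ _ ((h p0 / 2)%:E * mu B)%E); first by rewrite mule_gt0.
rewrite -integral_cst //.
apply: (@le_trans _ _ (\int[mu]_(p in B) (h p)%:E)%E).
  apply: ge0_le_integral => //.
  - by move=> p _; rewrite lee_fin ltW.
  - by apply/measurable_EFinP; apply: measurable_funTS; exact: continuous_measurable_heis.
  - move=> p [px py pz]; rewrite lee_fin ltW //; apply: He.
    have bI x y : I x y -> ball x e y.
      by rewrite /I /= in_itv /= /ball /= ltr_norml => /andP[? ?]; apply/andP; split; lra.
    split; [split|exact: bI].
    + by split=> // i j; rewrite ord1; exact: bI (px j).
    + by split=> // i j; rewrite ord1; exact: bI (py j).
apply: ge0_subset_integral => //.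
- by apply/measurable_EFinP; exact: continuous_measurable_heis.
- by move=> p _; rewrite lee_fin.
Qed.

Section fixed_function.
Variables (u : heis R n -> R) (C : set (heis R n)).
Hypothesis Cz : forall p, C p -> 0 < hz p.
Hypothesis tu : test_function C u.
Hypothesis n0 : (0 < n)%N.

Let su : smooth u. Proof. by case: tu. Qed.
Let bu : bounded_support u := test_function_bounded_support tu.
Let uC p : ~ C p -> \forall q \near p, u q = 0 := test_function_notin tu.
Let zu p : hz p <= 0 -> \forall q \near p, u q = 0.
Proof. by move=> z0; apply: uC => /Cz; rewrite ltNge z0. Qed.

Lemma test_function_hardy :
  ((n%:R ^+ 2 / 4)%:E * hardy_rhs C u <= hardy_lhs C u)%E.
Proof. exact: hardy_inequality. Qed.

Lemma hardy_rhs_ge_weight N : (\int[mu]_p (2 * weight u N p)%:E <= hardy_rhs C u)%E.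
Proof.
rewrite /hardy_rhs [leRHS]integral_mkcond.
apply: (ge0_ae_le_integral_lower (center_negligible n0)) => [p _|p _|p _ sn].
- by rewrite lee_fin mulr_ge0 // weight_ge0.
- exact: hardy_rhs_integrand_ge0.
- have [Cp|Cp] := pselect (C p); last first.
    by rewrite patchE memNset // /weight (nbhs_singleton (uC Cp)) expr0n mul0r mulr0.
  rewrite patchE mem_set //; have z0 := Cz Cp.
  have s0 := sqnorm_xy_gt0 sn.
  rewrite lee_fin real_normK ?num_real // mulrAC -mulrA psi_dist // mulrCA.
  rewrite /weight; apply: ler_wpM2l (sqr_ge0 _) _ _ _; rewrite ler_pM2l //.
  by rewrite ler_piMl ?eta_le1 // ltW // fieldA_gt0.
Qed.

Lemma hardy_rhs_gt0 : u <> cst 0 -> (0 < hardy_rhs C u)%E.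
Proof.
move=> un0; have [p0 up0] : exists p, u p != 0.
  apply: contrapT => H; apply: un0; apply/funext => p.
  by apply/eqP; apply/negPn/negP => up; apply: H; exists p.
have uc : continuous u by move=> p; exact: differentiable_continuous (su [::] p).
have [p1 up1 s1] : exists2 p, u p != 0 & 0 < sqnorm_xy p.
  have := sqnorm_xy_ge0 p0; rewrite le_eqVlt => /predU1P[s0|s0]; last by exists p0.
  have : \forall q \near p0, u q != 0 by exact: (cvgr_neq0 _ (uc p0)).
  move=> /nbhs_ballP[e /= e0 He].
  pose d := e / 2; have d0 : 0 < d by rewrite divr_gt0.
  (* A point of the center is pushed off it, within the ball where [u] does not vanish. *)
  pose w : heis R n := (\row_(i < n) d, 0, 0).
  have sw : sqnorm_xy (p0 + w) = n%:R * d ^+ 2.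
    have x0 : forall i, hx i p0 = 0.
      move=> i; move/esym/eqP: s0; rewrite sqnorm_xyE psumr_eq0 => [/allP H|j _]; last first.
        by rewrite addr_ge0 // sqr_ge0.
      have := H i; rewrite mem_index_enum => /(_ isT).
      by rewrite paddr_eq0 ?sqr_ge0 // !sqrf_eq0 => /andP[/eqP].
    have y0 : forall i, hy i p0 = 0.
      move=> i; move/esym/eqP: s0; rewrite sqnorm_xyE psumr_eq0 => [/allP H|j _]; last first.
        by rewrite addr_ge0 // sqr_ge0.
      have := H i; rewrite mem_index_enum => /(_ isT).
      by rewrite paddr_eq0 ?sqr_ge0 // !sqrf_eq0 => /andP[_ /eqP].
    rewrite sqnorm_xyE (eq_bigr (fun=> d ^+ 2)) => [|i _].
      by rewrite sumr_const card_ord mulr_natl.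
    have := x0 i; have := y0 i; rewrite /hx /hy /= !mxE => -> ->.
    by rewrite !add0r expr0n addr0.
  exists (p0 + w); last by rewrite sw mulr_gt0 ?ltr0n // exprn_gt0.
  apply: He; rewrite -ball_normE /ball_ /= opprD addNKr normrN.
  have cw : cube d w.
    have d1 : - d <= 0 <= d by apply/andP; split; lra.
    have d2 : - d <= d <= d by apply/andP; split; lra.
    by split=> [i|i|]; rewrite /hx /hy /hz /= ?mxE in_itv.
  by have := cube_norm cw; rewrite max_r ?(ltW d0) // /d => H; lra.
have z1 : 0 < hz p1.
  rewrite ltNge; apply/negP => /zu/nbhs_singleton up; by rewrite up eqxx in up1.
(* Makes the cutoff positive at [p1]. *)
have [N N1] : exists N, 1 < N%:R * sqnorm_xy p1.
  exists (Num.bound (sqnorm_xy p1)^-1); rewrite -ltr_pdivrMr // div1r.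
  by apply: archi_boundP; rewrite invr_ge0 ltW.
apply: lt_le_trans (hardy_rhs_ge_weight N).
apply: (@continuous_gt0_integral (fun p => 2 * weight u N p) p1).
- by move=> p; apply: cvgM; [exact: cvg_cst|exact: weight_continuous].
- by move=> p; rewrite mulr_ge0 // weight_ge0.
- rewrite mulr_gt0 // /weight mulr_gt0 //; first by rewrite lt_neqAle sqr_ge0 eq_sym sqrf_eq0 up1.
  by rewrite mulr_gt0 ?fieldA_gt0 // /eta /cutoff bumpe_gt0 // subr_gt0.
Qed.

(** The difference is [2 sin ^ 2 t (t + sin t cos t) / (s t (t - sin t cos t))], a quotient of
    nonnegative quantities. The bound does not degenerate on the center. *)
Lemma fieldA_le p : 0 < sqnorm_xy p -> 0 < hz p -> 2 * fieldA p <= (hz p)^-1.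
Proof.
move=> s0 z0; have tin := th_itv s0 z0; have [t0 _] := andP tin.
have st := sin_gt0_pi tin; have dt := sincos_lt t0.
rewrite (hzE s0 z0) /fieldA -subr_ge0.
have -> : (sqnorm_xy p * (th p - sin (th p) * cos (th p)) / (4 * sin (th p) ^+ 2))^-1 -
    2 * (sin (th p) ^+ 2 / (th p * sqnorm_xy p)) =
  2 * sin (th p) ^+ 2 * (th p + sin (th p) * cos (th p)) /
   (sqnorm_xy p * th p * (th p - sin (th p) * cos (th p))).
  by field; rewrite !gt_eqF // subr_gt0.
have h1 : 0 <= th p + sin (th p) * cos (th p).
  by have := sin_le_id (ltW t0); have := cos_geN1 (th p); nra.
apply: divr_ge0; first exact: mulr_ge0 (mulr_ge0 (ler0n _ _) (sqr_ge0 _)) h1.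
apply: mulr_ge0 (mulr_ge0 (ltW s0) (ltW t0)) _.
by rewrite subr_ge0 ltW.
Qed.

(** By [fieldA_le] the integrand is dominated by [u ^ 2 / z], which is continuous with bounded
    support because [u] vanishes near [z <= 0]. *)
Lemma hardy_rhs_lty : (hardy_rhs C u < +oo)%E.
Proof.
pose b p := u p ^+ 2 * (hz p)^-1.
have bC1 p : C1d 0 b p.
  have [z0|z0] := leP (hz p) 0.
    apply: (C1d_near (F := fun _ => 0)); last exact: C1d_cst.
    by apply: filterS (zu z0) => q uq; rewrite /b uq expr0n mul0r.
  apply: C1dM; first by apply: C1dX; exact: smooth_C1d.
  by apply: C1dV; [rewrite gt_eqF|exact: C1d_hz].
have bc : continuous b by move=> p; have [] := bC1 p.
have bi := continuous_bounded_support_integrable bc (bounded_support_cut bu (fun q => (hz q)^-1)).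
have b0 p : 0 <= b p.
  have [z0|z0] := leP (hz p) 0; first by rewrite /b (nbhs_singleton (zu z0)) expr0n mul0r.
  by rewrite mulr_ge0 ?sqr_ge0 // invr_ge0 ltW.
apply: (@le_lt_trans _ _ (\int[mu]_p (b p)%:E)%E).
  rewrite /hardy_rhs [leLHS]integral_mkcond.
  apply: (ge0_ae_le_integral_lower (center_negligible n0)) => [p _|p _|p _ sn].
  - exact: hardy_rhs_integrand_ge0.
  - by rewrite lee_fin.
  - rewrite patchE; case: ifPn => [/set_mem Cp|_]; last by rewrite lee_fin.
    have z0 := Cz Cp; have s0 := sqnorm_xy_gt0 sn.
    rewrite lee_fin real_normK ?num_real // mulrAC -mulrA psi_dist //.
    by apply: ler_wpM2l (sqr_ge0 _) _ _ _; exact: fieldA_le.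
by rewrite ltey_eq (integrable_fin_num measurableT bi).
Qed.

End fixed_function.

End test_functions_on_cones.

(** * A class of smooth functions *)

Section smooth_functions.
Context {R : realType} {n : nat}.

(* An inductive class of functions closed under directional derivatives; all
   its members are therefore smooth. *)
Inductive elementary : (heis R n -> R) -> Prop :=
| elem_cst c : elementary (fun _ => c)
| elem_hx i : elementary (hx i)
| elem_hy i : elementary (hy i)
| elem_hz : elementary hz
| elem_add f g : elementary f -> elementary g -> elementary (fun p => f p + g p)
| elem_mul f g : elementary f -> elementary g -> elementary (fun p => f p * g p)
| elem_inv f : (forall p, f p != 0) -> elementary f -> elementary (fun p => (f p)^-1)
| elem_exp f : elementary f -> elementary (fun p => expR (f p))
| elem_ln f : (forall p, 0 < f p) -> elementary f -> elementary (fun p => ln (f p))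
| elem_bump k f : elementary f -> elementary (fun p => bumpe k (f p)).

Lemma differentiable_compR (h : R -> R) (h' : R) (f : heis R n -> R) p :
  is_derive (f p) (1 : R) h h' -> differentiable f p ->
  differentiable (fun q => h (f q)) p.
Proof.
move=> [dh _] df; apply: (@differentiable_comp _ _ _ _ f h) => //.
exact/derivable1_diffP.
Qed.

Lemma elementary_differentiable f p : elementary f -> differentiable f p.
Proof.
elim=> {f}.
- by move=> c; exact: differentiable_cst.
- move=> i; pose l : {linear heis R n -> R} :=
    HB.pack (hx i : heis R n -> R) (GRing.isLinear.Build R _ R _ (hx i) (hx_linear i)).
  by apply: (@linear_differentiable _ _ _ l); exact: hx_continuous.
- move=> i; pose l : {linear heis R n -> R} :=
    HB.pack (hy i : heis R n -> R) (GRing.isLinear.Build R _ R _ (hy i) (hy_linear i)).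
  by apply: (@linear_differentiable _ _ _ l); exact: hy_continuous.
- pose l : {linear heis R n -> R} :=
    HB.pack (hz : heis R n -> R) (GRing.isLinear.Build R _ R _ hz hz_linear).
  by apply: (@linear_differentiable _ _ _ l); exact: hz_continuous.
- by move=> f g _ df _ dg; exact: differentiableD.
- by move=> f g _ df _ dg; exact: differentiableM.
- move=> f f0 _ df; apply: (differentiable_compR _ df).
  exact: (@is_deriveVL R R id (f p) 1 1 (f0 p) (is_derive_id _ _)).
- by move=> f _ df; exact: (differentiable_compR (is_derive_expR _) df).
- by move=> f f0 _ df; exact: (differentiable_compR (is_derive1_ln (f0 p)) df).
- by move=> k f _ df; exact: (differentiable_compR (is_derive_bumpe k _) df).
Qed.

Lemma elementary_is_derive f p v : elementary f -> is_derive p v f ('D_v f p).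
Proof.
move=> ef; apply: DeriveDef => //; apply: diff_derivable.
exact: elementary_differentiable.
Qed.

Lemma elementary_derive f v : elementary f -> elementary ('D_v f).
Proof.
elim=> {f}.
- move=> c; rewrite (_ : 'D_v _ = fun=> 0); first exact: elem_cst.
  by apply/funext => p; exact: (@derive_val _ _ _ _ _ _ _ (is_derive_cstL c p v)).
- move=> i; rewrite (_ : 'D_v _ = fun=> hx i v); first exact: elem_cst.
  by apply/funext => p; exact: (@derive_val _ _ _ _ _ _ _ (is_derive_hx i (is_derive_id p v))).
- move=> i; rewrite (_ : 'D_v _ = fun=> hy i v); first exact: elem_cst.
  by apply/funext => p; exact: (@derive_val _ _ _ _ _ _ _ (is_derive_hy i (is_derive_id p v))).
- rewrite (_ : 'D_v _ = fun=> hz v); first exact: elem_cst.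
  by apply/funext => p; exact: (@derive_val _ _ _ _ _ _ _ (is_derive_hz (is_derive_id p v))).
- move=> f g ef IHf eg IHg.
  have Df p := elementary_is_derive p v ef; have Dg p := elementary_is_derive p v eg.
  rewrite (_ : 'D_v _ = fun p => 'D_v f p + 'D_v g p); first exact: elem_add IHf IHg.
  by apply/funext => p; exact: (@derive_val _ _ _ _ _ _ _ (is_deriveDL (Df p) (Dg p))).
- move=> f g ef IHf eg IHg.
  have Df p := elementary_is_derive p v ef; have Dg p := elementary_is_derive p v eg.
  rewrite (_ : 'D_v _ = fun p => 'D_v f p * g p + f p * 'D_v g p); last first.
    by apply/funext => p; exact: (@derive_val _ _ _ _ _ _ _ (is_deriveML (Df p) (Dg p))).
  by apply: elem_add; apply: elem_mul.
- move=> f f0 ef IHf; have Df p := elementary_is_derive p v ef.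
  rewrite (_ : 'D_v _ = fun p => (-1) * ((f p)^-1 * (f p)^-1) * 'D_v f p); last first.
    apply/funext => p; rewrite (@derive_val _ _ _ _ _ _ _ (is_deriveVL (f0 p) (Df p))).
    by rewrite expr2 invfM mulN1r.
  apply: elem_mul; last exact: IHf.
  by apply: elem_mul; [exact: elem_cst|apply: elem_mul; exact: elem_inv].
- move=> f ef IHf; have Df p := elementary_is_derive p v ef.
  rewrite (_ : 'D_v _ = fun p => expR (f p) * 'D_v f p); last first.
    by apply/funext => p; exact: (@derive_val _ _ _ _ _ _ _ (is_derive_compL (is_derive_expR _) (Df p))).
  by apply: elem_mul; [exact: elem_exp|exact: IHf].
- move=> f f0 ef IHf; have Df p := elementary_is_derive p v ef.
  rewrite (_ : 'D_v _ = fun p => (f p)^-1 * 'D_v f p); last first.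
    by apply/funext => p; exact: (@derive_val _ _ _ _ _ _ _ (is_derive_compL (is_derive1_ln (f0 p)) (Df p))).
  apply: elem_mul; last exact: IHf.
  by apply: elem_inv => // p; rewrite gt_eqF.
- move=> k f ef IHf; have Df p := elementary_is_derive p v ef.
  rewrite (_ : 'D_v _ = fun p => (bumpe k.+2 (f p) + (- k%:R) * bumpe k.+1 (f p)) * 'D_v f p); last first.
    apply/funext => p; rewrite mulNr.
    exact: (@derive_val _ _ _ _ _ _ _ (is_derive_compL (is_derive_bumpe k _) (Df p))).
  apply: elem_mul; last exact: IHf.
  apply: elem_add; first exact: elem_bump.
  by apply: elem_mul; [exact: elem_cst|exact: elem_bump].
Qed.

Lemma elementary_smooth f : elementary f -> smooth f.
Proof.
move=> ef s p; apply: elementary_differentiable.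
by elim: s => [//|v s IH]; exact: elementary_derive.
Qed.

Lemma elem_sum m (f : 'I_m -> heis R n -> R) :
  (forall i, elementary (f i)) -> elementary (fun p => \sum_i f i p).
Proof.
elim: m f => [|m IH] f ef; first by under eq_fun do rewrite big_ord0; exact: elem_cst.
by under eq_fun do rewrite big_ord_recl; apply: elem_add => //; exact: IH.
Qed.

Lemma elem_sqnorm_xy : elementary (@sqnorm_xy R n).
Proof.
rewrite (_ : @sqnorm_xy R n = fun p => \sum_i (hx i p * hx i p + hy i p * hy i p)).
  apply: (elem_sum (f := fun i p => hx i p * hx i p + hy i p * hy i p)) => i.
  by apply: elem_add; apply: elem_mul; solve [exact: elem_hx|exact: elem_hy].
by apply/funext => p; apply: eq_bigr => i _; rewrite !expr2.
Qed.

End smooth_functions.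

(** * The nearly extremal functions *)

Section extremal_profile.
Context {R : realType} {n : nat}.
Implicit Types (p v : heis R n).

(** Young's inequality with a parameter: the main term loses only the factor [1 + tau]. *)
Lemma sqrB_le (tau x y : R) : 0 < tau ->
  (x - y) ^+ 2 <= (1 + tau) * x ^+ 2 + (1 + tau^-1) * y ^+ 2.
Proof.
move=> t0; rewrite -subr_ge0.
have -> : (1 + tau) * x ^+ 2 + (1 + tau^-1) * y ^+ 2 - (x - y) ^+ 2 =
  (tau * x + y) ^+ 2 / tau by field; rewrite gt_eqF.
by rewrite divr_ge0 ?sqr_ge0 // ltW.
Qed.

Lemma subr_sincos_le (t t' : R) : 0 < t -> t <= t' ->
  t - sin t * cos t <= t' - sin t' * cos t'.
Proof.
move=> t0; rewrite le_eqVlt => /predU1P[->//|tt'].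
have D (x : R) : is_derive x (1 : R) (fun t => t - sin t * cos t) (2 * sin x ^+ 2).
  by der; have := cos2Dsin2 x; nra.
have [c _ E] := mvt tt' (fun x _ => D x).
by rewrite -subr_ge0 E mulr_ge0 ?subr_ge0 ?(ltW tt') // mulr_ge0 // sqr_ge0.
Qed.

Lemma theta1_gt0 : 0 < theta (1 : R).
Proof. by have [/andP[]] := @thetaP R 1 ltr01. Qed.

Lemma th_ge p : 0 < sqnorm_xy p -> 0 < hz p -> sqnorm_xy p <= hz p ->
  theta (1 : R) <= th p.
Proof.
by move=> s0 z0 sz; apply: theta_le; rewrite ?divr_gt0 // ler_pdivrMr // mul1r.
Qed.

(** Written as [(t - sin t cos t) / (4 t z)], the coefficient [A] is at least this constant when
    [s <= z <= 2]: then [t >= theta 1], the numerator increases with [t], and [t z <= 2 pi]. *)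
Definition fieldA_lower : R :=
  let t := theta (1 : R) in (t - sin t * cos t) / (8 * pi).

Lemma fieldA_lower_gt0 : 0 < fieldA_lower.
Proof.
have t0 := theta1_gt0.
by rewrite divr_gt0 ?subr_gt0 ?sincos_lt // mulr_gt0 // pi_gt0.
Qed.

Lemma fieldA_ge p : 0 < sqnorm_xy p -> 0 < hz p -> sqnorm_xy p <= hz p ->
  hz p <= 2 -> fieldA_lower <= fieldA p.
Proof.
move=> s0 z0 sz z2; have tin := th_itv s0 z0; have [t0 tpi] := andP tin.
have st := sin_gt0_pi tin; have dt := sincos_lt t0.
have t10 := theta1_gt0.
have AE : fieldA p = (th p - sin (th p) * cos (th p)) / (4 * th p * hz p).
  rewrite [in RHS](hzE s0 z0) /fieldA.
  by field; rewrite !gt_eqF // subr_gt0.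
rewrite AE /fieldA_lower.
have h1 := subr_sincos_le t10 (th_ge s0 z0 sz).
have h2 := sincos_lt t10.
have p8 : 0 < 8 * pi :> R by rewrite mulr_gt0 // pi_gt0.
have p4 : 0 < 4 * th p * hz p.
  by apply: mulr_gt0 z0; apply: mulr_gt0 t0.
apply: ler_pM; [by rewrite subr_ge0 ltW|by rewrite invr_ge0 ltW|exact: h1|].
by rewrite lef_pV2 ?posrE //; have := mulr_gt0 t0 z0; have := pi_gt0 R; nra.
Qed.

Variables (e s1 : R).
Hypotheses (e0 : 0 < e) (s10 : 0 < s1) (s11 : s1 <= 1).

(* [s ^ (- n / 2)] would be extremal but has infinite energy; [e] regularizes it. *)
Definition peak p : R := expR (- (n%:R / 2) * ln (sqnorm_xy p + e)).
(** Together with [bz], confines the support to [s <= s1] and [1 <= z <= 2], a set inside the cone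
    when [s1] is chosen as in [homogeneous_cone_slab]. *)
Definition bs p : R := bumpe 0 (s1 - sqnorm_xy p).
Definition bz p : R := bumpe 0 (hz p - 1) * bumpe 0 (2 - hz p).
Definition profile p : R := peak p * bs p * bz p.

Lemma se_gt0 p : 0 < sqnorm_xy p + e.
Proof. by rewrite ltr_wpDl // sqnorm_xy_ge0. Qed.

Lemma peak_gt0 p : 0 < peak p. Proof. exact: expR_gt0. Qed.

Lemma peak_sqr p : peak p ^+ 2 = (sqnorm_xy p + e) ^- n.
Proof.
rewrite /peak -expRM_natl.
have -> : 2%:R * (- (n%:R / 2) * ln (sqnorm_xy p + e)) = - (n%:R * ln (sqnorm_xy p + e)).
  by field.
by rewrite expRN expRM_natl lnK // posrE se_gt0.
Qed.

Lemma profile_elementary : elementary profile.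
Proof.
have es := @elem_sqnorm_xy R n.
apply: elem_mul; first apply: elem_mul.
- apply: elem_exp; apply: elem_mul; first exact: elem_cst.
  apply: (elem_ln (f := fun p => sqnorm_xy p + e)); first exact: se_gt0.
  by apply: elem_add => //; exact: elem_cst.
- apply: (elem_bump 0 (f := fun p => s1 - sqnorm_xy p)).
  apply: elem_add; first exact: elem_cst.
  rewrite (_ : (fun p => - sqnorm_xy p) = fun p => (-1) * sqnorm_xy p).
    by apply: elem_mul => //; exact: elem_cst.
  by apply/funext => p; rewrite mulN1r.
- apply: elem_mul.
    apply: (elem_bump 0 (f := fun p => hz p - 1)).
    by apply: elem_add; [exact: elem_hz|exact: elem_cst].
  apply: (elem_bump 0 (f := fun p => 2 - hz p)).
  apply: elem_add; first exact: elem_cst.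
  rewrite (_ : (fun p => - hz p) = fun p => (-1) * hz p).
    by apply: elem_mul; [exact: elem_cst|exact: elem_hz].
  by apply/funext => p; rewrite mulN1r.
Qed.

Definition us p : R :=
  - (peak p * ((n%:R / 2) / (sqnorm_xy p + e) * bs p + bumpe 2 (s1 - sqnorm_xy p)) * bz p).
Definition dbz p : R := bumpe 2 (hz p - 1) * bumpe 0 (2 - hz p) -
  bumpe 0 (hz p - 1) * bumpe 2 (2 - hz p).
Definition uz p : R := peak p * bs p * dbz p.

Lemma profile_derive p : is_derive_sz profile p (us p) (uz p).
Proof.
move=> v; have Ds := is_derive_sqnorm_xy (is_derive_id p v).
have Dz := is_derive_hz (is_derive_id p v).
have se0 := se_gt0 p.
move: Ds; set S := (2 * _) => Ds.
have Dse : is_derive p v (fun q => sqnorm_xy q + e) S.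
  by der; rewrite addr0.
have D1 : is_derive p v peak (- (n%:R / 2) * peak p / (sqnorm_xy p + e) * S).
  have Dln := @is_derive_compL _ _ _ (fun q : heis R n => sqnorm_xy q + e) _ _ _ _ (is_derive1_ln se0) Dse.
  by rewrite /peak; der; field; rewrite gt_eqF.
have D2 : is_derive p v bs (- bumpe 2 (s1 - sqnorm_xy p) * S).
  have D : is_derive p v (fun q => s1 - sqnorm_xy q) (- S) by der; rewrite add0r.
  have := @is_derive_compL _ _ _ (fun q : heis R n => s1 - sqnorm_xy q) _ _ _ _ (is_derive_bumpe0 _) D.
  by rewrite mulrN mulNr.
have D3 : is_derive p v bz (dbz p * hz v).
  have Da : is_derive p v (fun q => hz q - 1) (hz v) by der; rewrite subr0.
  have Db : is_derive p v (fun q => 2 - hz q) (- hz v) by der; rewrite add0r.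
  have Dba := @is_derive_compL _ _ _ (fun q : heis R n => hz q - 1) _ _ _ _ (is_derive_bumpe0 _) Da.
  have Dbb := @is_derive_compL _ _ _ (fun q : heis R n => 2 - hz q) _ _ _ _ (is_derive_bumpe0 _) Db.
  by rewrite /bz; der; rewrite /dbz; ring.
rewrite /profile; der; rewrite /us /uz.
move: (peak p) (bs p) (bz p) (dbz p) (bumpe 2 _) => a b c d f.
by field; rewrite gt_eqF.
Qed.

Lemma bumpe0_itv (t : R) : 0 <= bumpe 0 t <= 1.
Proof. by rewrite bumpe_ge0 bumpe0_le1. Qed.
Lemma bumpe2_itv (t : R) : 0 <= bumpe 2 t <= 4.
Proof. by rewrite bumpe_ge0 bumpe2_le. Qed.

Lemma bz_itv p : 0 <= bz p <= 1.
Proof.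
have /andP[a0 a1] := bumpe0_itv (hz p - 1); have /andP[b0 b1] := bumpe0_itv (2 - hz p).
by rewrite mulr_ge0 //= mulr_ile1.
Qed.

Lemma dbz_sqr p : dbz p ^+ 2 <= 16.
Proof.
have /andP[a0 a1] := bumpe0_itv (hz p - 1); have /andP[b0 b1] := bumpe0_itv (2 - hz p).
have /andP[c0 c1] := bumpe2_itv (hz p - 1); have /andP[d0 d1] := bumpe2_itv (2 - hz p).
rewrite /dbz; set x := bumpe 2 _ * bumpe 0 _; set y := bumpe 0 _ * bumpe 2 _.
have x4 : 0 <= x <= 4 by rewrite mulr_ge0 //=; have := ler_pM c0 b0 c1 b1; rewrite mulr1.
have y4 : 0 <= y <= 4 by rewrite mulr_ge0 //=; have := ler_pM a0 d0 a1 d1; rewrite mul1r.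
by case/andP: x4 => ? ?; case/andP: y4 => ? ?; nra.
Qed.

Definition region p : bool := (sqnorm_xy p <= s1) && (1 <= hz p <= 2).

(** The terms with [16] and with [2 / theta 1] come from the derivatives of the cutoffs in [s] and
    in [z], bounded through [bumpe 2 t <= 4]; the factors in [tau] come from two uses of
    [sqrB_le]. *)
Definition err_const (tau : R) : R := (1 + tau^-1) * (16 * (1 + tau) + 2 / theta (1 : R)).

Lemma err_const_gt0 (tau : R) : 0 < tau -> 0 < err_const tau.
Proof.
move=> t0; have t10 := theta1_gt0.
have ti0 : 0 < tau^-1 by rewrite invr_gt0.
by apply: mulr_gt0; apply: addr_gt0 => //; [apply: mulr_gt0 => //; exact: addr_gt0|exact: divr_gt0].
Qed.

Lemma profile_outside p : ~~ region p -> us p = 0 /\ uz p = 0.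
Proof.
rewrite /region !negb_and -!ltNge => /orP[s1p|/orP[z1|z2]].
- rewrite /us /uz /bs !bumpe_le0 ?mulr0 ?addr0 ?mul0r ?mulr0 ?mul0r ?oppr0 //;
  by rewrite subr_le0 ltW.
- rewrite /us /uz /bz /dbz !(bumpe_le0 _ (_ : hz p - 1 <= 0)) ?subr_le0 ?ltW //.
  by rewrite !mul0r subr0 !mulr0 oppr0.
- rewrite /us /uz /bz /dbz !(bumpe_le0 _ (_ : 2 - hz p <= 0)) ?subr_le0 ?ltW //.
  by rewrite !mulr0 subr0 !mulr0 oppr0.
Qed.

(** [sqrB_le] separates the derivative of [peak] from the derivative in [z] and from that of the
    cutoff in [s]. The main term keeps the sharp constant because [s / (s + e) <= 1], while the
    errors carry an extra factor [s], which makes them small compared with [peak ^ 2] near the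
    center. *)
Lemma profile_upper (tau : R) p : 0 < tau -> 0 < sqnorm_xy p -> 0 < hz p ->
  hnorm (hgrad_perp profile p) ^+ 2 / psi p <=
  (1 + tau) ^+ 2 * (n%:R ^+ 2 / 4) * (2 * (profile p ^+ 2 * fieldA p)) +
  err_const tau * (sqnorm_xy p * peak p ^+ 2) * (region p)%:R.
Proof.
move=> t0 s0 z0; rewrite (hnorm_perp_sz s0 z0 (profile_derive p)) psiE.
have A0 := fieldA_gt0 s0 z0.
have tin := th_itv s0 z0; have [th0 thpi] := andP tin.
have t10 := theta1_gt0.
have ti0 : 0 < tau^-1 by rewrite invr_gt0.
have [reg|nreg] := boolP (region p); last first.
  have [-> ->] := profile_outside nreg.
  rewrite !(mulr0, mul0r) subr0 expr0n /= !(mulr0, mul0r) addr0.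
  exact: mulr_ge0 (mulr_ge0 (sqr_ge0 _) (divr_ge0 (sqr_ge0 _) (ler0n _ _)))
    (mulr_ge0 (ler0n _ _) (mulr_ge0 (sqr_ge0 _) (ltW A0))).
rewrite mulr1; have /and3P[ss1 z1 z2] := reg.
have sle1 : sqnorm_xy p <= 1 := le_trans ss1 s11.
(* In [region] both [A] and [1 / t] are bounded, because [s <= 1 <= z]. *)
have A1 : 2 * fieldA p <= 1.
  by apply: le_trans (fieldA_le s0 z0) _; rewrite invf_le1.
have tht : theta (1 : R) <= th p by apply: th_ge => //; exact: le_trans sle1 z1.
have AE : fieldA p = sin (th p) ^+ 2 / (th p * sqnorm_xy p) by [].
have g0 := peak_gt0 p; have /andP[b0 b1] := bumpe0_itv (s1 - sqnorm_xy p).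
have /andP[f0 f4] := bumpe2_itv (s1 - sqnorm_xy p).
have /andP[h0 h1] := bz_itv p; have d16 := dbz_sqr p; have c1 := cos_max (th p).
have sep := se_gt0 p.
rewrite /profile /us /uz /err_const -/(bs p) in b0 b1 *.
move: (fieldA p) (th p) (sin (th p)) (cos (th p)) (sqnorm_xy p) (peak p) (bs p)
  (bumpe 2 _) (bz p) (dbz p) (theta 1) AE A0 A1 c1 th0 tht t10 s0 sle1 sep g0 b0 b1 f0 f4
  h0 h1 d16 {tin thpi z0 reg ss1 z1 z2}.
move=> A t S c s g b f h d t1 AE A0 A1 c1 th0 tht t10 s0 sle1 sep g0 b0 b1 f0 f4 h0 h1 d16.
set nu := n%:R / 2; have nu0 : 0 <= nu by rewrite divr_ge0.
set u_s := - (g * (nu / (s + e) * b + f) * h); set u_z := g * b * d.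
have c2 : c ^+ 2 <= 1 by rewrite -real_normK ?num_real // expr_le1 ?normr_ge0.
have L1 : s * (2 * u_s * S - u_z / 2 * c) ^+ 2 / (2 * t) <=
    (1 + tau) * (2 * A * (s * u_s) ^+ 2) + (1 + tau^-1) * (s * (u_z * c) ^+ 2 / (8 * t)).
  have -> : (1 + tau) * (2 * A * (s * u_s) ^+ 2) + (1 + tau^-1) * (s * (u_z * c) ^+ 2 / (8 * t)) =
    s * ((1 + tau) * (2 * u_s * S) ^+ 2 + (1 + tau^-1) * (u_z / 2 * c) ^+ 2) / (2 * t).
    by rewrite AE; field; rewrite !gt_eqF.
  rewrite ler_pM2r ?invr_gt0 ?mulr_gt0 // ler_pM2l //.
  exact: sqrB_le.
have r01 : 0 <= s / (s + e) <= 1.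
  by rewrite divr_ge0 ?(ltW s0) ?(ltW sep) //= ler_pdivrMr // mul1r lerDl ltW.
have L2 : (s * u_s) ^+ 2 <= g ^+ 2 * h ^+ 2 * ((1 + tau) * (nu * b) ^+ 2 + (1 + tau^-1) * (16 * s)).
  have -> : (s * u_s) ^+ 2 = g ^+ 2 * h ^+ 2 * (nu * (s / (s + e)) * b - (- (s * f))) ^+ 2.
    by rewrite /u_s; field; rewrite gt_eqF.
  apply: ler_wpM2l; first by rewrite mulr_ge0 ?sqr_ge0.
  apply: le_trans (sqrB_le _ _ t0) _; apply: lerD; apply: ler_wpM2l; rewrite ?addr_ge0 ?(ltW t0) ?(ltW ti0) //.
    case/andP: r01 => r0 r1; have nb : 0 <= nu * b by rewrite mulr_ge0.
    rewrite mulrAC; move: (nu * b) nb (s / (s + e)) r0 r1 => x x0 r r0 r1.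
    by rewrite lerXn2r ?nnegrE ?mulr_ge0 // ler_piMr.
  rewrite sqrrN exprMn; have f16 : f ^+ 2 <= 16 by nra.
  have s2 : s ^+ 2 <= s by nra.
  have := ler_pM (sqr_ge0 s) (sqr_ge0 f) s2 f16; by rewrite [s * 16]mulrC.
have L3 : (u_z * c) ^+ 2 <= 16 * g ^+ 2.
  have -> : (u_z * c) ^+ 2 = g ^+ 2 * (b ^+ 2 * (d ^+ 2 * c ^+ 2)) by rewrite /u_z; ring.
  rewrite mulrC; apply: ler_wpM2r; first exact: sqr_ge0.
  have b2 : b ^+ 2 <= 1 by rewrite expr_le1.
  have dc := ler_pM (sqr_ge0 d) (sqr_ge0 c) d16 c2.
  by have := ler_pM (sqr_ge0 b) (mulr_ge0 (sqr_ge0 d) (sqr_ge0 c)) b2 dc; rewrite mul1r mulr1.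
apply: le_trans L1 _.
have -> : (1 + tau) ^+ 2 * (n%:R ^+ 2 / 4) * (2 * ((g * b * h) ^+ 2 * A)) +
    (1 + tau^-1) * (16 * (1 + tau) + 2 / t1) * (s * g ^+ 2) =
  (1 + tau) * ((1 + tau) * (nu ^+ 2) * (2 * ((g * b * h) ^+ 2 * A)) + (1 + tau^-1) * (16 * s * g ^+ 2)) +
  (1 + tau^-1) * (2 / t1 * (s * g ^+ 2)).
  by rewrite /nu; field; rewrite !gt_eqF.
apply: lerD; apply: ler_wpM2l; rewrite ?addr_ge0 ?(ltW t0) ?(ltW ti0) //.
  have A20 : 0 <= 2 * A by rewrite mulr_ge0 // ltW.
  apply: le_trans (ler_wpM2l A20 L2) _.
  have -> : 2 * A * (g ^+ 2 * h ^+ 2 * ((1 + tau) * (nu * b) ^+ 2 + (1 + tau^-1) * (16 * s))) =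
     (1 + tau) * nu ^+ 2 * (2 * ((g * b * h) ^+ 2 * A)) + (1 + tau^-1) * (16 * s * g ^+ 2) * (2 * A * h ^+ 2).
    by ring.
  rewrite lerD2l ler_piMr //.
    apply: mulr_ge0; first by rewrite addr_ge0 ?(ltW ti0).
    by apply: mulr_ge0 (sqr_ge0 g); rewrite mulr_ge0 ?(ltW s0).
  have h2 : h ^+ 2 <= 1 by rewrite expr_le1.
  by have := ler_pM A20 (sqr_ge0 h) A1 h2; rewrite mulr1.
have H : s * (u_z * c) ^+ 2 / (8 * t) <= s * (16 * g ^+ 2) / (8 * t).
  by rewrite ler_pM2r ?invr_gt0 ?mulr_gt0 // ler_pM2l.
apply: le_trans H _.
have -> : s * (16 * g ^+ 2) / (8 * t) = 2 / t * (s * g ^+ 2) by field; rewrite gt_eqF.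
apply: ler_wpM2r; first by rewrite mulr_ge0 ?sqr_ge0 // ltW.
by rewrite ler_pM2l // lef_pV2.
Qed.

End extremal_profile.

(** * Integral estimates for the sharpness *)

Section sharpness_integrals.
Context {R : realType} {n : nat}.
Local Notation mu := (@lebesgue_heis R n).
Implicit Types (p v : heis R n).

Lemma integral_heis_translation (v : heis R n) (D : set (mheis R n)) (f : mheis R n -> \bar R) :
  measurable D -> measurable_fun D f -> (forall p, (0 <= f p)%E) ->
  (\int[mu]_(p in (fun p : mheis R n => (p + v)%R) @^-1` D) f (p + v)%R = \int[mu]_(p in D) f p)%E.
Proof.
move=> mD mf f0; have mt := measurable_translation v.
have H : {in D, forall p, (0 <= f p)%E} by move=> p _.
have E := @ge0_integral_pushforward _ _ _ _ R _ mt mu D f mD mf H.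
apply: etrans (esym E) _.
by apply: (@eq_measure_integral _ _ _ _ mu) => A mA _; exact: lebesgue_heis_translation.
Qed.

Section upper_bound.
Variables (u g : heis R n -> R) (C : set (heis R n)) (a : R).
Hypothesis Cz : forall p, C p -> 0 < hz p.
Hypothesis tu : test_function C u.
Hypothesis n0 : (0 < n)%N.
Hypothesis a0 : 0 <= a.
Hypothesis g0 : forall p, 0 <= g p.
Hypothesis mg : measurable_fun [set: mheis R n] (g : mheis R n -> R).

(** The limit [W] of the cut-off weights is measurable and agrees on [C], off the center, with the
    integrand of [hardy_rhs]. Additivity of the integral is used for [W]; the remaining steps are
    comparisons. *)
Lemma hardy_lhs_le :
  (forall p, 0 < sqnorm_xy p -> 0 < hz p ->
    hnorm (hgrad_perp u p) ^+ 2 / psi p <= a * (2 * (u p ^+ 2 * fieldA p)) + g p) ->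
  (hardy_lhs C u <= a%:E * hardy_rhs C u + \int[mu]_p (g p)%:E)%E.
Proof.
move=> H.
have su : smooth u by case: tu.
have bu := test_function_bounded_support tu.
have zu p : hz p <= 0 -> \forall q \near p, u q = 0.
  by move=> z0; apply: (test_function_notin tu) => /Cz; rewrite ltNge z0.
pose w N p := (2 * weight u N p)%:E.
have w0 N p : (0 <= w N p)%E by rewrite lee_fin mulr_ge0 // weight_ge0.
have wd p : {homo w ^~ p : m k / (m <= k)%N >-> (m <= k)%E}.
  by move=> m k mk; rewrite lee_fin ler_pM2l // weight_nondecreasing.
have mw N : measurable_fun [set: mheis R n] (w N : mheis R n -> \bar R).
  apply/measurable_EFinP; apply: continuous_measurable_heis => p.
  by apply: cvgM; [exact: cvg_cst|exact: weight_continuous].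
pose W p := limn (w ^~ p).
have W0 p : (0 <= W p)%E.
  by apply: lime_ge; [apply: ereal_nondecreasing_is_cvgn; exact: wd|apply: nearW => N].
have WE p : 0 < sqnorm_xy p -> W p = (2 * (u p ^+ 2 * fieldA p))%:E.
  move=> s0; apply/cvg_lim => //; apply: cvg_EFin; first exact: nearW.
  by apply: cvgM; [exact: cvg_cst|exact: weight_cvg].
have mW : measurable_fun [set: mheis R n] (W : mheis R n -> \bar R).
  have := @emeasurable_fun_cvg _ _ _ [set: mheis R n] w W mw.
  apply => p _; apply: ereal_nondecreasing_is_cvgn; exact: wd.
have IW : (\int[mu]_p W p <= hardy_rhs C u)%E.
  rewrite /W monotone_convergence //.
  apply: lime_le; last by apply: nearW => N; exact: hardy_rhs_ge_weight.
  by apply: ereal_nondecreasing_is_cvgn => m k mk; apply: ge0_le_integral => // p _; exact: wd.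
apply: (@le_trans _ _ (\int[mu]_p (a%:E * W p + (g p)%:E))%E); last first.
  rewrite ge0_integralD //.
  - by rewrite ge0_integralZl // leeD2r // lee_wpmul2l.
  - by move=> p _; rewrite mule_ge0.
  - exact: measurable_funeM.
  - by move=> p _; rewrite lee_fin.
  - exact/measurable_EFinP.
rewrite /hardy_lhs [leLHS]integral_mkcond.
apply: (ge0_ae_le_integral_lower (center_negligible n0)) => [p _|p _|p _ sn].
- rewrite patchE; case: ifPn => // /set_mem Cp.
  by rewrite lee_fin divr_ge0 ?sqr_ge0 ?psi_posz ?Cz.
- by rewrite adde_ge0 ?mule_ge0 ?lee_fin.
- have [Cp|Cp] := pselect (C p); last first.
    by rewrite patchE memNset // adde_ge0 ?mule_ge0 ?lee_fin.
  rewrite patchE mem_set //; have z0 := Cz Cp.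
  have s0 := sqnorm_xy_gt0 sn.
  by rewrite WE // -EFinM -EFinD lee_fin; exact: H.
Qed.

End upper_bound.

Definition slab (k : R) (i : interval R) : set (heis R n) :=
  [set p | sqnorm_xy p <= k /\ hz p \in i].

Lemma measurable_sqnorm_xy :
  measurable_fun [set: mheis R n] (sqnorm_xy : mheis R n -> R).
Proof. by apply: continuous_measurable_heis; exact: sqnorm_xy_continuous. Qed.

Lemma measurable_slab k i : measurable (slab k i : set (mheis R n)).
Proof.
have -> : slab k i = (setT `&` (sqnorm_xy : mheis R n -> R) @^-1` `]-oo, k]%classic) `&`
   (setT `&` (hz : mheis R n -> R) @^-1` [set` i]).
  by apply/seteqP; split=> p; rewrite /slab /= in_itv /=; [move=> [? ?]|move=> [[_ ?] [_ ?]]].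
apply: measurableI.
  by apply: measurable_sqnorm_xy => //; exact: measurable_itv.
by apply: measurable_hz => //; exact: measurable_itv.
Qed.

Section peak_integrals.
Variables (e s1 : R).
Hypotheses (e0 : 0 < e) (s10 : 0 < s1) (s11 : s1 <= 1).

Let f p : \bar R := (peak e p ^+ 2)%:E.

Let f0 p : (0 <= f p)%E. Proof. by rewrite lee_fin sqr_ge0. Qed.

Lemma peak_continuous : continuous (peak e : heis R n -> R).
Proof.
have E : elementary (peak e : heis R n -> R).
  apply: elem_exp; apply: elem_mul; first exact: elem_cst.
  apply: (elem_ln (f := fun p => sqnorm_xy p + e)); first by move=> p; exact: se_gt0.
  by apply: elem_add; [exact: elem_sqnorm_xy|exact: elem_cst].
by move=> p; exact: differentiable_continuous (elementary_smooth E [::] p).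
Qed.

Lemma measurable_peak_sqr (D : set (mheis R n)) : measurable_fun D (f : mheis R n -> \bar R).
Proof.
apply/measurable_EFinP; apply: measurable_funTS; apply: measurable_funX.
by apply: continuous_measurable_heis; exact: peak_continuous.
Qed.

(** [peak] does not depend on [z], so a vertical translation preserves the integral. *)
Lemma slab_integral_shift (k c : R) (i j : interval R) :
  (forall z : R, (z \in i) = (z + c \in j)) ->
  (\int[mu]_(p in slab k i) f p = \int[mu]_(p in slab k j) f p)%E.
Proof.
move=> ij; pose v : heis R n := (0, 0, c).
have sv p : sqnorm_xy (p + v) = sqnorm_xy p.
  by rewrite /sqnorm_xy; apply: eq_bigr => l _; rewrite /v /= !mxE !addr0.
have fv p : f (p + v) = f p by rewrite /f /peak sv.
have E := @integral_heis_translation v _ f (measurable_slab k j) (@measurable_peak_sqr (slab k j)) f0.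
apply: (etrans _ E).
have -> : (fun p : mheis R n => (p + v)%R) @^-1` slab k j = slab k i.
  by apply/seteqP; split=> p /=; rewrite /slab /= sv ij.
by apply: eq_integral => p _; rewrite fv.
Qed.

(** Each half of [[1, 2]] is translated into [[5 / 4, 7 / 4]], where the cutoffs in [z] are bounded
    below. Errors spread over all heights are thus controlled by the part of the slab that
    [profile_rhs_ge] sees. *)
Lemma peak_integral_le (k : R) : k <= s1 / 2 ->
  (\int[mu]_(p in slab k `[1%R, 2%R]) f p <=
   2%:E * \int[mu]_(p in slab (s1 / 2)%R `[(5 / 4)%R, (7 / 4)%R]) f p)%E.
Proof.
move=> ks.
have -> : slab k `[1, 2] = slab k `[1, 3 / 2] `|` slab k `]3 / 2, 2].
  apply/seteqP; split=> p; rewrite /slab /= !in_itv /=.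
    move=> [-> /andP[z1 z2]]; have [z3|z3] := leP (hz p) (3 / 2).
      by left; rewrite z1.
    by right; rewrite z2.
  by case=> -[-> /andP[z1 z2]]; split=> //; apply/andP; split; lra.
have disj : [disjoint slab k `[1, 3 / 2] & slab k `]3 / 2, 2]].
  apply/disj_setPS => p [] [_]; rewrite /= !in_itv /= => /andP[_ z1] [_ /andP[z2 _]].
  have {}z2 : 3 / 2 < hz p by [].
  by move: z2; rewrite ltNge z1.
have -> := ge0_integral_setU mu (measurable_slab k `[1, 3 / 2]) (measurable_slab k `]3 / 2, 2])
  (@measurable_peak_sqr _) (fun p _ => f0 p) disj.
rewrite (@slab_integral_shift k (1 / 4) `[1, 3 / 2] `[5 / 4, 7 / 4]); last first.
  by move=> z; rewrite !in_itv /=; apply/andP/andP => -[]; split; lra.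
rewrite (@slab_integral_shift k (- (1 / 4)) `]3 / 2, 2] `]5 / 4, 7 / 4]); last first.
  by move=> z; rewrite !in_itv /=; apply/andP/andP => -[]; split; lra.
have -> : (2%:E = 1%:E + 1%:E :> \bar R)%E by rewrite -EFinD.
rewrite ge0_muleDl ?lee_fin // !mul1e; apply: leeD; apply: ge0_subset_integral => //.
all: try exact: measurable_slab.
all: try exact: measurable_peak_sqr.
- by move=> p [sk zi]; split => //; exact: le_trans sk ks.
- move=> p [sk zi]; split => /=; first exact: le_trans sk ks.
  by move: zi; rewrite !in_itv /= => /andP[/ltW -> ->].
Qed.

End peak_integrals.

End sharpness_integrals.

(** * Logarithmic divergence of the integral of [peak ^ 2] *)

Section peak_lower_bound.
Context {R : realType} {n : nat}.
Local Notation mu := (@lebesgue_heis R n).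
Implicit Types (p v : heis R n).
Variable s1 : R.
Hypotheses (s10 : 0 < s1) (s11 : s1 <= 1) (n0 : (0 < n)%N).

(** Small enough for the largest box to lie in [s <= s1 / 2], by [r_small]. *)
Let r : R := s1 / (4 * n%:R).
Let nR0 : 0 < n%:R :> R. Proof. by rewrite ltr0n. Qed.
Let nR1 : 1 <= n%:R :> R. Proof. by rewrite ler1n. Qed.
Let r0 : 0 < r. Proof. by rewrite divr_gt0 ?mulr_gt0. Qed.
Let r_small : n%:R * (2 * r ^+ 2) <= s1 / 2.
Proof.
have -> : n%:R * (2 * r ^+ 2) = s1 / 2 * (s1 / (4 * n%:R)).
  by rewrite /r; field; rewrite gt_eqF.
rewrite ler_piMr ?divr_ge0 ?(ltW s10) // ler_pdivrMr ?mulr_gt0 // mul1r.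
by have := nR1; have := s11; lra.
Qed.

(** Halving the [2 n] horizontal sides divides the measure by [4 ^ n], so [(4 ^ j) ^ n] times the
    indicator of box [j] has an integral independent of [j]. *)
Definition nested_box (j : nat) : set (heis R n) :=
  let I := `[- (r / 2 ^+ j), r / 2 ^+ j]%classic in
  [set p | [/\ forall i, I (hx i p), forall i, I (hy i p) &
    `[5 / 4, 7 / 4]%classic (hz p)]].

Lemma measurable_nested_box j : measurable (nested_box j : set (mheis R n)).
Proof.
have mI (a b : R) : measurable (`[a, b]%classic : set (measurableTypeR R)) by exact: measurable_itv.
exact: (measurable_box (fun=> mI _ _) (fun=> mI _ _) (mI _ _)).
Qed.

Lemma nested_box_measure j :
  mu (nested_box j) = ((2 * (r / 2 ^+ j)) ^+ n * (2 * (r / 2 ^+ j)) ^+ n / 2)%:E.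
Proof.
have mI (a b : R) : measurable (`[a, b]%classic : set (measurableTypeR R)) by exact: measurable_itv.
have -> := lebesgue_heis_box (fun=> mI _ _) (fun=> mI _ _) (mI _ _) : mu (nested_box j) = _.
have q0 : 0 < r / 2 ^+ j by rewrite divr_gt0 // exprn_gt0.
have IE (a b : R) : a < b -> lebesgue_measure (`[a, b]%classic : set (measurableTypeR R)) = (b - a)%:E.
  by move=> ab; rewrite lebesgue_measure_itv /= lte_fin ab.
rewrite !IE; [|lra|lra].
rewrite !prodEFin -!EFinM !prodr_const card_ord.
have -> : r / 2 ^+ j - - (r / 2 ^+ j) = 2 * (r / 2 ^+ j) by ring.
by have -> : 7 / 4 - 5 / 4 = 2^-1 :> R by lra.
Qed.

Lemma nested_box_sqnorm_xy j p : nested_box j p -> sqnorm_xy p <= s1 / 2 / 4 ^+ j.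
Proof.
move=> [px py _]; have q0 : 0 < r / 2 ^+ j by rewrite divr_gt0 // exprn_gt0.
apply: (@le_trans _ _ (\sum_(i < n) (2 * (r / 2 ^+ j) ^+ 2))).
  apply: ler_sum => i _; have := px i; have := py i; rewrite /= !in_itv /= /hx /hy.
  by move=> /andP[a b] /andP[c d]; nra.
rewrite sumr_const card_ord -[X in X <= _]mulr_natl.
have -> : n%:R * (2 * (r / 2 ^+ j) ^+ 2) = n%:R * (2 * r ^+ 2) / 4 ^+ j.
  by rewrite expr_div_n -exprM mulnC exprM (_ : 2 ^+ 2 = 4) ?mulrA //; lra.
by rewrite ler_pM2r // invr_gt0 exprn_gt0.
Qed.

Lemma geometric_sum_le (a : R) k : 2 <= a -> \sum_(j < k.+1) a ^+ j <= 2 * a ^+ k.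
Proof.
move=> a2; elim: k => [|k IH]; first by rewrite big_ord1 expr0; lra.
rewrite big_ord_recr /= exprS; move: IH; set S := \sum_(_ < _) _.
have : 0 <= a ^+ k by rewrite exprn_ge0 //; lra.
by move: (a ^+ k) => x x0 Sx; nra.
Qed.

(* At the point [p] only the boxes with [sqnorm_xy p <= 4 ^- j] contribute, and
   the last of them dominates the sum. *)
Lemma nested_box_sum J p :
  \sum_(j < J) (4 ^+ j) ^+ n * \1_(nested_box j) p <=
  2 * 2 ^+ n * (sqnorm_xy p + 4 ^- J) ^- n.
Proof.
have p40 k : 0 < 4 ^- k :> R by rewrite invr_gt0 exprn_gt0.
have sp k : 0 < sqnorm_xy p + 4 ^- k by rewrite ltr_wpDl // sqnorm_xy_ge0.
elim: J => [|J IH]; first by rewrite big_ord0 divr_ge0 ?mulr_ge0 ?exprn_ge0 // ltW.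
have [pJ|pJ] := pselect (nested_box J p); last first.
  rewrite big_ord_recr /= indicE memNset // mulr0 addr0; apply: le_trans IH _.
  rewrite ler_pM2l ?mulr_gt0 ?exprn_gt0 // lef_pV2 ?posrE ?exprn_gt0 //.
  rewrite lerXn2r ?nnegrE ?(ltW (sp _)) // lerD2l lef_pV2 ?posrE ?exprn_gt0 //.
  by rewrite exprS ler_peMl ?exprn_ge0 //; lra.
apply: (@le_trans _ _ (\sum_(j < J.+1) (4 ^+ n) ^+ j)).
  apply: ler_sum => j _; rewrite -!exprM mulnC indicE.
  by rewrite ler_piMr ?exprn_ge0 //; case: (_ \in _).
have a2 : 2 <= 4 ^+ n :> R.
  by apply: (@le_trans _ _ (4 ^+ 1)); [rewrite expr1; lra|rewrite ler_eXn2l //; lra].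
apply: le_trans (geometric_sum_le _ a2) _; rewrite -mulrA ler_pM2l //.
have sJ : sqnorm_xy p + 4 ^- J.+1 <= 2 * 4 ^- J.
  have := nested_box_sqnorm_xy pJ; rewrite exprS invfM; have := p40 J.
  by move: (4 ^- J) => x x0; have := s11; nra.
apply: (@le_trans _ _ (2 ^+ n * (2 * 4 ^- J) ^- n)).
  rewrite exprMn invfM mulrA mulfV ?mul1r ?expf_neq0 //.
  by rewrite -[X in _ <= X]exprVn invrK -!exprM mulnC.
rewrite ler_pM2l ?exprn_gt0 // lef_pV2 ?posrE ?exprn_gt0 ?mulr_gt0 //.
by rewrite lerXn2r ?nnegrE ?(ltW (sp _)) // mulr_ge0 // ltW.
Qed.

(** The common integral [(2 r) ^ (2 n) / 2] of the weighted boxes, divided by the constant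
    [2 * 2 ^ n] of [nested_box_sum]. *)
Definition peak_lower : R := (2 * r) ^+ n * (2 * r) ^+ n / (4 * 2 ^+ n).

Lemma peak_lower_gt0 : 0 < peak_lower.
Proof.
have p0 : 0 < (2 * r) ^+ n by apply: exprn_gt0; exact: mulr_gt0.
by apply: divr_gt0; [exact: mulr_gt0|apply: mulr_gt0 => //; exact: exprn_gt0].
Qed.

(** With [e = 4 ^- J], each of the [J] scales contributes the same amount, whence the growth in
    [log (1 / e)]; [nested_box_sum] keeps their sum below [peak ^ 2] up to a constant. *)
Lemma peak_integral_ge J :
  ((peak_lower * J%:R)%:E <=
   \int[mu]_(p in slab (s1 / 2)%R `[(5 / 4)%R, (7 / 4)%R]) (peak (4 ^- J)%R p ^+ 2)%:E)%E.
Proof.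
pose c := (2 * 2 ^+ n)^-1 : R.
have c0 : 0 < c by rewrite invr_gt0 mulr_gt0 ?exprn_gt0.
pose g j p := (4 ^+ j) ^+ n * \1_(nested_box j) p : R.
have g0 j p : 0 <= g j p by rewrite mulr_ge0 ?exprn_ge0.
have mg j : measurable_fun setT (g j : mheis R n -> R).
  by apply: measurable_funM => //; apply: measurable_indic; exact: measurable_nested_box.
apply: (@le_trans _ _ (\int[mu]_p (c%:E * \sum_(j < J) (g j p)%:E))%E).
  have mgE j : measurable_fun setT (fun p : mheis R n => (g j p)%:E).
    exact/measurable_EFinP.
  rewrite ge0_integralZl //; [|exact: emeasurable_sum|
    by move=> p _; apply: sume_ge0 => j _; rewrite lee_fin|by rewrite lee_fin ltW].
  rewrite ge0_integral_sum //; last by move=> j p _; rewrite lee_fin.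
  have Ig j : (\int[mu]_p (g j p)%:E = ((2 * r) ^+ n * (2 * r) ^+ n / 2)%:E)%E.
    under eq_integral do rewrite EFinM.
    have mi : measurable_fun setT (fun p : mheis R n => (\1_(nested_box j) p : R)%:E).
      by apply/measurable_EFinP; apply: measurable_indic; exact: measurable_nested_box.
    have i0 p : (0 <= (\1_(nested_box j) p : R)%:E)%E by rewrite lee_fin.
    have k0 : (0 <= ((4 ^+ j) ^+ n)%:E :> \bar R)%E by rewrite lee_fin !exprn_ge0.
    rewrite (ge0_integralZl mu measurableT mi (fun p _ => i0 p) k0).
    rewrite integral_indic //; last exact: measurable_nested_box.
    have E := nested_box_measure j.
    apply: (etrans (congr1 _ (etrans (congr1 mu (setIT _)) E))); rewrite -EFinM; congr (_%:E).
    have -> : (4 ^+ j) ^+ n = (2 ^+ j) ^+ n * (2 ^+ j) ^+ n :> R.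
      by rewrite -exprMn -exprMn; congr (_ ^+ _ ^+ _); lra.
    rewrite [2 * (r / _)]mulrA expr_div_n.
    have : (2 ^+ j) ^+ n != 0 :> R by rewrite !expf_neq0.
    by move: ((2 ^+ j) ^+ n) ((2 * r) ^+ n) => x y x0; field.
  rewrite (eq_bigr (fun=> ((2 * r) ^+ n * (2 * r) ^+ n / 2)%:E)) // sumEFin -EFinM lee_fin.
  rewrite sumr_const card_ord -mulr_natr /peak_lower /c.
  rewrite le_eqVlt; apply/orP; left; apply/eqP; field.
  by rewrite expf_neq0.
rewrite [leRHS]integral_mkcond.
apply: (ge0_ae_le_integral_lower (negligible_set0 mu)) => [p _|p _|p _ _].
- by rewrite mule_ge0 // ?lee_fin ?(ltW c0) //; apply: sume_ge0 => j _; rewrite lee_fin.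
- by rewrite patchE; case: ifP => // _; rewrite lee_fin sqr_ge0.
- rewrite patchE; case: ifPn => [_|].
    rewrite peak_sqr ?invr_gt0 ?exprn_gt0 // sumEFin -EFinM lee_fin /c mulrC.
    by rewrite ler_pdivrMr ?mulr_gt0 ?exprn_gt0 // mulrC nested_box_sum.
  move=> /negP; rewrite inE => pS; rewrite big1 ?mule0 // => j _.
  rewrite /g indicE memNset ?mulr0 // => pj; apply: pS; split; last by case: pj.
  apply: le_trans (nested_box_sqnorm_xy pj) _.
  rewrite ler_piMr ?divr_ge0 ?(ltW s10) // invf_le1 ?exprn_gt0 // exprn_ege1 //; lra.
Qed.

End peak_lower_bound.

(** * Sharpness of the constant *)

Section sharpness.
Context {R : realType} {n : nat}.
Local Notation mu := (@lebesgue_heis R n).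
Implicit Types (p v : heis R n).
Variables (s1 : R) (C : set (heis R n)).
Hypotheses (s10 : 0 < s1) (s11 : s1 <= 1) (n0 : (0 < n)%N).
Hypothesis Cz : forall p, C p -> 0 < hz p.
Hypothesis slabC : slab s1 `[1, 2] `<=` C.

Lemma slab_closed (k a b : R) : closed (slab k `[a, b] : set (heis R n)).
Proof.
have -> : slab k `[a, b] = (sqnorm_xy @^-1` [set x : R | x <= k]) `&`
    ((hz : heis R n -> R) @^-1` [set x | a <= x]) `&` ((hz : heis R n -> R) @^-1` [set x | x <= b]).
  apply/seteqP; split=> p; rewrite /slab /= in_itv /=; first by move=> [? /andP[? ?]].
  by move=> [[-> ->] ->].
apply: closedI; first apply: closedI.
- by apply: preimage_closed => [p _|]; [exact: sqnorm_xy_continuous|exact: closed_le].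
- by apply: preimage_closed => [p _|]; [exact: hz_continuous|exact: closed_ge].
- by apply: preimage_closed => [p _|]; [exact: hz_continuous|exact: closed_le].
Qed.

Lemma slab_cube (k a b : R) : k <= 1 -> -2 <= a -> b <= 2 -> (slab k `[a, b] : set (heis R n)) `<=` cube 2.
Proof.
move=> k1 a2 b2 p [sk]; rewrite in_itv /= => /andP[az zb].
have coord i : hx i p ^+ 2 + hy i p ^+ 2 <= 1.
  apply: le_trans (le_trans sk k1); rewrite sqnorm_xyE (bigD1 i) //= lerDl.
  by apply: sumr_ge0 => j _; rewrite addr_ge0 ?sqr_ge0.
split=> [i|i|]; rewrite /= in_itv /=; apply/andP; split.
all: try (by move: (coord i); nra).
all: lra.
Qed.

Section fixed_width.
Variable e : R.
Hypothesis e0 : 0 < e.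
Let u : heis R n -> R := profile e s1.

Lemma profile_support : [set p | u p != 0] `<=` slab s1 `[1, 2].
Proof.
move=> p; rewrite /u /profile /bs /bz /slab /= in_itv /=; apply: contra_neqP => H.
have [sp|sp] := leP (sqnorm_xy p) s1; last first.
  by rewrite (bumpe_le0 _ (_ : s1 - sqnorm_xy p <= 0)) ?mulr0 ?mul0r // subr_le0 ltW.
have [z1|z1] := leP 1 (hz p); last first.
  by rewrite (bumpe_le0 _ (_ : hz p - 1 <= 0)) ?mul0r ?mulr0 // subr_le0 ltW.
have [z2|z2] := leP (hz p) 2; last first.
  by rewrite (bumpe_le0 _ (_ : 2 - hz p <= 0)) ?mulr0 // subr_le0 ltW.
by exfalso; apply: H; rewrite z1 z2.
Qed.

Lemma profile_test_function : test_function C u.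
Proof.
have clS : closure [set p | u p != 0] `<=` slab s1 `[1, 2].
  apply: subset_trans (closure_subset profile_support) _.
  by rewrite -(closure_id _).1 //; exact: slab_closed.
split; first by apply: elementary_smooth; exact: profile_elementary.
- apply: (subclosed_compact _ (@cube_compact R n 2)); first exact: closed_closure.
  by apply: subset_trans clS _; apply: slab_cube s11 _ _; lra.
- exact: subset_trans clS slabC.
Qed.

Lemma profile_neq0 : u <> cst 0.
Proof.
move=> /(congr1 (fun f => f ((0, 0, 3 / 2) : heis R n))) /=.
have s0 : sqnorm_xy ((0, 0, 3 / 2) : heis R n) = 0.
  by rewrite /sqnorm_xy big1 // => i _; rewrite !mxE expr0n addr0.
apply/eqP; rewrite gt_eqF //; apply: mulr_gt0; first apply: mulr_gt0.
- exact: peak_gt0.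
- by apply: bumpe_gt0; rewrite s0 subr0.
- by apply: mulr_gt0; apply: bumpe_gt0; rewrite /hz /=; lra.
Qed.

(** On [s <= s1 / 2], [5 / 4 <= z <= 7 / 4], the three cutoffs are at least their values at distance
    [s1 / 2], [1 / 4] and [1 / 4] from where they vanish. *)
Definition rhs_lower : R :=
  2 * fieldA_lower * (bumpe 0 (s1 / 2) * (bumpe 0 (1 / 4) * bumpe 0 (1 / 4))) ^+ 2.

Lemma rhs_lower_gt0 : 0 < rhs_lower.
Proof.
apply: mulr_gt0; first by apply: mulr_gt0 => //; exact: fieldA_lower_gt0.
apply: exprn_gt0; apply: mulr_gt0; first by apply: bumpe_gt0; exact: divr_gt0.
by apply: mulr_gt0; apply: bumpe_gt0; exact: divr_gt0.
Qed.

Lemma profile_rhs_pointwise p : 0 < sqnorm_xy p -> sqnorm_xy p <= s1 / 2 ->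
  5 / 4 <= hz p -> hz p <= 7 / 4 ->
  rhs_lower * peak e p ^+ 2 <= u p ^+ 2 * (2 * fieldA p).
Proof.
move=> s0 sp z1 z2; have [s1p s1le] : 0 < s1 /\ s1 <= 1 by [].
have AL : fieldA_lower <= fieldA p by apply: fieldA_ge => //; lra.
have AL0 := @fieldA_lower_gt0 R.
have b1 : bumpe 0 (s1 / 2) <= bs s1 p by apply: bumpe0_nondecreasing; lra.
have b2 : bumpe 0 (1 / 4) <= bumpe 0 (hz p - 1) by apply: bumpe0_nondecreasing; lra.
have b3 : bumpe 0 (1 / 4) <= bumpe 0 (2 - hz p) by apply: bumpe0_nondecreasing; lra.
have bb : bumpe 0 (s1 / 2) * (bumpe 0 (1 / 4) * bumpe 0 (1 / 4)) <= bs s1 p * bz p.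
  by apply: ler_pM b1 _ => //; [exact: bumpe_ge0|exact: mulr_ge0 (bumpe_ge0 _ _) (bumpe_ge0 _ _)|
    apply: ler_pM b2 b3; exact: bumpe_ge0].
have b0 : 0 <= bumpe 0 (s1 / 2) * (bumpe 0 (1 / 4) * bumpe 0 (1 / 4)).
  exact: mulr_ge0 (bumpe_ge0 _ _) (mulr_ge0 (bumpe_ge0 _ _) (bumpe_ge0 _ _)).
have b2b : (bumpe 0 (s1 / 2) * (bumpe 0 (1 / 4) * bumpe 0 (1 / 4))) ^+ 2 <= (bs s1 p * bz p) ^+ 2.
  by rewrite lerXn2r ?nnegrE // (le_trans b0).
rewrite /rhs_lower /u /profile; move: b2b (sqr_ge0 (peak e p)).
have -> : (peak e p * bs s1 p * bz p) ^+ 2 * (2 * fieldA p) =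
  2 * fieldA p * (bs s1 p * bz p) ^+ 2 * peak e p ^+ 2.
  by move: (fieldA p) (peak e p) (bs s1 p) (bz p) => A g b b'; ring.
move: ((_ * (_ * _)) ^+ 2) (sqr_ge0 (bumpe 0 (s1 / 2) * (bumpe 0 (1 / 4) * bumpe 0 (1 / 4))))
  ((bs s1 p * bz p) ^+ 2) (peak e p ^+ 2) => b bge b' g bb' g0.
apply: ler_wpM2r => //; apply: ler_pM => //; first by rewrite mulr_ge0 // ltW.
by rewrite ler_pM2l.
Qed.

Lemma profile_rhs_ge :
  (rhs_lower%:E * \int[mu]_(p in slab (s1 / 2)%R `[(5 / 4)%R, (7 / 4)%R]) (peak e p ^+ 2)%:E
    <= hardy_rhs C u)%E.
Proof.
rewrite -ge0_integralZl; last 4 first.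
- exact: measurable_slab.
- exact: measurable_peak_sqr.
- by move=> p _; rewrite lee_fin sqr_ge0.
- by rewrite lee_fin ltW // rhs_lower_gt0.
rewrite /hardy_rhs [leLHS]integral_mkcond [leRHS]integral_mkcond.
apply: (ge0_ae_le_integral_lower (center_negligible n0)) => [p _|p _|p _ sn].
- rewrite patchE; case: ifP => // _.
  by rewrite -EFinM lee_fin mulr_ge0 ?sqr_ge0 // ltW // rhs_lower_gt0.
- exact: hardy_rhs_integrand_ge0.
- have s0 := sqnorm_xy_gt0 sn.
  rewrite patchE; case: ifPn => [/set_mem pS|_]; last first.
    exact: hardy_rhs_integrand_ge0.
  case: pS => sp; rewrite in_itv /= => /andP[z1 z2].
  have s1p : 0 < s1 by [].
  have Cp : C p by apply: slabC; split; [lra|rewrite in_itv /=; apply/andP; split; lra].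
  have z0 := Cz Cp.
  have -> : ((fun x : heis R n => (`|u x| ^+ 2 / cc_dist0 x ^+ 2 * psi x)%:E) \_ C) p =
      (u p ^+ 2 * (2 * fieldA p))%:E.
    by rewrite patchE mem_set // real_normK ?num_real // -psi_dist // mulrAC -mulrA.
  rewrite -EFinM lee_fin; exact: profile_rhs_pointwise.
Qed.

End fixed_width.

(** The error [s * peak ^ 2] is split at [s = k]. Below, it is at most [k * peak ^ 2], a small
    multiple of what bounds [hardy_rhs] from below; above, [s <= 1] and [peak ^ 2 <= k ^- n],
    uniformly in [e]. *)
Lemma profile_err_integral (tau k e : R) : 0 < e -> 0 < tau -> 0 < k -> k <= s1 / 2 ->
  (hardy_lhs C (profile e s1) <=
   ((1 + tau) ^+ 2 * (n%:R ^+ 2 / 4))%:E * hardy_rhs C (profile e s1) +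
   (err_const tau)%:E * ((2 * k)%:E *
     \int[mu]_(p in slab (s1 / 2)%R `[(5 / 4)%R, (7 / 4)%R]) (peak e p ^+ 2)%:E +
   (k ^- n)%:E * mu (cube 2)))%E.
Proof.
move=> e0 t0 k0 ks; have s1le : s1 <= 1 by [].
have E0 : 0 <= err_const tau := ltW (err_const_gt0 t0).
have kn0 : 0 <= k ^- n by rewrite invr_ge0 exprn_ge0 // ltW.
pose g1 p := peak e p ^+ 2 * \1_(slab k `[1, 2]) p.
pose g2 p := \1_(cube 2) p : R.
have g10 p : 0 <= g1 p by rewrite mulr_ge0 ?sqr_ge0.
have g20 p : 0 <= g2 p by rewrite /g2.
have mg1 : measurable_fun setT (g1 : mheis R n -> R).
  apply: measurable_funM; first by apply/measurable_EFinP; exact: measurable_peak_sqr.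
  by apply: measurable_indic; exact: measurable_slab.
have mg2 : measurable_fun setT (g2 : mheis R n -> R).
  by apply: measurable_indic; exact: measurable_cube.
pose h p := err_const tau * (k * g1 p + k ^- n * g2 p).
have h0 p : 0 <= h p.
  exact: mulr_ge0 E0 (addr_ge0 (mulr_ge0 (ltW k0) (g10 p)) (mulr_ge0 kn0 (g20 p))).
have mh : measurable_fun setT (h : mheis R n -> R).
  by apply: measurable_funM => //; apply: measurable_funD; apply: measurable_funM.
have a0 : 0 <= (1 + tau) ^+ 2 * (n%:R ^+ 2 / 4).
  by rewrite mulr_ge0 ?sqr_ge0 // divr_ge0 ?sqr_ge0.
have H := hardy_lhs_le Cz (profile_test_function e0) n0 a0 h0 mh.
apply: le_trans (H _) _ => [p s0 z0|].
  apply: le_trans (profile_upper e0 s11 t0 s0 z0) _; rewrite lerD2l /h -mulrA.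
  apply: (ler_wpM2l E0); rewrite /g1 /g2.
  have [reg|_] := boolP (region s1 p); last first.
    by rewrite mulr0; exact: (addr_ge0 (mulr_ge0 (ltW k0) (g10 p)) (mulr_ge0 kn0 (g20 p))).
  have /andP[ss zz] := reg; have g0 := sqr_ge0 (peak e p).
  have sl : slab s1 `[1, 2] p by split; rewrite ?in_itv.
  have c2 : cube 2 p by apply: slab_cube sl; lra.
  rewrite mulr1 [\1_(cube 2) p]indicE mem_set // mulr1.
  have [sk|sk] := leP (sqnorm_xy p) k.
    rewrite indicE mem_set ?mulr1; last by split; rewrite ?in_itv.
    by apply: ler_wpDr => //; exact: ler_wpM2r.
  apply: ler_wpDl; first exact: (mulr_ge0 (ltW k0) (g10 p)).
  apply: (@le_trans _ _ (1 * (peak e p ^+ 2))); first by apply: ler_wpM2r => //; lra.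
  rewrite mul1r peak_sqr // lef_pV2 ?posrE ?exprn_gt0 ?se_gt0 //.
  rewrite lerXn2r ?nnegrE ?(ltW k0) ?(ltW (se_gt0 e0 p)) //.
  by have := e0; lra.
rewrite leeD2l //.
have -> : (\int[mu]_p (h p)%:E =
    (err_const tau)%:E * (k%:E * \int[mu]_p (g1 p)%:E + (k ^- n)%:E * \int[mu]_p (g2 p)%:E))%E.
  have mE1 : measurable_fun setT (fun p : mheis R n => (g1 p)%:E) by exact/measurable_EFinP.
  have mE2 : measurable_fun setT (fun p : mheis R n => (g2 p)%:E) by exact/measurable_EFinP.
  have e10 (p : mheis R n) : setT p -> (0 <= (g1 p)%:E)%E by rewrite lee_fin.
  have e20 (p : mheis R n) : setT p -> (0 <= (g2 p)%:E)%E by rewrite lee_fin.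
  have kE : (0 <= k%:E)%E by rewrite lee_fin ltW.
  have knE : (0 <= (k ^- n)%:E)%E by rewrite lee_fin.
  have EE : (0 <= (err_const tau)%:E)%E by rewrite lee_fin.
  rewrite -(ge0_integralZl mu measurableT mE1 e10 kE) -(ge0_integralZl mu measurableT mE2 e20 knE).
  have f10 (p : mheis R n) : setT p -> (0 <= k%:E * (g1 p)%:E)%E by move=> pT; exact: mule_ge0 kE (e10 p pT).
  have f20 (p : mheis R n) : setT p -> (0 <= (k ^- n)%:E * (g2 p)%:E)%E by move=> pT; exact: mule_ge0 knE (e20 p pT).
  have mF1 := measurable_funeM k%:E mE1; have mF2 := measurable_funeM (k ^- n)%:E mE2.
  rewrite -(ge0_integralD mu measurableT f10 mF1 f20 mF2).
  rewrite -ge0_integralZl //.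
  - exact: emeasurable_funD.
  - by move=> p _; rewrite adde_ge0 ?f10 ?f20.
have I1 : (\int[mu]_p (g1 p)%:E = \int[mu]_(p in slab k `[1%R, 2%R]) (peak e p ^+ 2)%:E)%E.
  rewrite [RHS]integral_mkcond; apply: eq_integral => p _; rewrite patchE /g1 indicE.
  by case: (p \in _); rewrite ?mulr1 ?mulr0.
have I2 : (\int[mu]_p (g2 p)%:E = mu (cube 2))%E.
  by rewrite integral_indic ?setIT //; exact: measurable_cube.
rewrite I1 I2; apply: lee_wpmul2l; first by rewrite lee_fin.
rewrite leeD2r // [(2 * k)%R]mulrC EFinM -muleA; apply: lee_wpmul2l; first by rewrite lee_fin ltW.
exact: peak_integral_le.
Qed.

(** The excess [d] is shared in three: [tau] takes care of the constant, [k] of the error near the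
    center, and [J], chosen last, lets the divergence of [hardy_rhs] absorb the error away from the
    center, which is fixed by then. *)
Lemma hardy_sharp (d : R) : 0 < d -> exists u, [/\ test_function C u, u <> cst 0 &
  (hardy_lhs C u <= (n%:R ^+ 2 / 4 + d)%:E * hardy_rhs C u)%E].
Proof.
move=> d0; have [s1p s1le] : 0 < s1 /\ s1 <= 1 by [].
have m0 : 0 < n%:R ^+ 2 :> R by rewrite exprn_gt0 // ltr0n.
(* For [tau <= 1] one has [(1 + tau) ^ 2 <= 1 + 3 tau], and the second bound makes [3 tau n ^ 2 / 4]
   at most [d / 3]. *)
pose tau : R := Num.min 1 (4 * d / (9 * n%:R ^+ 2)).
have t0 : 0 < tau by rewrite lt_min ltr01 /=; apply: divr_gt0; apply: mulr_gt0.
have t1 : tau <= 1 by rewrite ge_min lexx.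
have ta : (1 + tau) ^+ 2 * (n%:R ^+ 2 / 4) <= n%:R ^+ 2 / 4 + d / 3.
  have : tau <= 4 * d / (9 * n%:R ^+ 2) by rewrite ge_min lexx orbT.
  have m9 : 0 < 9 * n%:R ^+ 2 :> R by exact: mulr_gt0.
  by rewrite ler_pdivlMr //; move: tau t0 t1 (n%:R ^+ 2) m0 {m9} => t t0 t1 m mp; nra.
have E0 := err_const_gt0 t0.
move: (err_const tau) E0 (profile_err_integral (tau := tau)) => E E0 perr.
have c00 := rhs_lower_gt0; move: rhs_lower c00 profile_rhs_ge => c0 c00 rge.
(* Chosen for [E * (2 * k / c0) <= d / 3], the integral of [peak ^ 2] being at most [hardy_rhs]
   divided by [c0]. *)
pose k : R := Num.min (s1 / 2) (d * c0 / (6 * E)).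
have k0 : 0 < k by rewrite lt_min divr_gt0 //=; apply: divr_gt0; exact: mulr_gt0.
have ks : k <= s1 / 2 by rewrite ge_min lexx.
have kE : E * (2 * k / c0) <= d / 3.
  have : k <= d * c0 / (6 * E) by rewrite ge_min lexx orbT.
  rewrite ler_pdivlMr ?mulr_gt0 // => H.
  by rewrite mulrA ler_pdivrMr //; nra.
have kn0 : 0 < k ^- n by rewrite invr_gt0 exprn_gt0.
have c20 := peak_lower_gt0 s10 n0; move: (@peak_lower R n s1) c20 (@peak_integral_ge R n s1 s10 s11 n0) => c2 c20 pge.
pose V := fine (mu (cube 2)).
have VE : mu (cube 2) = V%:E by rewrite fineK // ge0_fin_numE ?measure_ge0 ?cube_measure_lty.
have V0 : 0 <= V by rewrite fine_ge0 // measure_ge0.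
(* As [hardy_rhs] is at least [c0 * c2 * J], the remaining error is at most a third of
   [d * hardy_rhs]. *)
have [J HJ] : exists J : nat, 3 * (E * (k ^- n * V)) / (d * c0 * c2) <= J%:R.
  exists (Num.truncn (3 * (E * (k ^- n * V)) / (d * c0 * c2))).+1.
  by apply: ltW; exact: truncnS_gt.
have e0 : 0 < 4 ^- J :> R by rewrite invr_gt0 exprn_gt0.
exists (profile (4 ^- J) s1); have tu := profile_test_function e0.
split => //; first exact: profile_neq0.
have rlty := hardy_rhs_lty Cz tu n0; have rgt := hardy_rhs_gt0 Cz tu n0 (@profile_neq0 _).
have := perr k _ e0 t0 k0 ks; have := rge _ e0; have := pge J; rewrite VE.
have I0 : (0 <= \int[mu]_(p in slab (s1 / 2)%R `[(5 / 4)%R, (7 / 4)%R]) (peak (4 ^- J)%R p ^+ 2)%:E)%E.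
  by apply: integral_ge0 => p _; rewrite lee_fin sqr_ge0.
move: rlty rgt I0; set X := hardy_rhs _ _; move: (\int[mu]_(p in slab _ _) _)%E X => I [x| |] // _.
rewrite lte_fin => x0.
(* An infinite integral of [peak ^ 2] would make [hardy_rhs] infinite, against [hardy_rhs_lty]. *)
case: I => [i| |] //; last by rewrite gt0_muley // lte_fin.
rewrite -!(EFinM, EFinD) !lee_fin => i0 ci ix lhs; apply: le_trans lhs _; rewrite lee_fin.
have H2 : E * (k ^- n * V) <= d / 3 * x.
  have cx : c0 * (c2 * J%:R) <= x by apply: le_trans ix; rewrite ler_pM2l.
  move: HJ; rewrite ler_pdivrMr ?mulr_gt0 // => HJ.
  have : d * (c0 * (c2 * J%:R)) <= d * x by rewrite ler_pM2l.
  by move: (E * _) HJ => y HJ H; nra.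
have H1 : E * (2 * k * i) <= d / 3 * x.
  have ix' : i <= x / c0 by rewrite ler_pdivlMr // mulrC.
  have : E * (2 * k / c0) * x <= d / 3 * x by rewrite ler_pM2r.
  apply: le_trans; have -> : E * (2 * k / c0) * x = E * (2 * k * (x / c0)).
    by move: (k) (c0^-1) => k' c'; ring.
  by rewrite ler_pM2l // ler_pM2l // mulr_gt0.
have H3 : (1 + tau) ^+ 2 * (n%:R ^+ 2 / 4) * x <= (n%:R ^+ 2 / 4 + d / 3) * x by rewrite ler_pM2r.
rewrite mulrDr; lra.
Qed.

End sharpness.

(** A point with [b = s / z] is dilated to the sphere at the height [w] solving [w ^ 2 + b w = 1],
    and the claim is [w > c]. For [z >= 1] and [s <= 1 - c ^ 2] one has [b <= 1 - c ^ 2], so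
    [w <= c] would give [1 <= c ^ 2 + (1 - c ^ 2) c], whose right side is less than [1]. *)
Lemma homogeneous_cone_slab {R : realType} {n : nat} (S : set (heis R n)) :
  spherical_cap S -> exists s1 : R, [/\ 0 < s1, s1 <= 1 & slab s1 `[1, 2] `<=` homogeneous_cone S].
Proof.
move=> [c /andP[c0 c1] ->]; exists (1 - c ^+ 2); split; [nra|nra|].
move=> p [sp]; rewrite in_itv /= => /andP[z1 _]; have z0 : 0 < hz p by lra.
have s0 := sqnorm_xy_ge0 p.
pose b := sqnorm_xy p / hz p.
have b0 : 0 <= b by rewrite divr_ge0 // ltW.
have b1 : b <= 1 - c ^+ 2 by rewrite ler_pdivrMr //; nra.
pose q := Num.sqrt (b ^+ 2 + 4); pose w := (q - b) / 2.
have qq : q ^+ 2 = b ^+ 2 + 4 by rewrite sqr_sqrtr //; nra.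
have q0 : 0 <= q by exact: sqrtr_ge0.
have w0 : 0 < w by rewrite /w divr_gt0 // subr_gt0; nra.
have wE : w ^+ 2 + b * w = 1.
  have -> : w ^+ 2 + b * w = (q ^+ 2 - b ^+ 2) / 4 by rewrite /w; field.
  by rewrite qq; field.
have wc : c < w.
  rewrite ltNge; apply/negP => wc.
  have : w ^+ 2 + b * w <= c ^+ 2 + b * c.
    by apply: lerD; [rewrite lerXn2r ?nnegrE // ltW|exact: ler_wpM2l].
  rewrite wE; have : b * c <= (1 - c ^+ 2) * c by apply: ler_wpM2r.
  have : 0 < (1 - c ^+ 2) * (1 - c) by apply: mulr_gt0; nra.
  by move: (b * c) => y; nra.
pose l := Num.sqrt (w / hz p).
have l0 : 0 < l by rewrite sqrtr_gt0 divr_gt0.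
have ll : l ^+ 2 = w / hz p by rewrite sqr_sqrtr // divr_ge0 ?ltW.
have dz : hz (dilation l p) = w by rewrite /hz /= ll divfK ?gt_eqF.
have ds : sqnorm_xy (dilation l p) = l ^+ 2 * sqnorm_xy p.
  rewrite /sqnorm_xy mulr_sumr; apply: eq_bigr => i _.
  by rewrite /dilation /= !mxE; ring.
exists l^-1, (dilation l p); split; first by rewrite invr_gt0.
- have dz2 : (dilation l p).2 = w := dz.
  split; last by move: wc; rewrite -dz2.
  split; last by move: w0; rewrite -dz2.
  by rewrite dz2 ds ll -wE /b; field; rewrite gt_eqF.
- rewrite /dilation /= !scalerA mulrA -exprMn mulVf ?gt_eqF // expr1n !scale1r mul1r.
  by case: p {sp z1 z0 s0 b b0 b1 q w qq q0 w0 wE wc ll dz ds l l0} => -[].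
Qed.

Unset Implicit Arguments.
Set Strict Implicit.
Set Printing Implicit Defensive.

Theorem theorem5 (R : realType) (n : nat) (hn : (1 <= n)%N)
    (Sigma : set (heis R n)) (hSigma : spherical_cap Sigma) :
  (forall u : heis R n -> R, test_function (homogeneous_cone Sigma) u ->
    ((n%:R ^+ 2 / 4)%:E * hardy_rhs (homogeneous_cone Sigma) u
       <= hardy_lhs (homogeneous_cone Sigma) u)%E) /\
  ereal_inf [set (hardy_lhs (homogeneous_cone Sigma) u /
                  hardy_rhs (homogeneous_cone Sigma) u)%E |
             u in [set u : heis R n -> R |
                     test_function (homogeneous_cone Sigma) u /\ u <> cst 0]]
    = (n%:R ^+ 2 / 4)%:E.
Proof.
set C := homogeneous_cone Sigma.
have Cz p : C p -> 0 < hz p by exact: homogeneous_cone_hz.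
have hardy u : test_function C u -> ((n%:R ^+ 2 / 4)%:E * hardy_rhs C u <= hardy_lhs C u)%E.
  by move=> tu; exact: test_function_hardy.
split=> //.
(* Every denominator is a positive real, so the quotients of extended reals have their usual
   meaning. *)
have rhsE u : test_function C u -> u <> cst 0 -> exists2 x : R, 0 < x & hardy_rhs C u = x%:E.
  move=> tu u0; have := hardy_rhs_gt0 Cz tu hn u0; have := hardy_rhs_lty Cz tu hn.
  by case: (hardy_rhs C u) => [x _|//|//]; rewrite lte_fin => x0; exists x.
apply/eqP; rewrite eq_le; apply/andP; split; last first.
  apply: le_ereal_inf_tmp => _ [u [tu u0] <-]; have [x x0 xE] := rhsE u tu u0.
  by have := hardy u tu; rewrite xE inver gt_eqF // lee_pdivlMr.
have [s1 [s10 s11 slabC]] := homogeneous_cone_slab hSigma.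
apply/lee_addgt0Pr => d d0; have [u [tu u0 ub]] := hardy_sharp s10 s11 hn Cz slabC d0.
have [x x0 xE] := rhsE u tu u0.
apply: le_trans (ereal_inf_lbound _) _; first by exists u.
by move: ub; rewrite xE inver gt_eqF // lee_pdivrMr.
Qed.
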